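(* Let $(M,D,g)$ be a time-oriented sub-Lorentzian manifold and let $\gamma:[a,b]\to M$ be a timelike future directed normal extremal trajectory. Then for each $t\in[a,b]$ there exists a neighborhood $U$ of $\gamma(t)$ such that the restriction of $\gamma$ to $U$ is the unique maximizer connecting its endpoints. Precisely: if $J\subset[a,b]$ denotes the connected component of $\gamma^{-1}(U)$ containing $t$, then for all $t_1<t_2$ in $J$ the curve $\gamma|_{[t_1,t_2]}$ is a $U$-maximizer, and every $U$-maximizer from $\gamma(t_1)$ to $\gamma(t_2)$ is a reparametrization of $\gamma|_{[t_1,t_2]}$.
   Context: A sub-Lorentzian manifold is a triple $(M,D,g)$, where $M$ is a smooth $n$-dimensional manifold, $D\subset TM$ is a smooth distribution (of rank $r$) and $g$ is a smoothly varying Lorentzian metric (nondegenerate, index 1) on $D$. An absolutely continuous curve is horizontal if its derivative lies in $D$ almost everywhere. A vector $v\in D_p$ is timelike if $g(v,v)<0$ and non-spacelike (nspc.) if $g(v,v)\le 0$. A horizontal curve is timelike (resp. nspc.) if its tangent vector is timelike (resp. nspc.) almost everywhere. A time orientation is a continuous timelike vector field $X$ on $M$; a nspc. vector $v\in D_p$ is future directed (f.d.) if $g(v,X(p))<0$; a nspc. curve is f.d. if its tangent vectors are f.d. almost everywhere. The length of a nspc. horizontal curve $\eta:[\alpha,\beta]\to M$ is $l(\eta)=\int_\alpha^\beta\sqrt{|g(\dot\eta,\dot\eta)|}\,ds$. For an open set $U\subset M$ and $q_1,q_2\in U$, let $H_U(q_1,q_2)$ be the set of nspc. f.d. curves contained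 in $U$ joining $q_1$ to $q_2$, and $d_U(q_1,q_2)=\sup\{l(\eta):\eta\in H_U(q_1,q_2)\}$ if $H_U(q_1,q_2)\ne\emptyset$, $d_U(q_1,q_2)=0$ otherwise. A curve $\eta\in H_U(q_1,q_2)$ is a $U$-maximizer if $l(\eta)=d_U(q_1,q_2)$. The sub-Lorentzian Hamiltonian $H:T^*M\to\mathbb{R}$ is given, in terms of a local $g$-orthonormal frame $X_1,\dots,X_r$ of $D$ with $g(X_1,X_1)=-1$ and $g(X_i,X_i)=1$ for $i\ge2$, by $H(x,\lambda)=-\frac12\langle\lambda,X_1(x)\rangle^2+\frac12\sum_{i=2}^r\langle\lambda,X_i(x)\rangle^2$ (independent of the choice of frame). A normal extremal trajectory is a curve $\gamma:[a,b]\to M$ admitting a lift $\Gamma:[a,b]\to T^*M$ that is a solution of the Hamiltonian system with Hamiltonian $H$. *)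

(* Defs.v *)
(* MathComp / MathComp-Analysis. *)
From HB Require Import structures.
From mathcomp Require Import all_boot all_order all_algebra.
From mathcomp Require Import all_classical all_reals all_analysis.

Set Implicit Arguments.
Unset Strict Implicit.
Unset Printing Implicit Defensive.

Import Order.TTheory GRing.Theory Num.Theory numFieldNormedType.Exports.

Local Open Scope classical_set_scope.
Local Open Scope ring_scope.

Section Calculus.
Variable R : realType.

(* On an open set A: the partial derivatives of all orders up to k exist
   and those of order exactly k are continuous. *)
Fixpoint Ck (n : nat) (V : normedModType R) (k : nat) (A : set 'rV[R]_n)
    (f : 'rV[R]_n -> V) : Prop :=
  match k with
  | 0 => forall x, A x -> {for x, continuous f}
  | k'.+1 => forall i : 'I_n,
      (forall x, A x -> derivable f x (delta_mx 0 i)) /\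
      Ck k' A ('D_(delta_mx 0 i) f)
  end.

Definition smooth_on (n : nat) (V : normedModType R) (A : set 'rV[R]_n)
    (f : 'rV[R]_n -> V) : Prop :=
  forall k, Ck k A f.

(* Derivative at t relative to A; one-sided at an endpoint of an interval. *)
Definition has_derivative_within (V : normedModType R) (A : set R)
    (f : R -> V) (t : R) (v : V) : Prop :=
  (fun s => (s - t)^-1 *: (f s - f t)) @ within A t^' --> v.

Definition absolutely_continuous (V : normedModType R) (a b : R)
    (f : R -> V) : Prop :=
  forall e : R, 0 < e -> exists2 d : R, 0 < d &
    forall (N : nat) (u v : 'I_N -> R),
      (forall i, [/\ a <= u i, u i <= v i & v i <= b]) ->
      trivIset [set: 'I_N] (fun i => [set` `]u i, v i[]) ->
      \sum_(i < N) (v i - u i) < d ->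
      \sum_(i < N) `|f (v i) - f (u i)| < e.

End Calculus.

(* A Hausdorff second countable smooth manifold of dimension n, given by an
   atlas of charts phi c : dom c -> R^n with inverses psi c.  The total
   functions phi c and psi c are only meaningful on dom c and on phi c (dom c).
   chart_at p is a chart around p, singled out to represent vectors at p. *)
Record smoothManifold (R : realType) (n : nat) := SmoothManifold {
  carrier :> topologicalType;
  chart : Type;
  dom : chart -> set carrier;
  phi : chart -> carrier -> 'rV[R]_n;
  psi : chart -> 'rV[R]_n -> carrier;
  chart_at : carrier -> chart;
  manifold_hausdorff : hausdorff_space carrier;
  manifold_second_countable : @second_countable carrier;
  dom_open : forall c, open (dom c);
  codom_open : forall c, open (phi c @` dom c);
  phiK : forall c p, dom c p -> psi c (phi c p) = p;
  phi_continuous : forall c p, dom c p -> {for p, continuous (phi c)};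
  psi_continuous : forall c x, (phi c @` dom c) x ->
    {for x, continuous (psi c)};
  dom_chart_at : forall p, dom (chart_at p) p;
  transition_smooth : forall c c',
    smooth_on (phi c @` (dom c `&` dom c')) (phi c' \o psi c)
}.

Arguments chart {R n} s.
Arguments dom {R n} s c.
Arguments phi {R n} s c.
Arguments psi {R n} s c.
Arguments chart_at {R n} s p.

(* The tangent space T_p M is 'rV[R]_n: a row vector v stands for the tangent
   vector with components v in chart_at M p.  The cotangent space is its dual
   'cV[R]_n, with pairing <l, v> = v *m l.  As chart_at M p need not depend
   continuously on p, regularity of vector fields and covectors along curves is
   always expressed in the components with respect to a fixed chart c. *)
Section Tangent.
Variables (R : realType) (n : nat) (M : smoothManifold R n).

Definition pairing (l : 'cV[R]_n) (v : 'rV[R]_n) : R := (v *m l) 0 0.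

(* For p in dom c, v |-> v *m coord_change c p maps the components in
   chart_at M p of a vector of T_p M to its components in c. *)
Definition coord_change (c : chart M) (p : M) : 'M[R]_n :=
  jacobian (phi M c \o psi M (chart_at M p)) (phi M (chart_at M p) p).

(* Components in c of the covector l at p, for p in dom c. *)
Definition covector_coord (c : chart M) (p : M) (l : 'cV[R]_n) : 'cV[R]_n :=
  invmx (coord_change c p) *m l.

Definition field_coord (c : chart M) (X : M -> 'rV[R]_n) (x : 'rV[R]_n) :
    'rV[R]_n :=
  X (psi M c x) *m coord_change c (psi M c x).

Definition smooth_function (W : set M) (f : M -> R) : Prop :=
  forall c, smooth_on (phi M c @` (W `&` dom M c)) (f \o psi M c : _ -> R^o).

Definition smooth_field (W : set M) (X : M -> 'rV[R]_n) : Prop :=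
  forall c, smooth_on (phi M c @` (W `&` dom M c)) (field_coord c X).

Definition continuous_field (X : M -> 'rV[R]_n) : Prop :=
  forall c x, (phi M c @` dom M c) x -> {for x, continuous (field_coord c X)}.

Definition smooth_distribution (r : nat) (D : M -> {vspace 'rV[R]_n}) : Prop :=
  forall p, exists (W : set M) (X : 'I_r -> M -> 'rV[R]_n),
    [/\ open W, W p, forall i, smooth_field W (X i) &
        forall q, W q -> basis_of (D q) [tuple X i q | i < r]].

End Tangent.

Section BilinearForm.
Variables (R : realType) (n : nat).
Variables (D : {vspace 'rV[R]_n}) (g : 'rV[R]_n -> 'rV[R]_n -> R).

Definition symmetric_bilinear_on : Prop :=
  (forall v w, v \in D -> w \in D -> g v w = g w v) /\
  (forall (k : R) u v w, u \in D -> v \in D -> w \in D ->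
     g (k *: u + v) w = k * g u w + g v w).

Definition nondegenerate_on : Prop :=
  forall v, v \in D -> (forall w, w \in D -> g v w = 0) -> v = 0.

Definition negative_definite_on (V : {vspace 'rV[R]_n}) : Prop :=
  forall v, v \in V -> v != 0 -> g v v < 0.

(* The index is the largest dimension of a negative definite subspace. *)
Definition has_index (k : nat) : Prop :=
  (exists V : {vspace 'rV[R]_n},
     [/\ (V <= D)%VS, negative_definite_on V & \dim V = k]) /\
  (forall V : {vspace 'rV[R]_n},
     (V <= D)%VS -> negative_definite_on V -> (\dim V <= k)%N).

End BilinearForm.

(* g p is only meaningful on D p. *)
Record subLorentzian (R : realType) (n : nat) (M : smoothManifold R n)
    (r : nat) := SubLorentzian {
  distr : M -> {vspace 'rV[R]_n};
  metric : M -> 'rV[R]_n -> 'rV[R]_n -> R;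
  distr_smooth : smooth_distribution r distr;
  metric_bilinear : forall p, symmetric_bilinear_on (distr p) (metric p);
  metric_nondegenerate : forall p, nondegenerate_on (distr p) (metric p);
  metric_index : forall p, has_index (distr p) (metric p) 1;
  metric_smooth : forall (W : set M) (Y Z : M -> 'rV[R]_n), open W ->
    smooth_field W Y -> smooth_field W Z ->
    (forall q, W q -> Y q \in distr q) -> (forall q, W q -> Z q \in distr q) ->
    smooth_function W (fun q => metric q (Y q) (Z q))
}.

(* A map defined on [cleft, cright]; the values of cmap elsewhere are
   irrelevant. *)
Record curve (R : realType) (M : Type) := Curve {
  cleft : R;
  cright : R;
  cmap : R -> M
}.

Section Curves.
Variables (R : realType) (n : nat) (M : smoothManifold R n).

Definition absolutely_continuous_curve (eta : curve R M) : Prop :=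
  [/\ cleft eta < cright eta,
      {within [set` `[cleft eta, cright eta]], continuous (cmap eta)} &
      forall c s t, cleft eta <= s -> s <= t -> t <= cright eta ->
        (forall u, s <= u <= t -> dom M c (cmap eta u)) ->
        absolutely_continuous s t (phi M c \o cmap eta)].

Definition velocity (eta : curve R M) (s : R) : 'rV[R]_n :=
  derive1 (phi M (chart_at M (cmap eta s)) \o cmap eta) s.

Definition tangents_ae (P : M -> 'rV[R]_n -> Prop) (eta : curve R M) : Prop :=
  {ae (@lebesgue_measure R), forall s, s \in `[cleft eta, cright eta] ->
     P (cmap eta s) (velocity eta s)}.

Definition reparametrization (eta zeta : curve R M) : Prop :=
  exists theta : R -> R,
    [/\ absolutely_continuous (cleft eta) (cright eta) (theta : R -> R^o),
        {in `[cleft eta, cright eta] &, {homo theta : s t / s < t}},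
        theta (cleft eta) = cleft zeta, theta (cright eta) = cright zeta &
        {in `[cleft eta, cright eta],
           forall s, cmap eta s = cmap zeta (theta s)}].

End Curves.

Section Causality.
Variables (R : realType) (n : nat) (M : smoothManifold R n) (r : nat).
Variable S : subLorentzian M r.

Definition timelike (p : M) (v : 'rV[R]_n) : Prop :=
  v \in distr S p /\ metric S p v v < 0.

Definition nonspacelike (p : M) (v : 'rV[R]_n) : Prop :=
  v \in distr S p /\ metric S p v v <= 0.

Definition horizontal_curve (eta : curve R M) : Prop :=
  absolutely_continuous_curve eta /\
  tangents_ae (fun p v => v \in distr S p) eta.

Definition timelike_curve (eta : curve R M) : Prop :=
  horizontal_curve eta /\ tangents_ae timelike eta.

Definition nonspacelike_curve (eta : curve R M) : Prop :=
  horizontal_curve eta /\ tangents_ae nonspacelike eta.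

Definition time_orientation (X : M -> 'rV[R]_n) : Prop :=
  continuous_field X /\ forall p, timelike p (X p).

Definition future_directed (X : M -> 'rV[R]_n) (p : M) (v : 'rV[R]_n) : Prop :=
  nonspacelike p v /\ metric S p v (X p) < 0.

Definition future_directed_curve (X : M -> 'rV[R]_n) (eta : curve R M) : Prop :=
  nonspacelike_curve eta /\ tangents_ae (future_directed X) eta.

Definition curve_length (eta : curve R M) : \bar R :=
  (\int[@lebesgue_measure R]_(s in [set` `[cleft eta, cright eta]])
     (Num.sqrt `|metric S (cmap eta s) (velocity eta s) (velocity eta s)|)%:E)%E.

Definition joining (X : M -> 'rV[R]_n) (U : set M) (q1 q2 : M) :
    set (curve R M) :=
  [set eta | [/\ future_directed_curve X eta,
                 forall s, s \in `[cleft eta, cright eta] -> U (cmap eta s),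
                 cmap eta (cleft eta) = q1 & cmap eta (cright eta) = q2]].

Definition distance (X : M -> 'rV[R]_n) (U : set M) (q1 q2 : M) : \bar R :=
  if `[< joining X U q1 q2 !=set0 >]
  then ereal_sup (curve_length @` joining X U q1 q2) else 0%E.

Definition maximizer (X : M -> 'rV[R]_n) (U : set M) (q1 q2 : M)
    (eta : curve R M) : Prop :=
  joining X U q1 q2 eta /\ curve_length eta = distance X U q1 q2.

End Causality.

Section Hamiltonian.
Variables (R : realType) (n : nat) (M : smoothManifold R n) (r : nat).
Variable S : subLorentzian M r.

(* The frame vector of index 0 is the timelike one. *)
Definition frame_sign (i : 'I_r) : R := if i == 0 :> nat then -1 else 1.

Definition orthonormal_frame (W : set M) (X : 'I_r -> M -> 'rV[R]_n) : Prop :=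
  [/\ open W, forall i, smooth_field W (X i),
      forall i q, W q -> X i q \in distr S q &
      forall i j q, W q ->
        metric S q (X i q) (X j q) = if i == j then frame_sign i else 0].

(* Local orthonormal frames exist around every point and the value below does
   not depend on the one used, so the set contains exactly one number. *)
Definition hamiltonian (p : M) (l : 'cV[R]_n) : R :=
  xget 0 [set h | exists (W : set M) (X : 'I_r -> M -> 'rV[R]_n),
    [/\ W p, orthonormal_frame W X &
        h = 2^-1 * \sum_(i < r) frame_sign i * pairing l (X i p) ^+ 2]].

(* The Hamiltonian in the canonical coordinates (x, xi) on T*M induced by the
   chart c. *)
Definition hamiltonian_coord (c : chart M) (x : 'rV[R]_n) (xi : 'cV[R]_n) : R :=
  hamiltonian (psi M c x) (coord_change c (psi M c x) *m xi).

(* s |-> (gamma s, l s) solves Hamilton's equations x' = dH/dxi,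
   xi' = - dH/dx on [a, b] in the canonical coordinates of every chart. *)
Definition hamiltonian_solution (a b : R) (gamma : R -> M) (l : R -> 'cV[R]_n) :
    Prop :=
  {within [set` `[a, b]], continuous gamma} /\
  forall (c : chart M) (t : R), t \in `[a, b] -> dom M c (gamma t) ->
    let x := phi M c \o gamma in
    let xi := fun s => covector_coord c (gamma s) (l s) in
    has_derivative_within [set` `[a, b]] x t
      (\row_i 'D_(delta_mx i 0) (hamiltonian_coord c (x t) : _ -> R^o) (xi t))
    /\
    has_derivative_within [set` `[a, b]] xi t
      (- \col_i 'D_(delta_mx 0 i)
                  ((fun y => hamiltonian_coord c y (xi t)) : _ -> R^o) (x t)).

Definition normal_extremal_trajectory (eta : curve R M) : Prop :=
  exists l : R -> 'cV[R]_n,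
    hamiltonian_solution (cleft eta) (cright eta) (cmap eta) l.

End Hamiltonian.

(* Main.v *)
(* The extremal is calibrated by an explicit strict subsolution of the Hamilton-Jacobi equation, so
   that no field of extremals has to be constructed.  In a chart around gamma(t0) let x = gamma and
   let p be the covector; h = H (x, p) < 0 is constant along the extremal.  As <p(t0), x(t)> is
   strictly decreasing near t0, every z near x(t0) has a time tau with <p(t0), z> = <p(t0), x(tau)>.
   For K large, Q(t0) = 0 and Q' = - 2 K, the function
     S(z) = 2 h tau + <p(tau), y> + Q(tau) |y|^2 / 2,   y = z - x(tau),
   has differential p + Q y + kappa p(t0), where - K |y|^2 enters kappa divided by the derivative of
   <p(t0), x>; to first order this gives H(z, dS) = h - K |y|^2, and the remainder is O(|y|^2) with
   a constant independent of K, so H(z, dS) <= h - |y|^2.  By the reversed Cauchy-Schwarz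
   inequality <dS, v> <= - sqrt (- 2 h) w for a future directed causal v of Lorentzian length w,
   strictly if y <> 0.  Integrating dS bounds the length of a competitor by sqrt (- 2 h) (t2 - t1),
   the length of the extremal, and equality forces y = 0, that is z = x o tau.
   A competitor is only absolutely continuous and its speed is not known to be measurable, so the
   pointwise inequality is integrated by covering the exceptional null set. *)

(* [S] is never built as a function on a neighbourhood. Along a future directed competitor
   [<p(t0), z>] decreases from [<p(t0), x(t1)>] to [<p(t0), x(t2)>], so every time [tau] can be
   found in [[t1, t2]], and only the composite of [S] with the competitor is differentiated. Hence
   [t0] may be an endpoint of the extremal, beyond which no time is available. As [tau] depends on
   [z] through [<p(t0), z>] alone, its differential is a multiple of [p(t0)], which explains the
   term [kappa p(t0)]. The choice of constants is not circular: as long as [|Q| <= 1] and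
   [K |y| <= 1], the shift [Q y + kappa p(t0)] is bounded by [L |y|] with [L] independent of [K]. So
   [L] comes first, then [K] beats the remainder that belongs to [L], and only then are the time
   interval and the ball cut down to a size governed by [1 / K]. The ball is small compared with the
   time interval: the extremal is outside the ball whenever [|s - t0|] equals the half-length [eps],
   and this confines the component [J]. *)
Require Import Defs.
From mathcomp Require Import all_boot all_order all_algebra.
From mathcomp Require Import all_classical all_reals all_analysis.
From mathcomp Require Import measurable_realfun ring lra.

Set Implicit Arguments.
Unset Strict Implicit.
Unset Printing Implicit Defensive.

Import Order.TTheory GRing.Theory Num.Theory numFieldNormedType.Exports.

Local Open Scope classical_set_scope.
Local Open Scope ring_scope.

(** * Absolutely continuous functions of one variable *)

Section RealLine.
Variable R : realType.
Implicit Types (a b : R) (F : R -> R).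

(** Real induction: the supremum of the points up to which [F a] is a lower bound is itself such a
    point by the left half of the hypothesis, and the right half passes beyond it unless it is
    [b]. *)
Lemma le_of_locally_nondecreasing a b F : a <= b ->
  (forall x, a <= x <= b -> exists2 r, 0 < r &
     (forall u, a <= u -> x - r < u -> u <= x -> F u <= F x) /\
     (forall v, v <= b -> x <= v -> v < x + r -> F x <= F v)) ->
  F a <= F b.
Proof.
move=> ab locF.
pose T := [set x | a <= x <= b /\ forall y, a <= y <= x -> F a <= F y].
have Ta : T a.
  split=> [|y]; first by rewrite lexx.
  by rewrite -eq_le => /eqP <-.
have supT : has_sup T by split; [exists a|exists b => x [/andP[]]].
pose s := sup T.
have as_ : a <= s by apply: sup_upper_bound.
have sb : s <= b by apply: ge_sup; [exists a|move=> x [/andP[]]].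
have [r r0 [Fl Fr]] := locF s (introT andP (conj as_ sb)).
have [x [/andP[ax xb] Tx] sx] := sup_adherent r0 supT.
have xs : x <= s by apply: sup_upper_bound => //; split; rewrite ?ax.
have Fs : F a <= F s.
  by apply: le_trans (Fl x ax sx xs); apply: Tx; rewrite ax lexx.
have Ts y : a <= y <= s -> F a <= F y.
  move=> /andP[ay]; rewrite le_eqVlt => /orP[/eqP->//|ys].
  have sy0 : 0 < s - y by rewrite subr_gt0.
  have [z [/andP[az zb] Tz] sz] := sup_adherent sy0 supT.
  by apply: Tz; rewrite ay ltW//; rewrite -/s in sz; lra.
have [sb'|sb'] := ltP s b; last by apply: Ts; rewrite ab sb'.
pose v := Num.min b (s + r / 2).
have sv : s < v by rewrite lt_min sb'/=; lra.
have vb : v <= b by rewrite ge_min lexx.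
have vr : v <= s + r / 2 by rewrite ge_min lexx orbT.
suff Tv : T v by have := sup_upper_bound supT Tv; rewrite leNgt sv.
split=> [|y /andP[ay yv]]; first by rewrite vb andbT; lra.
have [ys|sy] := leP y s; first by apply: Ts; rewrite ay.
by apply: (le_trans Fs); apply: Fr; lra.
Qed.

(** This is the local hypothesis of [le_of_locally_nondecreasing] for [F] plus a line of slope
    [e]. *)
Lemma nonneg_derive_locally_ge F x : derivable F x 1 -> 0 <= derive1 F x ->
  forall e, 0 < e -> exists2 r, 0 < r & forall v, `|v - x| < r ->
    (x <= v -> F x <= F v + e * (v - x)) /\
    (v <= x -> F v <= F x + e * (x - v)).
Proof.
move=> dF F0 e e0.

have : h^-1 *: ((F \o shift x) (h *: 1) - F x) @[h --> 0^'] --> derive1 F x.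
  by rewrite derive1E; exact: dF.
move/cvgrPdist_lt => /(_ _ e0)[r /= r0 Hr].
exists r => // v vx.
have [->|vneq] := eqVneq v x; first by rewrite subrr mulr0 addr0.
have := Hr (v - x); rewrite /= sub0r normrN => /(_ vx).
rewrite subr_eq0 => /(_ vneq); rewrite -[_ *: 1]/(_ * 1) mulr1 subrK.
set q := _ *: _ => Hq.
have qE : F v - F x = q * (v - x).
  by rewrite /q -[_ *: _]/(_ * _) mulrC mulrA divff ?mul1r// subr_eq0.
have qe : - e <= q.
  by move: Hq; rewrite ltr_distl => /andP[_ ]; lra.
split=> xv.
- have : 0 <= (q + e) * (v - x) by rewrite mulr_ge0//; lra.
  lra.
- have : 0 <= (q + e) * (x - v) by rewrite mulr_ge0//; lra.
  lra.
Qed.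

End RealLine.

Section AbsolutelyContinuous.
Variable R : realType.
Notation mu := (@lebesgue_measure R).
Implicit Types (a b : R) (F : R -> R).

Lemma sum_disjoint_itv_le (N : nat) (u v : 'I_N -> R) (U : set R) :
  open U -> (forall i, u i <= v i) ->
  (forall i, [set` `]u i, v i[] `<=` U) ->
  trivIset [set: 'I_N] (fun i => [set` `]u i, v i[]) ->
  ((\sum_(i < N) (v i - u i))%:E <= mu U)%E.
Proof.
move=> oU uv sU tI.
have muE i : mu [set` `]u i, v i[] = (v i - u i)%:E.
  rewrite lebesgue_measure_itv /= lte_fin; case: ltP => // vu.
  by have -> : u i = v i by [apply/eqP; rewrite eq_le uv vu]; rewrite subrr.
rewrite -sumEFin; under eq_bigr do rewrite -muE.
rewrite -(@measure_bigsetU_ord _ _ _ mu _ xpredT) //.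
apply: le_measure; rewrite ?inE.
- by apply: bigsetU_measurable => i _; exact: measurable_itv.
- exact: open_measurable.
- by elim/big_ind : _ => // A B AU BU; rewrite subUset.
Qed.

(* [variation_in U a F x] bounds the oscillation of [F] inside [U] up to [x]; added to [F] it
   makes [F] nondecreasing across the exceptional points of a derivative estimate. *)
Definition variation_in (U : set R) a F (x : R) : R :=
  sup [set z | exists N (u v : 'I_N -> R),
    [/\ forall i, [/\ a <= u i, u i <= v i & v i <= x],
        forall i, [set` `[u i, v i]] `<=` U,
        trivIset [set: 'I_N] (fun i => [set` `]u i, v i[]) &
        z = \sum_(i < N) `|F (v i) - F (u i)|]].

Section Variation.
Variables (U : set R) (a b : R) (F : R -> R) (e : R).
Hypothesis Ue : forall (N : nat) (u v : 'I_N -> R),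
      (forall i, [/\ a <= u i, u i <= v i & v i <= b]) ->
      (forall i, [set` `[u i, v i]] `<=` U) ->
      trivIset [set: 'I_N] (fun i => [set` `]u i, v i[]) ->
      \sum_(i < N) `|F (v i) - F (u i)| < e.

Let fam x := [set z | exists N (u v : 'I_N -> R),
    [/\ forall i, [/\ a <= u i, u i <= v i & v i <= x],
        forall i, [set` `[u i, v i]] `<=` U,
        trivIset [set: 'I_N] (fun i => [set` `]u i, v i[]) &
        z = \sum_(i < N) `|F (v i) - F (u i)|]].

Let fam_sup x : x <= b -> has_sup (fam x).
Proof.
move=> xb; split.
  exists 0, 0%N, (fun=> 0), (fun=> 0); rewrite big_ord0.
  by split => // [[]|[]|[]].
exists e => z [N [u [v [H1 H2 H3 ->]]]]; apply/ltW/Ue => // i.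
by have [? ? ?] := H1 i; split => //; lra.
Qed.

Lemma variation_in_le x : x <= b -> variation_in U a F x <= e.
Proof.
move=> xb; apply: ge_sup; first exact: (fam_sup xb).1.
move=> z [N [u [v [H1 H2 H3 ->]]]]; apply/ltW/Ue => // i.
by have [? ? ?] := H1 i; split => //; lra.
Qed.

Lemma variation_in_ge0 x : x <= b -> 0 <= variation_in U a F x.
Proof.
move=> xb; apply: sup_upper_bound; first exact: fam_sup.
exists 0%N, (fun=> 0), (fun=> 0); rewrite big_ord0.
by split => // [[]|[]|[]].
Qed.

Lemma variation_in_nd x y : x <= y -> y <= b ->
  variation_in U a F x <= variation_in U a F y.
Proof.
move=> xy yb; apply: ge_sup; first exact: (fam_sup (le_trans xy yb)).1.
move=> z [N [u [v [H1 H2 H3 zE]]]]; apply: sup_upper_bound; first exact: fam_sup.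
exists N, u, v; split => // i; have [? ? ?] := H1 i; split => //; lra.
Qed.

(** Every interval of a family that ends before [x] lies to the left of [[x, y]], so [[x, y]] may be
    appended to the family. *)
Lemma variation_in_add x y : a <= x -> x <= y -> y <= b ->
  [set` `[x, y]] `<=` U ->
  variation_in U a F x + `|F y - F x| <= variation_in U a F y.
Proof.
move=> ax xy yb sU; rewrite -lerBrDr.
apply: ge_sup; first exact: (fam_sup (le_trans xy yb)).1.
move=> z [N [u [v [H1 H2 H3 ->]]]]; rewrite lerBrDr.
apply: sup_upper_bound; first exact: fam_sup.
pose ext (w : 'I_N -> R) w0 (i : 'I_N.+1) :=
  if unlift ord_max i is Some j then w j else w0.
have extL w w0 j : ext w w0 (lift ord_max j) = w j by rewrite /ext liftK.
have extM w w0 : ext w w0 ord_max = w0 by rewrite /ext unlift_none.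
exists N.+1, (ext u x), (ext v y); split.
- move=> i; case: (unliftP ord_max i) => [j|] ->.
    by rewrite !extL; have [? ? ?] := H1 j; split => //; lra.
  by rewrite !extM.
- move=> i; case: (unliftP ord_max i) => [j|] ->.
    by rewrite !extL; exact: H2.
  by rewrite !extM.
- move=> i j _ _; case: (unliftP ord_max i) => [k|] ->;
    case: (unliftP ord_max j) => [l|] -> //.
  + by rewrite !extL => kl; congr (lift _ _); exact: H3 kl.
  + rewrite !extL !extM => -[t [/=]]; rewrite !in_itv/= => /andP[_ t1] /andP[t2 _].
    by exfalso; have [_ _ ?] := H1 k; lra.
  + rewrite !extL !extM => -[t [/=]]; rewrite !in_itv/= => /andP[t2 _] /andP[_ t1].
    by exfalso; have [_ _ ?] := H1 l; lra.
- rewrite big_ord_recr /= !extM; congr (_ + _); apply: eq_bigr => i _.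
  have -> : widen_ord (leqnSn N) i = lift ord_max i.
    by apply: val_inj; rewrite /= /bump leqNgt ltn_ord.
  by rewrite !extL.
Qed.

End Variation.

(** The exceptional null set is covered by an open [U] so small that the increments of [F] over
    disjoint intervals inside [U] add up to less than [e]. Then [F + e * (x - a) + V], with [V] the
    variation inside [U], is locally nondecreasing: at an exceptional point because [V] compensates
    the increments of [F], elsewhere by the sign of the derivative. *)
Lemma ac_nondecreasing a b F : a <= b ->
  absolutely_continuous a b (F : R -> R^o) ->
  {ae mu, forall x, x \in `]a, b[ -> derivable F x 1 /\ 0 <= derive1 F x} ->
  F a <= F b.
Proof.
move=> ab acF [A [mA A0 sA]].
suff H (e : R) : 0 < e -> F a <= F b + e * (b - a) + e.
  apply/ler_addgt0Pr => e e0.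
  (* The slope costs [e' * (b - a)] and the variation at most [e'], hence the divisor. *)
  have e'0 : 0 < e / (b - a + 1) by rewrite divr_gt0//; lra.
  have := H _ e'0; set e' := _ / _.
  have <- : e' * (b - a + 1) = e by rewrite /e' divfK//; lra.
  lra.
move=> e0; have [d d0 Hd] := acF e e0.
(* The endpoints are exceptional too, as the derivative is controlled on the open interval only. *)
pose D := A `|` [set a; b].
have mab : measurable [set a; b].
  by apply: measurableU; exact: measurable_set1.
have D0 : mu D = 0%E.
  apply: null_set_setU => //; apply: null_set_setU; try exact: measurable_set1.
    exact: lebesgue_measure_set1.
  exact: lebesgue_measure_set1.
have mD : measurable D by apply: measurableU.
have Doo : (mu D < +oo)%E by rewrite D0 ltry.
have [U [oU DU Ud]] := lebesgue_regularity_outer mD Doo d0.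
have Ud' : (mu U < d%:E)%E.
  have -> // : mu U = mu (U `\` D).
  rewrite -[in LHS](setDUK DU) setUC measureU0//.
  by apply: measurableD => //; exact: open_measurable.
have Ue (N : nat) (u v : 'I_N -> R) :
      (forall i, [/\ a <= u i, u i <= v i & v i <= b]) ->
      (forall i, [set` `[u i, v i]] `<=` U) ->
      trivIset [set: 'I_N] (fun i => [set` `]u i, v i[]) ->
      \sum_(i < N) `|F (v i) - F (u i)| < e.
  move=> H1 H2 H3; apply: Hd => //; rewrite -lte_fin; apply: le_lt_trans Ud'.
  apply: sum_disjoint_itv_le => // [i|i]; first by have [] := H1 i.
  by apply: subset_trans (H2 i); apply: subset_itv_oo_cc.
pose V := variation_in U a F.
pose G x := F x + e * (x - a) + V x.
have : G a <= G b.
  apply: le_of_locally_nondecreasing => // x /andP[ax xb].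
  have [Dx|nDx] := pselect (D x).
    have [r /= r0 Hr] : nbhs x U by exact: oU (DU _ Dx).
    exists r => //; split.
    - move=> u au ru ux.
      have := variation_in_add Ue au ux xb; rewrite -/(V _) -/(V _) => Hv.
      have : V u + `|F x - F u| <= V x.
        apply: Hv => t /=; rewrite in_itv /= => /andP[ut tx].
        by apply: Hr; rewrite /ball_/= ger0_norm; lra.
      have := ler_norm (- (F x - F u)); rewrite normrN /G => ? ?.
      have : 0 <= e * (x - u) by rewrite mulr_ge0//; lra.
      lra.
    - move=> v vb xv vr.
      have := variation_in_add Ue ax xv vb; rewrite -/(V _) -/(V _) => Hv.
      have : V x + `|F v - F x| <= V v.
        apply: Hv => t /=; rewrite in_itv /= => /andP[ut tx].
        by apply: Hr; rewrite /ball_/= ler0_norm; lra.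
      have := ler_norm (- (F v - F x)); rewrite normrN /G => ? ?.
      have : 0 <= e * (v - x) by rewrite mulr_ge0//; lra.
      lra.
  have xab : x \in `]a, b[.
    rewrite in_itv /= !lt_neqAle ax xb !andbT.
    by apply/andP; split; apply/eqP => E; apply: nDx; right; [left|right].
  have [dF F0] : derivable F x 1 /\ 0 <= derive1 F x.
    apply: contrapT => nH; apply: nDx; left; apply: sA => /= H; exact: nH (H xab).
  have [r r0 Hr] := nonneg_derive_locally_ge dF F0 e0.
  exists r => //; split.
  - move=> u au ru ux; have := variation_in_nd Ue ux xb; rewrite -/(V _) -/(V _).
    have [|_ /(_ ux)] := Hr u; first by rewrite ler0_norm; lra.
    rewrite /G; lra.
  - move=> v vb xv vr; have := variation_in_nd Ue xv vb; rewrite -/(V _) -/(V _).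
    have [|/(_ xv) + _] := Hr v; first by rewrite ger0_norm; lra.
    rewrite /G; lra.
have := variation_in_le Ue (lexx b); have := variation_in_ge0 Ue ab.
rewrite /G -/V -/(V _) subrr mulr0; lra.
Qed.

End AbsolutelyContinuous.

(** * Integrals of speeds compared with increments of absolutely continuous functions *)

Section IntegralBounds.
Variable R : realType.
Notation mu := (@lebesgue_measure R).
Implicit Types (a b : R) (F : R -> R).

Lemma ac_dominated (V W : normedModType R) a b (z : R -> V) (f : R -> W) L :
  absolutely_continuous a b z ->
  (forall s t, a <= s -> s <= t -> t <= b -> `|f t - f s| <= L * `|z t - z s|) ->
  absolutely_continuous a b f.
Proof.
move=> acz fz e e0; pose L' := `|L| + 1.
have L0 : 0 < L' by rewrite /L' ltr_pwDr.
have [d d0 Hd] := acz (e / L') (divr_gt0 e0 L0).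
exists d => // N u v uv tI ud; have := Hd N u v uv tI ud.
rewrite ltr_pdivlMr// mulrC; apply: le_lt_trans.
rewrite mulr_sumr; apply: ler_sum => i _; have [? ? ?] := uv i.
apply: (le_trans (fz _ _ _ _ _)) => //; apply: ler_wpM2r => //.
by rewrite /L'; have := ler_norm L; lra.
Qed.

Lemma ac_id a b : absolutely_continuous a b (id : R -> R^o).
Proof.
move=> e e0; exists e => // N u v uv tI; apply: le_lt_trans.
by apply: ler_sum => i _; have [? ? ?] := uv i; rewrite ger0_norm// subr_ge0.
Qed.

Lemma ac_lipschitz (W : normedModType R) a b (f : R -> W) L :
  (forall s t, a <= s -> s <= t -> t <= b -> `|f t - f s| <= L * (t - s)) ->
  absolutely_continuous a b f.
Proof.
move=> fL; apply: (ac_dominated (L := L) (@ac_id a b)) => s t as_ st tb.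
by rewrite (ger0_norm (_ : 0 <= t - s)) ?subr_ge0//; exact: fL.
Qed.

Lemma ac_sub a b F G : absolutely_continuous a b (F : R -> R^o) ->
  absolutely_continuous a b (G : R -> R^o) ->
  absolutely_continuous a b (F \- G : R -> R^o).
Proof.
move=> acF acG e e0; have e20 : 0 < e / 2 by lra.
have [d d0 Hd] := acF _ e20; have [d' d'0 Hd'] := acG _ e20.
exists (Num.min d d'); first by rewrite lt_min d0.
move=> N u v uv tI; rewrite lt_min => /andP[ud ud'].
have := ltrD (Hd N u v uv tI ud) (Hd' N u v uv tI ud').
rewrite -splitr; apply: le_lt_trans; rewrite -big_split /=.
have E (p q r s : R) : (p - q) - (r - s) = (p - r) - (q - s) by ring.
by apply: ler_sum => i _ /=; rewrite E; exact: ler_normB.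
Qed.

Import HBNNSimple.

(* [w] need not be measurable: each simple function below [w] is the derivative of its primitive
   almost everywhere, by Lebesgue's differentiation theorem. *)
Lemma integral_le_of_primitives a b (w : R -> R) (B : R) : a <= b ->
  (forall x, 0 <= w x) ->
  (forall H : R -> R, absolutely_continuous a b (H : R -> R^o) ->
    {ae mu, forall x, x \in `]a, b[ -> derivable H x 1 /\ derive1 H x <= w x} ->
    H b - H a <= B) ->
  (\int[mu]_(x in [set` `[a, b]]) (w x)%:E <= B%:E)%E.
Proof.
move=> ab w0 HB.
rewrite ge0_integralE; last by move=> x _; rewrite lee_fin.
apply: ge_ereal_sup => _ [h /= hw <-].
have hle x : h x <= w x.
  have := hw x; rewrite patchE; case: ifPn => _; rewrite lee_fin// => /le_trans; exact.
have h0 x : 0 <= h x by [].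
(* [h] lies below the extension of [w] by zero, so its integral over the line is the one over
   [[a, b]]. *)
have hout x : x \notin `[a, b] -> h x = 0.
  move=> xab; apply/eqP; rewrite eq_le h0 andbT -lee_fin; have := hw x.
  by rewrite patchE memNset//=; exact/negP.
have [M [_ HM]] := simple_bounded h.
pose M' := `|M| + 1.
have M0 : 0 <= M' by rewrite /M' addr_ge0.
have hM x : h x <= M'.
  apply: le_trans (ler_norm _) _; apply: HM => //.
  by rewrite /M'; have := ler_norm M; lra.
have mh : measurable_fun setT h by exact: measurable_funPT.
have bh : forall D : set R, [bounded h x | x in D].
  move=> D; exists M'; split; rewrite ?num_real// => y My x _.
  by rewrite /= ger0_norm ?h0//; apply: le_trans (hM x) (ltW My).
have ih x y : mu.-integrable [set` `[x, y]] (EFin \o h).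
  apply: measurable_bounded_integrable => //; last exact: measurable_funTS.
  by rewrite /= lebesgue_measure_itv/=; case: ifPn => // _; rewrite -EFinB ltry.
have hE : h \_ [set` `[a, b]] = h.
  apply/funext => x; rewrite patchE; case: ifPn => // xab.
  by rewrite hout//; move: xab; rewrite mem_setE.
have lh : locally_integrable [set: R] h.
  by rewrite -hE; apply: integrable_locally => //; exact: ih.
pose H (x : R) := (\int[mu]_(t in [set` `[a, x]]) (h t))%R.
have aeH := FTC1 (a := BLeft a) (fun y => ih a y) lh.
(* A simple function is bounded, so its primitive is Lipschitz. *)
have acH : absolutely_continuous a b (H : R -> R^o).
  apply: (@ac_lipschitz _ _ _ _ M') => s t as_ st tb.
  rewrite /H (Rintegral_itvB (ih a t)) ?bnd_simp//.
  rewrite ger0_norm ?Rintegral_ge0//.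
  have -> : M' * (t - s) = (\int[mu]_(x in [set` `]s, t]]) M')%R.
    rewrite Rintegral_cst//= lebesgue_measure_itv/= lte_fin.
    case: ltP => //= ts; have -> : s = t by lra.
    by rewrite subrr.
  apply: le_Rintegral => //.
  - by apply: integrableS (ih a t) => //; apply: subset_itvr; rewrite bnd_simp.
  - apply: measurable_bounded_integrable => //=; last exact: bounded_cst.
    by rewrite lebesgue_measure_itv/=; case: ifPn => // _; rewrite -EFinB ltry.
have HBH := HB H acH.
have -> : sintegral mu h = (H b)%:E.
  rewrite -integralT_nnsfun /H /Rintegral fineK.
    by rewrite [RHS]integral_mkcond; apply: eq_integral => x _; rewrite restrict_EFin hE.
  by apply: integrable_fin_num => //; exact: ih.
have Ha : H a = 0 by rewrite /H set_itv1 Rintegral_set1.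
rewrite lee_fin; move: HBH; rewrite Ha subr0; apply.
have FF := ae_filter_ringOfSetsType mu.
move: aeH; apply: filterS => x Hx; rewrite in_itv /= => /andP[ax xb].
have [dH ->] : derivable H x 1 /\ derive1 H x = h x.
  by apply: Hx; rewrite lte_fin.
by [].
Qed.

Lemma ac_sub_itv (V : normedModType R) a b c d (f : R -> V) : a <= c -> d <= b ->
  absolutely_continuous a b f -> absolutely_continuous c d f.
Proof.
move=> ac db acf e e0; have [dl dl0 H] := acf e e0; exists dl => // N u v uv.
by apply: H => i; have [cu uv' vd] := uv i; split=> //;
  [exact: le_trans ac cu|exact: le_trans vd db].
Qed.

Lemma ac_scale a b k F : absolutely_continuous a b (F : R -> R^o) ->
  absolutely_continuous a b (fun x => k * F x : R^o).
Proof.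
move=> acF; apply: (ac_dominated (L := `|k|) acF) => s t _ _ _.
by rewrite -mulrBr normrM.
Qed.

Lemma ac_derive_le a b F G : a <= b ->
  absolutely_continuous a b (F : R -> R^o) ->
  absolutely_continuous a b (G : R -> R^o) ->
  {ae mu, forall x, x \in `]a, b[ ->
    [/\ derivable F x 1, derivable G x 1 & derive1 G x <= derive1 F x]} ->
  G b - G a <= F b - F a.
Proof.
move=> ab acF acG aeFG.
have : (F \- G) a <= (F \- G) b.
  apply: ac_nondecreasing => //; first exact: ac_sub.
  have FF := ae_filter_ringOfSetsType mu.
  move: aeFG; apply: filterS => x Hx /Hx [dF dG GF].
  split; first exact: derivableB.
  by rewrite derive1E deriveB// -!derive1E subr_ge0.
by rewrite /=; lra.
Qed.

Lemma ae_itv_exists a b (P : R -> Prop) : a < b ->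
  {ae mu, forall x, x \in `]a, b[ -> P x} -> exists2 x, x \in `]a, b[ & P x.
Proof.
move=> ab [A [mA A0 sA]]; apply: contrapT => nP.
have : (mu [set` `]a, b[] <= mu A)%E.
  apply: le_measure; rewrite ?inE// => x xab; apply: sA => /= H.
  by apply: nP; exists x => //; exact: H.
rewrite [X in (_ <= X)%E]A0 lebesgue_measure_itv /= lte_fin ab lee_fin.
by rewrite subr_le0 leNgt ab.
Qed.

Lemma ae_sub_itv a b c d (P : R -> Prop) : a <= c -> d <= b ->
  {ae mu, forall x, x \in `]a, b[ -> P x} ->
  {ae mu, forall x, x \in `]c, d[ -> P x}.
Proof.
move=> ac db; have FF := ae_filter_ringOfSetsType mu; apply: filterS => x Hx.
rewrite in_itv /= => /andP[cx xd]; apply: Hx; rewrite in_itv /=.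
by rewrite (le_lt_trans ac cx) (lt_le_trans xd db).
Qed.

(** Monotonicity is [ac_nondecreasing]. If [F s = F t], then [F] is constant on [[s, t]] and its
    derivative vanishes inside, whereas almost every interior point has a positive derivative. *)
Lemma ac_increasing a b F :
  absolutely_continuous a b (F : R -> R^o) ->
  {ae mu, forall x, x \in `]a, b[ -> derivable F x 1 /\ 0 < derive1 F x} ->
  forall s t, a <= s -> s < t -> t <= b -> F s < F t.
Proof.
move=> acF aeF s t as_ st tb.
have FF := ae_filter_ringOfSetsType mu.
have nd u v : s <= u -> u <= v -> v <= t -> F u <= F v.
  move=> su uv vt; have au := le_trans as_ su; have vb := le_trans vt tb.
  apply: ac_nondecreasing => //; first exact: ac_sub_itv acF.
  have := ae_sub_itv au vb aeF.
  by apply: filterS => x Hx /Hx [dF F0]; split => //; exact: ltW.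
rewrite lt_neqAle (nd s t (lexx _) (ltW st) (lexx _)) andbT; apply/eqP => Fst.
have [x xst [dF]] := ae_itv_exists st (ae_sub_itv as_ tb aeF).
have Fc y : s <= y -> y <= t -> F y = F s.
  by move=> sy yt; apply/eqP; rewrite eq_le {1}Fst !nd//; lra.
suff -> : derive1 F x = 0 by rewrite ltxx.
move: xst; rewrite in_itv /= => /andP[sx xt].
rewrite derive1E (near_eq_derive (g := cst (F s))); first exact: derive_cst.
near=> y; apply: Fc.
- by apply: ltW; near: y; exact: lt_nbhsr.
- by apply: ltW; near: y; exact: lt_nbhsl.
Unshelve. all: by end_near. Qed.

Lemma integral_le_ac_increment a b F (w : R -> R) : a <= b ->
  absolutely_continuous a b (F : R -> R^o) -> (forall x, 0 <= w x) ->
  {ae mu, forall x, x \in `]a, b[ -> derivable F x 1 /\ w x <= derive1 F x} ->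
  (\int[mu]_(x in [set` `[a, b]]) (w x)%:E <= (F b - F a)%:E)%E.
Proof.
move=> ab acF w0 aeF; apply: integral_le_of_primitives => // H acH aeH.
apply: ac_derive_le => //; have FF := ae_filter_ringOfSetsType mu.
move: aeF aeH; apply: filterS2 => x Fx Hx xab.
have [dF wF] := Fx xab; have [dH Hw] := Hx xab.
by split => //; exact: le_trans Hw wF.
Qed.

(** Over [[c, d]] the primitive of a simple function below [w] grows by at most
    [k^-1 * (F d - F c)]. The deficit [(1 - k^-1) * (F d - F c)] is the same for all simple
    functions, so it survives their supremum; this is what the uniform factor [k] is for. *)
Lemma integral_lt_ac_increment a b c d F (w : R -> R) k :
  a <= c -> c <= d -> d <= b -> 1 < k ->
  absolutely_continuous a b (F : R -> R^o) -> (forall x, 0 <= w x) ->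
  {ae mu, forall x, x \in `]a, b[ -> derivable F x 1 /\ w x <= derive1 F x} ->
  {ae mu, forall x, x \in `]c, d[ -> k * w x <= derive1 F x} ->
  F c < F d ->
  (\int[mu]_(x in [set` `[a, b]]) (w x)%:E < (F b - F a)%:E)%E.
Proof.
move=> ac cd db k1 acF w0 aeF aek Fcd.
have k0 : 0 < k by apply: lt_trans k1.
have FF := ae_filter_ringOfSetsType mu.
apply: (@le_lt_trans _ _ (F b - F a - (1 - k^-1) * (F d - F c))%:E); last first.
  rewrite lte_fin ltrBlDr ltrDl mulr_gt0 ?subr_gt0//.
  by rewrite invf_lt1.
apply: integral_le_of_primitives => //; first by lra.
move=> H acH aeH.
have part s t : a <= s -> s <= t -> t <= b -> H t - H s <= F t - F s.
  move=> as_ st tb; apply: ac_derive_le => //.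
  - exact: ac_sub_itv acF.
  - exact: ac_sub_itv acH.
  move: (ae_sub_itv as_ tb aeF) (ae_sub_itv as_ tb aeH).
  apply: filterS2 => x Fx Hx xab; have [dF wF] := Fx xab; have [dH Hw] := Hx xab.
  by split => //; exact: le_trans Hw wF.
have mid : H d - H c <= k^-1 * F d - k^-1 * F c.
  apply: (ac_derive_le (F := fun x => k^-1 * F x)) => //.
  - exact: ac_scale (ac_sub_itv ac db acF).
  - exact: ac_sub_itv acH.
  move: (ae_sub_itv ac db aeH); apply: filterS2 (filterI (ae_sub_itv ac db aeF) aek).
  move=> x [Fx kx] Hx xab; have [dF wF] := Fx xab; have [dH Hw] := Hx xab.
  split => //; first exact: derivableZ.
  have -> : derive1 (fun x => k^-1 * F x) x = k^-1 * derive1 F x.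
    by rewrite !derive1E; exact: (deriveZ (k^-1) dF).
  apply: le_trans Hw _; rewrite mulrC.
  by rewrite ler_pdivlMr// mulrC; exact: kx.
have cb := le_trans cd db; have ad := le_trans ac cd.
have := part a c (lexx _) ac cb; have := part d b ad db (lexx _).
rewrite mulrBl mul1r mulrBr; lra.
Qed.

(** The simple function equal to [k] on the open interval is below [w]. In the application [w] is
    the speed of the extremal, whose two-sided derivative says nothing at an endpoint of its
    domain. *)
Lemma integral_ge_cst a b (w : R -> R) (k : R) : a <= b -> 0 <= k ->
  (forall x, 0 <= w x) -> (forall x, x \in `]a, b[ -> w x = k) ->
  ((k * (b - a))%:E <= \int[mu]_(x in [set` `[a, b]]) (w x)%:E)%E.
Proof.
move=> ab k0 w0 wk.
rewrite ge0_integralE; last by move=> x _; rewrite lee_fin.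
pose D : set (measurableTypeR R) := [set` `]a, b[].
have mD : measurable D by exact: measurable_itv.
pose h := scale_nnsfun (indic_nnsfun R mD) k0.
apply: (@le_trans _ _ (sintegral mu h)).
  rewrite (@eq_sintegral _ _ _ mu (cst k \* indic_nnsfun R mD)%R)// sintegralrM.
  have mDE : mu [set` `]a, b[] = (b - a)%:E.
    rewrite lebesgue_measure_itv/= lte_fin; case: ltP => // ba.
    by have -> : a = b by [lra]; rewrite subrr.
  by rewrite (@sintegral_indic _ _ _ mu D)// EFinM -mDE.
apply: ereal_sup_ubound; exists h => //= x.
rewrite patchE mindicE; have [xD|xD] := boolP (x \in D); last first.
  by rewrite mulr0; case: ifPn => // _; rewrite lee_fin.
have xab := set_mem xD; have xab' : [set` `[a, b]] x by exact: subset_itv_oo_cc xab.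
by rewrite (mem_set xab') mulr1 lee_fin wk.
Qed.

End IntegralBounds.

(** * Smooth maps on open subsets of the coordinate space *)

Section Differentiability.
Variable R : realType.

Lemma differentiable_of_linear_approx (V W : normedModType R) (f : V -> W) x
    (L : {linear V -> W}) : continuous L ->
  (forall e, 0 < e -> exists2 d, 0 < d &
     forall h, `|h| < d -> `|f (h + x) - (f x + L h)| <= e * `|h|) ->
  differentiable f x.
Proof.
move=> cL fL.
have dxf : f \o shift x = cst (f x) + L +o_ 0 id.
  apply/eqaddoP => e e0; have [d d0 Hd] := fL e e0.
  by apply/nbhs_norm0P; exists d.
have hdf h : (f \o shift x = cst (f x) + h +o_ 0 id) ->
    h = f \o shift x - cst (f x) +o_ 0 id.
  move=> hdf; apply: eqaddoE.
  rewrite hdf addrAC -!addrA addrC !addrA subrK.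
  rewrite -[LHS]addr0 -addrA; congr (_ + _).
  by apply/eqP; rewrite eq_sym addrC addr_eq0 oppo.
apply/diffP => /=.
(* The differential is the choice made by [get] among the continuous linear maps with this
   expansion, so it is enough to exhibit [L]. *)
apply: (@getPex _ (fun (df : {linear V -> W}) => continuous df /\
  forall y, f y = f (lim (nbhs x)) + df (y - lim (nbhs x))
                  +o_(y \near x) (y - lim (nbhs x)))).
exists L; split=> //; apply: eqaddoEx => z.
rewrite (hdf _ dxf) !addrA lim_id // /(_ \o _) /= subrK [f _ + _]addrC addrK.
rewrite -addrA -[LHS]addr0; congr (_ + _).
apply/eqP; rewrite eq_sym addrC addr_eq0 oppox; apply/eqP.
rewrite [in LHS]littleo_center0 (comp_centerK x id).
by rewrite -[- _ in RHS](comp_centerK x).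
Qed.

Lemma line_growth_rate (V W : normedModType R) (f : V -> W) (v w : V) (s : R) :
  (fun h : R => h^-1 *: (((fun u : R => f (u *: v + w)) \o shift s) (h *: 1)
     - (fun u : R => f (u *: v + w)) s)) =
  (fun h : R => h^-1 *: ((f \o shift (s *: v + w)) (h *: v) - f (s *: v + w))).
Proof.
by apply/funext => h /=; rewrite -[h *: 1]/(h * 1) mulr1 scalerDl addrA.
Qed.

Lemma derivable_line (V W : normedModType R) (f : V -> W) (v w : V) (s : R) :
  derivable (fun u : R => f (u *: v + w)) s 1 <-> derivable f (s *: v + w) v.
Proof. by rewrite /derivable line_growth_rate. Qed.

Lemma derive_line (V W : normedModType R) (f : V -> W) (v w : V) (s : R) :
  'D_1 (fun u : R => f (u *: v + w)) s = 'D_v f (s *: v + w).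
Proof. by rewrite /derive line_growth_rate. Qed.

Lemma le_mx_norm (m n : nat) (A : 'M[R]_(m, n)) i j : `|A i j| <= `|A|.
Proof.
rewrite [leRHS]/Num.Def.normr/= mx_normrE.
exact: (le_bigmax _ (fun ij => `|A ij.1 ij.2|) (i, j)).
Qed.

Lemma mx_norm_le (m n : nat) (A : 'M[R]_(m, n)) e : 0 <= e ->
  (forall i j, `|A i j| <= e) -> `|A| <= e.
Proof.
move=> e0 Ae; rewrite [leLHS]/Num.Def.normr/= mx_normrE.
by apply: bigmax_le => // i _; exact: Ae.
Qed.

(* The increment of [f] between [x] and [y] along the broken line which updates one coordinate at a
   time; in the sup norm this line stays in the ball centred at [x] through [y]. *)
Lemma increment_coord (n : nat) (f : 'rV[R]_n -> R) (x y : 'rV[R]_n) :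
  (forall z, `|z - x| <= `|y - x| ->
     forall j, derivable f z (delta_mx 0 j)) ->
  exists xi : 'I_n -> 'rV[R]_n, (forall j, `|xi j - x| <= `|y - x|) /\
    f y - f x = \sum_j (y 0 j - x 0 j) * 'D_(delta_mx 0 j) f (xi j).
Proof.
move=> df.
pose w (k : nat) : 'rV[R]_n := \row_j (if (j < k)%N then y 0 j else x 0 j).
have w0 : w 0%N = x by apply/rowP => j; rewrite mxE.
have wn : w n = y by apply/rowP => j; rewrite mxE ltn_ord.
have step (k : 'I_n) : exists z, `|z - x| <= `|y - x| /\
    f (w k.+1) - f (w k) = (y 0 k - x 0 k) * 'D_(delta_mx 0 k) f z.
  pose v0 := w k - x 0 k *: delta_mx 0 k.
  pose g s := f (s *: delta_mx 0 k + v0).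
  have gx : f (w k) = g (x 0 k) by rewrite /g /v0 addrC subrK.
  have gy : f (w k.+1) = g (y 0 k).
    congr f; apply/rowP => j; rewrite !mxE eqxx /=.
    have [->|jk] := eqVneq j k; first by rewrite ltnSn ltnn !mulr1; ring.
    by rewrite !mulr0 subr0 add0r ltnS leq_eqVlt (inj_eq val_inj) (negPf jk).
  have inb s : Num.min (x 0 k) (y 0 k) <= s <= Num.max (x 0 k) (y 0 k) ->
      `|s *: delta_mx 0 k + v0 - x| <= `|y - x|.
    move=> /andP[s1 s2]; apply: mx_norm_le => // i j; rewrite ord1 !mxE eqxx /=.
    have [->|jk] := eqVneq j k.
      rewrite ltnn !mulr1; have := le_mx_norm (y - x) 0 k; rewrite !mxE.
      apply: le_trans; rewrite (_ : _ - _ = s - x 0 k); last by ring.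
      move: s1 s2; rewrite /Num.min /Num.max; case: ltP => ?.
        by move=> ? ?; rewrite !ger0_norm; lra.
      by move=> ? ?; rewrite !ler0_norm; lra.
    rewrite !mulr0 subr0 add0r; case: ifP => _; last by rewrite subrr normr0.
    by have := le_mx_norm (y - x) 0 j; rewrite !mxE.
  have dg s : Num.min (x 0 k) (y 0 k) <= s <= Num.max (x 0 k) (y 0 k) ->
      is_derive s 1 g ('D_(delta_mx 0 k) f (s *: delta_mx 0 k + v0)).
    move=> sI; apply: DeriveDef; last exact: derive_line.
    by apply/derivable_line; apply: df; exact: inb.
  have cg a b : Num.min (x 0 k) (y 0 k) <= a -> b <= Num.max (x 0 k) (y 0 k) ->
      {within `[a, b], continuous g}.
    move=> ma bM; apply: derivable_within_continuous => s.
    rewrite in_itv /= => /andP[? ?].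
    by have [] := dg s _ => //; apply/andP; split; lra.
  have [xy|yx] := leP (x 0 k) (y 0 k).
  - have mE : Num.min (x 0 k) (y 0 k) = x 0 k by rewrite min_l.
    have ME : Num.max (x 0 k) (y 0 k) = y 0 k by rewrite max_r.
    have [||c cI gE] := @MVT_segment _ g
        (fun s => 'D_(delta_mx 0 k) f (s *: delta_mx 0 k + v0)) _ _ xy.
    + move=> s; rewrite in_itv/= => /andP[? ?]; apply: dg; rewrite mE ME; lra.
    + by apply: cg; rewrite ?mE ?ME.
    + exists (c *: delta_mx 0 k + v0); split; last by rewrite gx gy gE mulrC.
      by apply: inb; rewrite mE ME; move: cI; rewrite in_itv.
  - have mE : Num.min (x 0 k) (y 0 k) = y 0 k by rewrite min_r// ltW.
    have ME : Num.max (x 0 k) (y 0 k) = x 0 k by rewrite max_l// ltW.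
    have [||c cI gE] := @MVT_segment _ g
        (fun s => 'D_(delta_mx 0 k) f (s *: delta_mx 0 k + v0)) _ _ (ltW yx).
    + move=> s; rewrite in_itv/= => /andP[? ?]; apply: dg; rewrite mE ME; lra.
    + by apply: cg; rewrite ?mE ?ME.
    + exists (c *: delta_mx 0 k + v0); split.
        by apply: inb; rewrite mE ME; move: cI; rewrite in_itv.
      by rewrite gx gy -opprB gE; ring.
have [xi Hxi] := choice step.
exists xi; split=> [j|]; first exact: (Hxi j).1.
under eq_bigr do rewrite -(Hxi _).2.
by rewrite -(big_mkord xpredT (fun k => f (w k.+1) - f (w k))) telescope_sumr// wn w0.
Qed.

End Differentiability.

Section CkAlgebra.
Variable R : realType.

Lemma nbhs_rVP (n : nat) (x : 'rV[R]_n) (A : set 'rV[R]_n) :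
  nbhs x A <-> exists2 d, 0 < d & forall y, `|y - x| < d -> A y.
Proof.
split=> [/nbhs_ballP[d /= d0 H]|[d d0 H]].
  by exists d => // y yx; apply: H; rewrite -ball_normE /= distrC.
by apply/nbhs_ballP; exists d => //= y; rewrite -ball_normE /= distrC; exact: H.
Qed.

Lemma continuous_at_norm (T : topologicalType) (V : normedModType R) (f : T -> V) x :
  (forall e, 0 < e -> nbhs x [set y | `|f x - f y| <= e]) -> {for x, continuous f}.
Proof. by move=> H; apply/cvgrPdist_le. Qed.

Lemma continuous_mx (T : topologicalType) (m n : nat) (f : T -> 'M[R]_(m, n)) x :
  (forall i j, {for x, continuous (fun y => f y i j)}) -> {for x, continuous f}.
Proof.
move=> cf; apply/cvgrPdist_le => e e0.
have : \forall y \near x, forall ij : 'I_m * 'I_n, `|f x ij.1 ij.2 - f y ij.1 ij.2| <= e.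
  by apply: filter_forall => ij; move: (cf ij.1 ij.2) => /cvgrPdist_le /(_ _ e0).
apply: filterS => y Hy; apply: mx_norm_le (ltW e0) _ => i j.
by rewrite !mxE; exact: (Hy (i, j)).
Qed.

Lemma continuous_mx_coord (T : topologicalType) (m n : nat) (f : T -> 'M[R]_(m, n)) x i j :
  {for x, continuous f} -> {for x, continuous (fun y => f y i j)}.
Proof.
move=> cf; apply/cvgrPdist_le => e e0.
move: cf => /cvgrPdist_le /(_ _ e0); apply: filterS => y; apply: le_trans.
by have := le_mx_norm (f x - f y) i j; rewrite !mxE.
Qed.

Section Coordinates.
Variables (n : nat) (A : set 'rV[R]_n).
Hypothesis oA : open A.

Lemma Ck_eq (V : normedModType R) k (f g : 'rV[R]_n -> V) :
  (forall x, A x -> f x = g x) -> Ck k A f -> Ck k A g.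
Proof.
have near_fg (f' g' : 'rV[R]_n -> V) : (forall x, A x -> f' x = g' x) ->
    forall x, A x -> \forall y \near x, f' y = g' y.
  by move=> fg x Ax; move: (oA Ax); apply: filterS.
elim: k f g => [|k IH] f g fg /=.
  move=> cf x Ax; rewrite /prop_for /continuous_at -(fg _ Ax).
  by apply: cvg_trans (cf x Ax); exact: (near_eq_cvg (near_fg _ _ fg x Ax)).
move=> Hf i; have [df Cf] := Hf i; split=> [x Ax|].
  by apply: near_eq_derivable (df x Ax); exact: near_fg.
by apply: IH Cf => x Ax; apply: near_eq_derive; exact: near_fg.
Qed.

Lemma Ck_coord (m p : nat) k (f : 'rV[R]_n -> 'M[R]_(m, p)) :
  Ck k A f <-> forall i j, Ck k A (fun x => f x i j : R^o).
Proof.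
elim: k f => [|k IH] f /=.
  split=> [cf i j x Ax|cf x Ax]; first exact: continuous_mx_coord (cf x Ax).
  by apply: continuous_mx => i j; exact: cf.
split=> [Hf i j l|Hf l].
  have [df Cf] := Hf l; split=> [x Ax|]; first by move: (df x Ax) => /derivable_mxP.
  have /IH/(_ i j) := Cf; apply: Ck_eq => x Ax.
  by rewrite derive_mx ?mxE//; exact: df.
have df x : A x -> derivable f x (delta_mx 0 l).
  by move=> Ax; apply/derivable_mxP => i j; exact: (Hf i j l).1.
split=> //; apply/IH => i j; have [_] := Hf i j l; apply: Ck_eq => x Ax.
by rewrite derive_mx ?mxE//; exact: df.
Qed.

(** By [increment_coord] the increment is a sum of partial derivatives at nearby points, which
    continuity compares with those at [x]. Each of the [n] terms may err by [e / (n + 1)]; the extra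
    one keeps the quotient meaningful for [n = 0]. *)
Lemma C1_linear_approx (f : 'rV[R]_n -> R^o) x : Ck 1 A f -> A x ->
  forall e, 0 < e -> exists2 d, 0 < d & forall h, `|h| < d ->
    `|f (h + x) - (f x + \sum_j h 0 j * 'D_(delta_mx 0 j) f x)| <= e * `|h|.
Proof.
move=> Cf Ax e e0.
have e'0 : 0 < e / (n%:R + 1) by rewrite divr_gt0// ltr_wpDl.
pose P := [set y | forall j : 'I_n,
    `|'D_(delta_mx 0 j) f x - 'D_(delta_mx 0 j) f y| <= e / (n%:R + 1)].
have nP : nbhs x P.
  apply: (@filter_forall _ _ _ (nbhs x) (nbhs_filter x)) => j; have [_ cDf] := Cf j.
  by move: (cDf x Ax) => /cvgrPdist_le /(_ _ e'0).
have /nbhs_rVP[d d0 Hd] : nbhs x (A `&` P) by apply: filterI => //; exact: oA.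
exists d => // h hd.
have hx : h + x - x = h by rewrite addrK.
have [|xi [Hxi fE]] := @increment_coord R n f x (h + x).
  move=> z; rewrite hx => zh j; have [Az _] := Hd z (le_lt_trans zh hd).
  exact: (Cf j).1.
rewrite opprD addrA fE -sumrB.
apply: (le_trans (ler_norm_sum _ _ _)).
apply: (@le_trans _ _ (\sum_(j < n) e / (n%:R + 1) * `|h|)).
  apply: ler_sum => j _; rewrite mxE addrK -mulrBr normrM mulrC.
  apply: ler_pM => //; last by have := le_mx_norm h 0 j.
  have := Hxi j; rewrite hx => xih.
  by rewrite distrC; have [_] := Hd (xi j) (le_lt_trans xih hd).
rewrite sumr_const card_ord -[leLHS]mulr_natr.
have -> : e / (n%:R + 1) * `|h| * n%:R = e * `|h| * (n%:R / (n%:R + 1)) by ring.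
apply: ler_piMr; first by rewrite mulr_ge0// ltW.
have n0 : 0 < n%:R + 1 :> R by rewrite ltr_wpDl.
by rewrite ler_pdivrMr// mul1r lerDl.
Qed.

(** [Ck] asks for continuity of the partial derivatives of top order only, so the continuity of [f]
    itself has to be recovered. It is what makes the classes [Ck] decreasing in the order, which the
    product rule needs. *)
Lemma C1_continuous (f : 'rV[R]_n -> R^o) : Ck 1 A f -> Ck 0 A f.
Proof.
move=> Cf x Ax; apply: continuous_at_norm => e e0.
have [d d0 Hd] := C1_linear_approx Cf Ax (@ltr01 R).
pose B := 1 + \sum_j `|'D_(delta_mx 0 j) f x|.
have B0 : 0 < B by rewrite ltr_pwDl// sumr_ge0.
apply/nbhs_rVP; exists (Num.min d (e / B)); first by rewrite lt_min d0 divr_gt0.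
move=> y; rewrite lt_min => /andP[yd ye] /=.
have := Hd _ yd; rewrite subrK mul1r => H.
rewrite distrC (_ : f y - f x = (f y - (f x + \sum_j (y - x) 0 j * 'D_(delta_mx 0 j) f x))
  + \sum_j (y - x) 0 j * 'D_(delta_mx 0 j) f x); last by rewrite opprD; ring.
apply: (le_trans (ler_normD _ _)).
apply: (@le_trans _ _ (B * `|y - x|)); last first.
  by rewrite mulrC -ler_pdivlMr// ltW.
rewrite /B mulrDl mul1r; apply: lerD => //.
apply: (le_trans (ler_norm_sum _ _ _)); rewrite mulr_suml; apply: ler_sum => j _.
by rewrite normrM mulrC ler_wpM2l//; exact: le_mx_norm.
Qed.

End Coordinates.
End CkAlgebra.

Lemma continuous_sum (R : realType) (T : topologicalType) (I : Type) (s : seq I)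
    (F : I -> T -> R) x : (forall i, {for x, continuous (F i)}) ->
  {for x, continuous (fun y => \sum_(i <- s) F i y)}.
Proof.
move=> cF; elim: s => [|i s IH].
  have -> : (fun y => \sum_(i <- [::]) F i y) = cst 0.
    by apply/funext => y; rewrite big_nil.
  exact: cst_continuous.
have -> : (fun y => \sum_(j <- i :: s) F j y) = F i + (fun y => \sum_(j <- s) F j y).
  by apply/funext => y; rewrite big_cons.
exact: (continuousD (cF i) IH).
Qed.

Section SmoothAlgebra.
Variables (R : realType) (n : nat) (A : set 'rV[R]_n).
Hypothesis oA : open A.
Implicit Types f g : 'rV[R]_n -> R^o.

Lemma Ck_pred k f : Ck k.+1 A f -> Ck k A f.
Proof.
elim: k f => [|k IH] f Hf; first exact: C1_continuous.
by move=> i; have [df Cf] := Hf i; split => //; exact: IH.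
Qed.

Lemma Ck_cst k (c : R) : Ck k A (cst c : _ -> R^o).
Proof.
elim: k c => [|k IH] c /=; first by move=> x _; exact: cst_continuous.
move=> i; split=> [x _|]; first exact: derivable_cst.
by apply: (Ck_eq oA _ (IH 0)) => x _; rewrite derive_cst.
Qed.

Lemma Ck_add k f g : Ck k A f -> Ck k A g -> Ck k A (f \+ g).
Proof.
elim: k f g => [|k IH] f g /=.
  by move=> cf cg x Ax; exact: (continuousD (cf x Ax) (cg x Ax)).
move=> Hf Hg i; have [df Cf] := Hf i; have [dg Cg] := Hg i; split=> [x Ax|].
  by apply: derivableD; [exact: df|exact: dg].
apply: (Ck_eq oA _ (IH _ _ Cf Cg)) => x Ax.
by rewrite deriveD//; [exact: df|exact: dg].
Qed.

Lemma Ck_mul k f g : Ck k A f -> Ck k A g -> Ck k A (f \* g).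
Proof.
elim: k f g => [|k IH] f g.
  by move=> cf cg x Ax; exact: (continuousM (cf x Ax) (cg x Ax)).
move=> Hf Hg i; have [df Cf] := Hf i; have [dg Cg] := Hg i; split=> [x Ax|].
  by apply: derivableM; [exact: df|exact: dg].
have Hf' := Ck_pred Hf; have Hg' := Ck_pred Hg.
apply: (Ck_eq oA _ (Ck_add (IH _ _ Hf' Cg) (IH _ _ Hg' Cf))) => x Ax.
by rewrite deriveM//; [exact: df|exact: dg].
Qed.

(** The function [u = f^(-1/2)] satisfies [u' = - u^3 f' / 2], a polynomial in [u] and [f'], so the
    induction on the order closes by means of [Ck_mul] alone. *)
Lemma smooth_rsqrt f : smooth_on A f -> (forall x, A x -> 0 < f x) ->
  smooth_on A (fun x => (Num.sqrt (f x))^-1 : R^o).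
Proof.
move=> Sf f0; pose u x : R^o := (Num.sqrt (f x))^-1.
have dsqrt (y : R) : 0 < y ->
    is_derive y 1 (fun z : R => (Num.sqrt z)^-1) (- 2^-1 * (Num.sqrt y)^-1 ^+ 3).
  move=> y0.
  have s0 : Num.sqrt y != 0 by rewrite gt_eqF// sqrtr_gt0.
  have ds := is_derive1_sqrt y0.
  have dV := is_deriveV s0 ds.
  apply: is_derive_eq; rewrite -[_ *: _]/(_ * _); field.
  by rewrite s0.
have du x v : A x -> derivable f x v ->
    derivable u x v /\ 'D_v u x = - 2^-1 * u x ^+ 3 * 'D_v f x.
  move=> Ax dfx.
  pose l (s : R) : R := f (s *: v + x).
  have l0 : l 0 = f x by rewrite /l scale0r add0r.
  have dl : derivable l 0 1 by apply/derivable_line; rewrite scale0r add0r.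
  have Dl : 'D_1 l 0 = 'D_v f x by rewrite derive_line scale0r add0r.
  have dg : is_derive (l 0) 1 (fun z : R => (Num.sqrt z)^-1)
      (- 2^-1 * (Num.sqrt (l 0))^-1 ^+ 3) by apply: dsqrt; rewrite l0; exact: f0.
  have dgl : differentiable ((fun z : R => (Num.sqrt z)^-1) \o l) 0.
    by apply: differentiable_comp; [exact/derivable1_diffP|
      apply/derivable1_diffP; exact: ex_derive].
  have := derive_line u v x 0; rewrite scale0r add0r => <-; split.
    have := (derivable_line u v x 0).1 ((derivable1_diffP _ _).2 dgl).
    by rewrite scale0r add0r.
  have := @derive1_comp R l (fun z : R => (Num.sqrt z)^-1) 0 dl (@ex_derive _ _ _ _ _ _ _ dg).
  rewrite !derive1E Dl (@derive_val _ _ _ _ _ _ _ dg) l0 => E.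
  exact: E.
have Du x v : A x -> derivable f x v -> derivable u x v by move=> ? ?; apply: (du _ _ _ _).1.
move=> k; rewrite -/u; elim: k => [|k IH].
  move=> x Ax; have s0 : Num.sqrt (f x) != 0 by rewrite gt_eqF// sqrtr_gt0 f0.
  have cs : {for x, continuous ((@Num.sqrt R) \o f)}.
    by apply: continuous_comp (Sf 0%N x Ax) _; exact: sqrt_continuous.
  exact: (continuousV (s := (@Num.sqrt R) \o f) s0 cs).
move=> i; have [df Cf] := Sf k.+1 i; split=> [x Ax|].
  by apply: Du => //; exact: df.
have C3 := Ck_mul (Ck_mul (Ck_cst k (- 2^-1)) (Ck_mul IH (Ck_mul IH IH))) Cf.
apply: (Ck_eq oA _ C3) => x Ax.
by rewrite (du _ _ Ax (df _ Ax)).2 /= !exprS expr0 mulr1.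
Qed.

Lemma smooth_sum (I : Type) (s : seq I) (P : pred I) (F : I -> 'rV[R]_n -> R^o) :
  (forall i, P i -> smooth_on A (F i)) ->
  smooth_on A (fun x => \sum_(i <- s | P i) F i x : R^o).
Proof.
move=> SF k; elim: s => [|i s IH].
  by apply: (Ck_eq oA _ (Ck_cst k 0)) => x _; rewrite big_nil.
have [Pi|nPi] := boolP (P i).
  by apply: (Ck_eq oA _ (Ck_add (SF i Pi k) IH)) => x _; rewrite big_cons Pi.
by apply: (Ck_eq oA _ IH) => x _; rewrite big_cons (negPf nPi).
Qed.

Lemma smooth_coord (m p : nat) (F : 'rV[R]_n -> 'M[R]_(m, p)) :
  smooth_on A F <-> forall i j, smooth_on A (fun x => F x i j : R^o).
Proof.
split=> [SF i j k|SF k]; first by move/(Ck_coord oA): (SF k).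
by apply/(Ck_coord oA) => i j; exact: SF.
Qed.

Lemma smooth_scale (m p : nat) (f : 'rV[R]_n -> R^o) (F : 'rV[R]_n -> 'M[R]_(m, p)) :
  smooth_on A f -> smooth_on A F -> smooth_on A (fun x => f x *: F x).
Proof.
move=> Sf /smooth_coord SF; apply/smooth_coord => i j k.
by apply: (Ck_eq oA _ (Ck_mul (Sf k) (SF i j k))) => x _; rewrite mxE.
Qed.

Lemma smooth_sum_mx (m p : nat) (I : Type) (s : seq I) (P : pred I)
    (F : I -> 'rV[R]_n -> 'M[R]_(m, p)) :
  (forall i, P i -> smooth_on A (F i)) ->
  smooth_on A (fun x => \sum_(i <- s | P i) F i x).
Proof.
move=> SF; apply/smooth_coord => i j k.
have SF' l : P l -> smooth_on A (fun x => F l x i j : R^o).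
  by move=> Pl; exact: (smooth_coord _).1 (SF l Pl) i j.
by apply: (Ck_eq oA _ (smooth_sum s SF' k)) => x _; rewrite summxE.
Qed.

Lemma smooth_differentiable (m : nat) (F : 'rV[R]_n -> 'rV[R]_m) x :
  smooth_on A F -> A x -> differentiable F x.
Proof.
move=> SF Ax.
pose J : 'M[R]_(n, m) := \matrix_(i, j) 'D_(delta_mx 0 i) (fun y => F y 0 j) x.
apply: (@differentiable_of_linear_approx _ _ _ _ _ (mulmxr J)).
  move=> h; apply: continuous_mx => i j; rewrite ord1.
  have -> : (fun y => mulmxr J y 0 j) = (fun y : 'rV[R]_n => \sum_k y 0 k * J k j).
    by apply/funext => y; rewrite /= mxE.
  apply: continuous_sum => k.
  by apply: continuousM; [exact: coord_continuous|exact: cst_continuous].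
move=> e e0.
have H j : exists d, 0 < d /\ forall h, `|h| < d ->
    `|F (h + x) 0 j - (F x 0 j + \sum_i h 0 i * J i j)| <= e * `|h|.
  have /smooth_coord/(_ 0 j 1%N) C1 := SF.
  have [d d0 Hd] := C1_linear_approx oA C1 Ax e0; exists d; split => // h hd.
  by under eq_bigr do rewrite mxE; exact: Hd.
have [d Hd] := choice H.
exists (\big[Num.min/1]_j d j).
  by apply: lt_bigmin => // j _; exact: (Hd j).1.
move=> h hd; apply: mx_norm_le => [|i j]; first by rewrite mulr_ge0// ltW.
rewrite ord1 !mxE; apply: (Hd j).2; apply: lt_le_trans hd _.
exact: bigmin_le.
Qed.

End SmoothAlgebra.

(** * Second order Taylor estimates, uniform near a point *)

Section Taylor.
Variables (R : realType) (n : nat) (A : set 'rV[R]_n) (x0 : 'rV[R]_n).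
Hypotheses (oA : open A) (Ax0 : A x0).
Implicit Types x y : 'rV[R]_n.

Lemma continuous_bounded_near (f : 'rV[R]_n -> R^o) :
  {for x0, continuous f} -> nbhs x0 [set x | `|f x| <= `|f x0| + 1].
Proof.
move=> cf; have : nbhs x0 [set x | `|f x0 - f x| <= 1].
  by move: cf => /cvgrPdist_le /(_ 1 ltr01).
apply: filterS => x /= fx.
rewrite (_ : f x = f x0 - (f x0 - f x)); last by rewrite opprB addrC subrK.
by apply: le_trans (ler_normB _ _) _; rewrite lerD2l.
Qed.

(** The derivatives of order at most two are bounded near [x0] by a common constant, and
    [increment_coord] is applied twice: to [F i], then to the difference between its partial
    derivatives at an intermediate point and at [x]. *)
Lemma smooth_taylor_fam (I : finType) (F : I -> 'rV[R]_n -> R^o) :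
  (forall i, smooth_on A (F i)) ->
  exists rho C, [/\ 0 < rho, 0 <= C, forall x, `|x - x0| < rho -> A x &
    forall i x x', `|x - x0| < rho -> `|x' - x0| < rho ->
      [/\ `|F i x| <= C, forall j, `|'D_(delta_mx 0 j) (F i) x| <= C &
          `|F i x' - F i x - \sum_j (x' - x) 0 j * 'D_(delta_mx 0 j) (F i) x|
            <= C * `|x' - x| ^+ 2]].
Proof.
move=> SF.
pose d0 i x := `|F i x|.
pose d1 (ij : I * 'I_n) x := `|'D_(delta_mx 0 ij.2) (F ij.1) x|.
pose d2 (ijk : I * 'I_n * 'I_n) x :=
  `|'D_(delta_mx 0 ijk.2) ('D_(delta_mx 0 ijk.1.2) (F ijk.1.1)) x|.
pose P := [set x | A x /\ [/\ forall i, d0 i x <= d0 i x0 + 1,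
   forall ij, d1 ij x <= d1 ij x0 + 1 & forall ijk, d2 ijk x <= d2 ijk x0 + 1]].
have nP : nbhs x0 P.
  have nfor (J : finType) (d : J -> 'rV[R]_n -> R) :
      (forall i, nbhs x0 [set x | d i x <= d i x0 + 1]) ->
      nbhs x0 [set x | forall i, d i x <= d i x0 + 1].
    by move=> H; apply: (@filter_forall _ _ _ (nbhs x0) (nbhs_filter x0)).
  have n0 := nfor _ d0 (fun i => continuous_bounded_near (SF i 0%N x0 Ax0)).
  have n1 : nbhs x0 [set x | forall i, d1 i x <= d1 i x0 + 1].
    apply: nfor => -[i j].
    exact: (continuous_bounded_near ((SF i 1%N j).2 x0 Ax0)).
  have n2 : nbhs x0 [set x | forall i, d2 i x <= d2 i x0 + 1].
    apply: nfor => -[[i j] k].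
    exact: (continuous_bounded_near (((SF i 2%N j).2 k).2 x0 Ax0)).
  have nA : nbhs x0 A by exact: oA.
  have /nbhs_rVP[ra ra0 Ha] := nA; have /nbhs_rVP[r0 r00 H0] := n0.
  have /nbhs_rVP[r1 r10 H1] := n1; have /nbhs_rVP[r2 r20 H2] := n2.
  apply/nbhs_rVP; exists (Num.min (Num.min ra r0) (Num.min r1 r2)).
    by rewrite !lt_min ra0 r00 r10.
  move=> y; rewrite !lt_min => /andP[/andP[ya y0] /andP[y1 y2]].
  by split; [exact: Ha|split; [exact: H0|exact: H1|exact: H2]].
have /nbhs_rVP[rho rho0 Hrho] := nP.
have sum_bound (J : finType) (d : J -> 'rV[R]_n -> R) : (forall i, 0 <= d i x0) ->
    exists2 s, 0 <= s & forall i, d i x0 + 1 <= s.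
  move=> d0'; exists (\sum_i (d i x0 + 1)).
    by apply: sumr_ge0 => j _; rewrite addr_ge0.
  move=> i; rewrite (bigD1 i)//= lerDl sumr_ge0// => j _.
  by rewrite addr_ge0.
have [s0 s0_ge0 L0] := sum_bound _ d0 (fun i => normr_ge0 _).
have [s1 s1_ge0 L1] := sum_bound _ d1 (fun i => normr_ge0 _).
have [s2 s2_ge0 L2] := sum_bound _ d2 (fun i => normr_ge0 _).
pose B := s0 + (s1 + s2).
have B0 i x : P x -> d0 i x <= B.
  move=> [_ [/(_ i) H _ _]]; apply: le_trans H (le_trans (L0 i) _).
  by rewrite /B lerDl addr_ge0.
have B1 ij x : P x -> d1 ij x <= B.
  move=> [_ [_ /(_ ij) H _]]; apply: le_trans H (le_trans (L1 ij) _).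
  by rewrite /B addrCA lerDl addr_ge0.
have B2 ijk x : P x -> d2 ijk x <= B.
  move=> [_ [_ _ /(_ ijk) H]]; apply: le_trans H (le_trans (L2 ijk) _).
  by rewrite /B addrA lerDr addr_ge0.
have B_ge0 : 0 <= B by rewrite /B !addr_ge0.
have nn0 : 0 <= n%:R * n%:R :> R by rewrite mulr_ge0.
(* A point within [|x' - x|] of [x] is within [|x' - x0| + 2 |x - x0|] of [x0], hence the division
   by 3. The two nested sums have [n * n] terms bounded by [B], and the summand 1 accounts for the
   bounds on [F i] and its first derivatives. *)
exists (rho / 3), (B * (1 + n%:R * n%:R)); split; first lra.
- by rewrite mulr_ge0// addr_ge0.
- by move=> x xr; apply: (Hrho x _).1; apply: lt_trans xr _; lra.
have BC : B <= B * (1 + n%:R * n%:R) by rewrite ler_peMr// lerDl.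
move=> i x x' xr xr'.
have inP z : `|z - x| <= `|x' - x| -> P z.
  move=> zx; apply: Hrho.
  have : `|x' - x| <= `|x' - x0| + `|x - x0|.
    rewrite (_ : x' - x = (x' - x0) - (x - x0)); first exact: ler_normB.
    by rewrite opprB addrA subrK.
  have : `|z - x0| <= `|z - x| + `|x - x0|.
    rewrite (_ : z - x0 = (z - x) + (x - x0)); first exact: ler_normD.
    by rewrite addrA subrK.
  lra.
have Px : P x by apply: inP; rewrite subrr normr0.
have Px' : P x' by exact: inP.
split; [exact: le_trans (B0 i x Px) BC|move=> j; exact: le_trans (B1 (i, j) x Px) BC|].
have dF z j : `|z - x| <= `|x' - x| -> derivable (F i) z (delta_mx 0 j).
  by move=> zx; apply: (SF i 1%N j).1; exact: (inP z zx).1.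
have dDF z j k : `|z - x| <= `|x' - x| ->
    derivable ('D_(delta_mx 0 j) (F i)) z (delta_mx 0 k).
  by move=> zx; apply: ((SF i 2%N j).2 k).1; exact: (inP z zx).1.
have [xi [Hxi ->]] := increment_coord (fun z zx j => dF z j zx).
rewrite -sumrB; apply: le_trans (ler_norm_sum _ _ _) _.
have step j : `|'D_(delta_mx 0 j) (F i) (xi j) - 'D_(delta_mx 0 j) (F i) x|
    <= n%:R * B * `|x' - x|.
  have le1 z : `|z - x| <= `|xi j - x| -> `|z - x| <= `|x' - x|.
    by move=> /le_trans; apply.
  have [eta [Heta ->]] := increment_coord (fun z zx k => dDF z j k (le1 z zx)).
  apply: le_trans (ler_norm_sum _ _ _) _.
  have -> : n%:R * B * `|x' - x| = \sum_(k < n) (`|x' - x| * B).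
    by rewrite sumr_const card_ord -[RHS]mulr_natr; ring.
  apply: ler_sum => k _; rewrite normrM; apply: ler_pM => //.
    by apply: le_trans (Hxi j); have := le_mx_norm (xi j - x) 0 k; rewrite !mxE.
  exact: (B2 (i, j, k) _ (inP _ (le1 _ (Heta k)))).
have -> : B * (1 + n%:R * n%:R) * `|x' - x| ^+ 2 =
    B * `|x' - x| ^+ 2 + \sum_(j < n) (`|x' - x| * (n%:R * B * `|x' - x|)).
  by rewrite sumr_const card_ord -[X in _ = _ + X]mulr_natr; ring.
rewrite -[leLHS]add0r lerD ?mulr_ge0 ?exprn_ge0//.
apply: ler_sum => j _; rewrite !mxE -mulrBr normrM.
by apply: ler_pM => //; have := le_mx_norm (x' - x) 0 j; rewrite !mxE.
Qed.

Lemma smooth_taylor_rV (I : finType) (m : nat) (F : I -> 'rV[R]_n -> 'rV[R]_m) :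
  (forall i, smooth_on A (F i)) ->
  exists rho C, [/\ 0 < rho, 0 <= C, forall x, `|x - x0| < rho -> A x &
    forall i x x', `|x - x0| < rho -> `|x' - x0| < rho ->
      [/\ `|F i x| <= C, forall j, `|'D_(delta_mx 0 j) (F i) x| <= C &
          `|F i x' - F i x - \sum_j (x' - x) 0 j *: 'D_(delta_mx 0 j) (F i) x|
            <= C * `|x' - x| ^+ 2]].
Proof.
move=> SF.
have [|rho [C [rho0 C0 HA H]]] := @smooth_taylor_fam (I * 'I_m)%type
  (fun ij x => F ij.1 x 0 ij.2).
  by move=> [i j]; exact: (smooth_coord oA _).1 (SF i) 0 j.
exists rho, C; split => // i x x' xr xr'.
have D j : 'D_(delta_mx 0 j) (F i) x =
    \row_k 'D_(delta_mx 0 j) (fun y => F i y 0 k) x.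
  rewrite derive_mx; first by apply/rowP => k; rewrite !mxE.
  by have [/(_ x (HA x xr))] := SF i 1%N j.
split.
- by apply: mx_norm_le => // a k; rewrite ord1; have [] := H (i, k) x x' xr xr'.
- move=> j; rewrite D; apply: mx_norm_le => // a k; rewrite mxE.
  by have [_ + _] := H (i, k) x x' xr xr'; exact.
- apply: mx_norm_le => [|a k]; first by rewrite mulr_ge0// exprn_ge0.
  rewrite ord1; have [_ _] := H (i, k) x x' xr xr'.
  set s := \sum_j _ => Hs.
  suff -> : (F i x' - F i x - \sum_j (x' - x) 0 j *: 'D_(delta_mx 0 j) (F i) x) 0 k =
    F i x' 0 k - F i x 0 k - s by [].
  rewrite !mxE summxE /s; congr (_ - _); apply: eq_bigr => j _.
  by rewrite D !mxE.
Qed.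

End Taylor.

(** * Lorentzian linear algebra *)

Section Lorentz.
Variables (R : realType) (r : nat).
Implicit Types a b c : 'I_r -> R.

Definition lorentz_form a b : R := \sum_(i < r) frame_sign R i * a i * b i.

Lemma cauchy_schwarz_sum (m : nat) (a b : 'I_m -> R) :
  (\sum_i a i * b i) ^+ 2 <= (\sum_i a i ^+ 2) * (\sum_i b i ^+ 2).
Proof.
set A := \sum_i a i ^+ 2; set B := \sum_i b i ^+ 2; set C := \sum_i a i * b i.
have A0 : 0 <= A by apply: sumr_ge0 => i _; exact: sqr_ge0.
have [A0'|A0'] := eqVneq A 0.
  have a0 i : a i = 0.
    apply/eqP; rewrite -sqrf_eq0; move/eqP: A0'; rewrite psumr_eq0.
      by move/allP/(_ i (mem_index_enum _))/implyP; apply.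
    by move=> j _; exact: sqr_ge0.
  have -> : C = 0 by apply: big1 => i _; rewrite a0 mul0r.
  by rewrite A0' expr0n mul0r.
have : 0 <= \sum_i (A * b i - C * a i) ^+ 2 by apply: sumr_ge0 => i _; exact: sqr_ge0.
have -> : \sum_i (A * b i - C * a i) ^+ 2 = A * (A * B - C ^+ 2).
  transitivity (\sum_i (A ^+ 2 * b i ^+ 2) - \sum_i (2 * A * C * (a i * b i))
    + \sum_i (C ^+ 2 * a i ^+ 2)).
    by rewrite -sumrB -big_split /=; apply: eq_bigr => i _; ring.
  by rewrite -!mulr_sumr -/A -/B -/C; ring.
by rewrite pmulr_rge0 ?subr_ge0// lt_def A0'.
Qed.

Lemma lorentz_formC a b : lorentz_form a b = lorentz_form b a.
Proof. by apply: eq_bigr => i _; ring. Qed.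

End Lorentz.

Lemma lorentz_form_recl (R : realType) (r : nat) (a b : 'I_r.+1 -> R) :
  lorentz_form a b = \sum_i a (lift ord0 i) * b (lift ord0 i) - a ord0 * b ord0.
Proof.
rewrite /lorentz_form big_ord_recl /= addrC; congr (_ + _).
  by apply: eq_bigr => i _; rewrite /frame_sign /= mul1r.
by rewrite /frame_sign eqxx; ring.
Qed.

(** By Cauchy-Schwarz the spatial part of the product of two causal vectors is at most the time part
    in absolute value, so a negative product forces the time components to have the same sign. *)
Lemma time_component_sign (R : realType) (r : nat) (a c : 'I_r.+1 -> R) :
  lorentz_form c c < 0 -> lorentz_form a a <= 0 -> lorentz_form a c < 0 ->
  0 < a ord0 * c ord0.
Proof.
rewrite !lorentz_form_recl.
have := cauchy_schwarz_sum (fun i => a (lift ord0 i)) (fun i => c (lift ord0 i)).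
rewrite /=; set A := \sum_i a (lift ord0 i) ^+ 2.
set C := \sum_i c (lift ord0 i) ^+ 2.
set p := \sum_i a (lift ord0 i) * c (lift ord0 i).
have A0 : 0 <= A by apply: sumr_ge0 => i _; exact: sqr_ge0.
have C0 : 0 <= C by apply: sumr_ge0 => i _; exact: sqr_ge0.
set x := a ord0; set z := c ord0 => cs hC hA hp.
rewrite ltNge; apply/negP => xz.
have hAC : A * C <= (x * x) * (z * z) by apply: ler_pM => //; lra.
have px : `|p| <= `|x * z|.
  rewrite -ler_sqr ?nnegrE// -!normrX !ger0_norm ?sqr_ge0//.
  by apply: le_trans cs _; rewrite exprMn !expr2.
have := ler_norm (- p); rewrite normrN; move: px.
by rewrite (ler0_norm xz); lra.
Qed.

(** The vector [c] stands for the time orientation: it makes the time components [x] of [a] and [y]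
    of [b] agree in sign. With [A], [B] the spatial squares, [p] the spatial product and
    [s = sqrt (A * B)] one has [p <= s < x * y], whence [(x * y - p)^2 >= (x * y - s)^2 >= (x^2 - A)
    * (y^2 - B)], the last step being the inequality [amgm] between the means. *)
Lemma reversed_cauchy_schwarz (R : realType) (r : nat) (a b c : 'I_r -> R) :
  lorentz_form c c < 0 -> lorentz_form a a <= 0 -> lorentz_form b b < 0 ->
  lorentz_form a c < 0 -> lorentz_form b c < 0 ->
  lorentz_form a b < 0 /\
  Num.sqrt (- lorentz_form b b) * Num.sqrt (- lorentz_form a a) <=
    - lorentz_form a b.
Proof.
case: r a b c => [|r] a b c; first by rewrite {1}/lorentz_form big_ord0 ltxx.
move=> hc ha hb hac hbc.
have ac0 := time_component_sign hc ha hac.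
have bc0 := time_component_sign hc (ltW hb) hbc.
move: ha hb; rewrite !lorentz_form_recl.
have := cauchy_schwarz_sum (fun i => a (lift ord0 i)) (fun i => b (lift ord0 i)).
rewrite /=; set A := \sum_i a (lift ord0 i) ^+ 2.
set B := \sum_i b (lift ord0 i) ^+ 2.
set p := \sum_i a (lift ord0 i) * b (lift ord0 i).
have A0 : 0 <= A by apply: sumr_ge0 => i _; exact: sqr_ge0.
have B0 : 0 <= B by apply: sumr_ge0 => i _; exact: sqr_ge0.
move: ac0 bc0; set x := a ord0; set y := b ord0; set z := c ord0.
move=> xz yz cs hA hB.
have xy : 0 < x * y.
  have : 0 < (x * z) * (y * z) by exact: mulr_gt0.
  have -> : (x * z) * (y * z) = (x * y) * z ^+ 2 by ring.
  by rewrite pmulr_lgt0// lt_def sqr_ge0 sqrf_eq0 andbT; apply: contraTneq yz => ->;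
    rewrite mulr0 ltxx.
pose s := Num.sqrt (A * B).
have s0 : 0 <= s by exact: sqrtr_ge0.
have sE : s ^+ 2 = A * B by rewrite sqr_sqrtr// mulr_ge0.
have ps : p <= s.
  apply: le_trans (ler_norm p) _.
  by rewrite -ler_sqr ?nnegrE// sE -normrX ger0_norm ?sqr_ge0.
have x2 : 0 < x * x.
  by rewrite -expr2 lt_def sqr_ge0 sqrf_eq0 andbT; apply: contraTneq xy => ->;
    rewrite mul0r ltxx.
have sxy : s < x * y.
  rewrite -ltr_sqr ?nnegrE// ?ltW// sE exprMn !expr2.
  apply: (@le_lt_trans _ _ (x * x * B)); first by apply: ler_wpM2r => //; lra.
  by rewrite ltr_pM2l//; lra.
split; first lra.
have h1 : 0 <= x * x - A by lra.
have h2 : 0 <= y * y - B by lra.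
rewrite !opprB -sqrtrM//.
have -> : x * y - p = Num.sqrt ((x * y - p) ^+ 2) by rewrite sqrtr_sqr gtr0_norm//; lra.
rewrite ler_wsqrtr// -subr_ge0.
have amgm : 2 * (x * y) * s <= x * x * B + y * y * A.
  have [sA sB] : 0 <= Num.sqrt A /\ 0 <= Num.sqrt B by rewrite !sqrtr_ge0.
  have -> : s = Num.sqrt A * Num.sqrt B by rewrite /s sqrtrM.
  have eA : Num.sqrt A ^+ 2 = A by rewrite sqr_sqrtr.
  have eB : Num.sqrt B ^+ 2 = B by rewrite sqr_sqrtr.
  have := sqr_ge0 (x * Num.sqrt B - y * Num.sqrt A).
  rewrite -{3}eA -{3}eB; lra.
have : 0 <= (s - p) * (2 * (x * y) - p - s) by apply: mulr_ge0; lra.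
have : (y * y - B) * (x * x - A) = (x * y) ^+ 2 - y * y * A - x * x * B + s ^+ 2.
  by rewrite sE; ring.
move=> ->; nra.
Qed.

(** * Orthonormal bases and the metric dual of a covector *)

Section OrthonormalFrame.
Variables (R : realType) (n r : nat) (D : {vspace 'rV[R]_n}).
Variable g : 'rV[R]_n -> 'rV[R]_n -> R.
Hypothesis g_bil : symmetric_bilinear_on D g.
Variable X : 'I_r -> 'rV[R]_n.
Hypothesis X_D : forall i, X i \in D.

Lemma bilinear0l w : w \in D -> g 0 w = 0.
Proof.
move=> wD; have [_ gl] := g_bil.
have := gl 1 0 0 w (mem0v _) (mem0v _) wD.
by rewrite scale1r addr0 mul1r => /esym/eqP; rewrite -subr_eq0 addrK => /eqP.
Qed.

Lemma bilinear_suml (I : Type) (s : seq I) (a : I -> R) (V : I -> 'rV[R]_n) w :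
  (forall i, V i \in D) -> w \in D ->
  g (\sum_(i <- s) a i *: V i) w = \sum_(i <- s) a i * g (V i) w.
Proof.
move=> VD wD; have [_ gl] := g_bil; elim: s => [|i s IH].
  by rewrite !big_nil bilinear0l.
rewrite !big_cons gl// ?IH//.
by apply: memv_suml => j _; exact: memvZ.
Qed.

Hypothesis X_on : forall i j, g (X i) (X j) = if i == j then frame_sign R i else 0.

Lemma frame_sign_sqr (i : 'I_r) : frame_sign R i * frame_sign R i = 1.
Proof. by rewrite /frame_sign; case: ifP => _; ring. Qed.

Lemma frame_sum_mem (a : 'I_r -> R) : \sum_i a i *: X i \in D.
Proof. by apply: memv_suml => i _; exact: memvZ. Qed.

Lemma metric_frame_coord (a : 'I_r -> R) j :
  g (\sum_i a i *: X i) (X j) = frame_sign R j * a j.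
Proof.
rewrite bilinear_suml// (bigD1 j)//= X_on eqxx big1 ?addr0 1?mulrC//.
by move=> i ij; rewrite X_on (negPf ij) mulr0.
Qed.

Lemma metric_frame (a b : 'I_r -> R) :
  g (\sum_i a i *: X i) (\sum_i b i *: X i) = lorentz_form a b.
Proof.
have [gs _] := g_bil.
rewrite gs ?frame_sum_mem// bilinear_suml// ?frame_sum_mem//.
apply: eq_bigr => i _; rewrite gs ?frame_sum_mem// metric_frame_coord; ring.
Qed.

Hypothesis dimD : \dim D = r.

(** Taking the product with [X i] recovers the i-th coefficient up to sign, so the vectors are free,
    and their number is the dimension. *)
Lemma frame_span v : v \in D -> exists a : 'I_r -> R, v = \sum_i a i *: X i.
Proof.
pose t := [tuple X i | i < r].
have t_free : free t.
  apply/freeP => k k0 i.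
  have : \sum_i k i *: X i = 0.
    by rewrite -[RHS]k0; apply: eq_bigr => j _; rewrite /t nth_mktuple.
  move=> k0'; have := metric_frame_coord k i.
  rewrite k0' bilinear0l// => /esym/eqP; rewrite mulf_eq0 => /orP[|/eqP//].
  by rewrite /frame_sign; case: ifP => _; rewrite ?oppr_eq0 oner_eq0.
have tD : basis_of D t.
  rewrite basisEfree t_free size_tuple dimD leqnn andbT /=.
  by apply/span_subvP => _ /mapP[i _ ->].
move=> vD; exists (fun i => coord t i v).
rewrite {1}(coord_basis tD vD); apply: eq_bigr => i _.
by rewrite /t nth_mktuple.
Qed.

Definition horizontal_gradient (l : 'cV[R]_n) : 'rV[R]_n :=
  \sum_i (frame_sign R i * pairing l (X i)) *: X i.

Lemma pairing_sum (I : Type) (s : seq I) (l : 'cV[R]_n) (V : I -> 'rV[R]_n) :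
  pairing l (\sum_(i <- s) V i) = \sum_(i <- s) pairing l (V i).
Proof. by rewrite /pairing mulmx_suml summxE. Qed.

Lemma pairingZ (l : 'cV[R]_n) (k : R) (v : 'rV[R]_n) :
  pairing l (k *: v) = k * pairing l v.
Proof. by rewrite /pairing -scalemxAl mxE. Qed.

Lemma metric_horizontal_gradient l v : v \in D ->
  g (horizontal_gradient l) v = pairing l v.
Proof.
move=> /frame_span[a ->]; rewrite metric_frame pairing_sum.
apply: eq_bigr => i _; rewrite pairingZ mulrA frame_sign_sqr mul1r; ring.
Qed.

Lemma pairing_horizontal_gradient l :
  pairing l (horizontal_gradient l) = \sum_i frame_sign R i * pairing l (X i) ^+ 2.
Proof.
by rewrite /horizontal_gradient pairing_sum; apply: eq_bigr => i _; rewrite pairingZ; ring.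
Qed.

End OrthonormalFrame.

(* The horizontal gradient is the metric dual of the covector, so it does not depend on the frame. *)
Lemma hamiltonian_frame_indep (R : realType) (n r : nat) (D : {vspace 'rV[R]_n})
    (g : 'rV[R]_n -> 'rV[R]_n -> R) (X Y : 'I_r -> 'rV[R]_n) (l : 'cV[R]_n) :
  symmetric_bilinear_on D g -> nondegenerate_on D g -> \dim D = r ->
  (forall i, X i \in D) -> (forall i, Y i \in D) ->
  (forall i j, g (X i) (X j) = if i == j then frame_sign R i else 0) ->
  (forall i j, g (Y i) (Y j) = if i == j then frame_sign R i else 0) ->
  \sum_i frame_sign R i * pairing l (X i) ^+ 2 =
  \sum_i frame_sign R i * pairing l (Y i) ^+ 2.
Proof.
move=> gb gnd dD XD YD Xon Yon.
rewrite -!pairing_horizontal_gradient; congr pairing.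
apply/eqP; rewrite -subr_eq0; apply/eqP.
have mX : horizontal_gradient X l \in D by exact: frame_sum_mem.
have mY : horizontal_gradient Y l \in D by exact: frame_sum_mem.
apply: gnd => [|w wD]; first exact: rpredB.
have [_ gl] := gb.
rewrite addrC -scaleN1r gl// (metric_horizontal_gradient gb XD Xon dD)//.
by rewrite (metric_horizontal_gradient gb YD Yon dD)//; ring.
Qed.

(** * The Hamiltonian of a frame in coordinates *)

Section QuadraticEstimate.
Variables (R : realType) (n r : nat).

Lemma le_pairing (l : 'cV[R]_n) (v : 'rV[R]_n) :
  `|pairing l v| <= n%:R * `|l| * `|v|.
Proof.
rewrite /pairing mxE; apply: le_trans (ler_norm_sum _ _ _) _.
have -> : n%:R * `|l| * `|v| = \sum_(k < n) (`|v| * `|l|).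
  by rewrite sumr_const card_ord -[RHS]mulr_natr; ring.
by apply: ler_sum => k _; rewrite normrM; apply: ler_pM => //; exact: le_mx_norm.
Qed.

Lemma pairingDl (l m : 'cV[R]_n) (v : 'rV[R]_n) :
  pairing (l + m) v = pairing l v + pairing m v.
Proof. by rewrite /pairing mulmxDr mxE. Qed.

Lemma pairingDr (l : 'cV[R]_n) (v w : 'rV[R]_n) :
  pairing l (v + w) = pairing l v + pairing l w.
Proof. by rewrite /pairing mulmxDl mxE. Qed.

Lemma pairingNr (l : 'cV[R]_n) (v : 'rV[R]_n) : pairing l (- v) = - pairing l v.
Proof. by rewrite /pairing mulNmx mxE. Qed.

Lemma pairingZl (l : 'cV[R]_n) (k : R) (v : 'rV[R]_n) :
  pairing (k *: l) v = k * pairing l v.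
Proof. by rewrite /pairing -scalemxAr mxE. Qed.

Lemma pairingE (l : 'cV[R]_n) (v : 'rV[R]_n) : pairing l v = \sum_k v 0 k * l k 0.
Proof. by rewrite /pairing mxE. Qed.

Definition frame_hamiltonian (Y : 'I_r -> 'rV[R]_n) (l : 'cV[R]_n) : R :=
  2^-1 * \sum_i frame_sign R i * pairing l (Y i) ^+ 2.

(** Pure algebra: the frame moves by [Dy] of order [t] up to order [t^2], the covector by [d] of
    order [t], and the constant of the quadratic remainder depends on the bounds [P], [C], [L]
    alone. This uniformity is what later allows the choice of [K]. *)
Lemma frame_hamiltonian_expand (P C L : R) : 0 <= P -> 0 <= C -> 0 <= L ->
  exists2 K, 0 <= K & forall (p d : 'cV[R]_n) (Yx Yz Dy : 'I_r -> 'rV[R]_n) (t : R),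
    0 <= t <= 1 -> `|p| <= P -> `|d| <= L * t ->
    (forall i, [/\ `|Yx i| <= C, `|Dy i| <= C * t &
       `|Yz i - Yx i - Dy i| <= C * t ^+ 2]) ->
    `|frame_hamiltonian Yz (p + d) - frame_hamiltonian Yx p -
      \sum_i frame_sign R i * pairing p (Yx i) * (pairing p (Dy i) + pairing d (Yx i))|
      <= K * t ^+ 2.
Proof.
move=> P0 C0 L0; pose N : R := n%:R.
have N0 : 0 <= N by [].
(* [b0], [d0 * t] and [e0 * t ^+ 2] bound the parts [bb], [dd], [ee] of order zero, one and two of
   the pairing of [p + d] with [Yz i]. *)
pose b0 := N * P * C; pose d0 := N * P * C + N * L * C.
pose e0 := N * P * C + 2 * (N * L * C).
have [NPC NLC] : 0 <= N * P * C /\ 0 <= N * L * C by rewrite !mulr_ge0.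
have b00 : 0 <= b0 by []. have d00 : 0 <= d0 by rewrite addr_ge0.
have e00 : 0 <= e0 by rewrite addr_ge0// mulr_ge0.
pose K1 := 2 * b0 * e0 + (d0 + e0) ^+ 2.
have K10 : 0 <= K1 by rewrite addr_ge0 ?sqr_ge0// !mulr_ge0.
exists (2^-1 * (r%:R * K1)); first by rewrite !mulr_ge0.
move=> p d Yx Yz Dy t /andP[t0 t1] pP dL HY.
have tt : t ^+ 2 <= t by rewrite expr2 ler_piMl.
have term i : `|frame_sign R i * pairing (p + d) (Yz i) ^+ 2 -
   frame_sign R i * pairing p (Yx i) ^+ 2 -
   2 * (frame_sign R i * pairing p (Yx i) * (pairing p (Dy i) + pairing d (Yx i)))|
   <= K1 * t ^+ 2.
  have [HYx HDy HR] := HY i.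
  set Ri := Yz i - Yx i - Dy i in HR.
  have -> : Yz i = Yx i + Dy i + Ri by rewrite /Ri -[_ - _ - _]addrA -opprD [RHS]addrC subrK.
  set bb := pairing p (Yx i).
  set dd := pairing p (Dy i) + pairing d (Yx i).
  pose ee := pairing p Ri + pairing d (Dy i + Ri).
  have -> : pairing (p + d) (Yx i + Dy i + Ri) = bb + dd + ee.
    by rewrite pairingDl /bb /dd /ee !pairingDr; ring.
  have bound (l : 'cV[R]_n) v A B : `|l| <= A -> `|v| <= B -> `|pairing l v| <= N * A * B.
    move=> lA vB; apply: le_trans (le_pairing l v) _.
    by apply: ler_pM; rewrite ?mulr_ge0 ?ler_wpM2l.
  have hb : `|bb| <= b0 by exact: bound.
  have hd : `|dd| <= d0 * t.
    apply: le_trans (ler_normD _ _) _.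
    have := bound _ _ _ _ pP HDy; have := bound _ _ _ _ dL HYx.
    by rewrite /d0 mulrDl; lra.
  have he : `|ee| <= e0 * t ^+ 2.
    apply: le_trans (ler_normD _ _) _.
    have HDR : `|Dy i + Ri| <= 2 * C * t.
      apply: le_trans (ler_normD _ _) _.
      have : C * t ^+ 2 <= C * t by apply: ler_wpM2l.
      lra.
    have := bound _ _ _ _ pP HR; have := bound _ _ _ _ dL HDR.
    rewrite /e0 mulrDl; lra.
  have he' : `|ee| <= e0 * t by apply: le_trans he _; apply: ler_wpM2l.
  have hde : `|dd + ee| <= (d0 + e0) * t.
    by apply: le_trans (ler_normD _ _) _; rewrite mulrDl; exact: lerD.
  have hsq : (dd + ee) ^+ 2 <= (d0 + e0) ^+ 2 * t ^+ 2.
    by rewrite -exprMn -[leLHS]real_normK ?num_real// ler_sqr ?nnegrE// mulr_ge0// addr_ge0.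
  have hbe : `|bb * ee| <= b0 * e0 * t ^+ 2.
    by rewrite normrM -mulrA; apply: ler_pM.
  have s0 : 0 <= (dd + ee) ^+ 2 by exact: sqr_ge0.
  have -> : frame_sign R i * (bb + dd + ee) ^+ 2 - frame_sign R i * bb ^+ 2
    - 2 * (frame_sign R i * bb * dd) = frame_sign R i * (2 * (bb * ee) + (dd + ee) ^+ 2) by ring.
  have -> (u : R) : `|frame_sign R i * u| = `|u|.
    by rewrite /frame_sign; case: ifP => _; rewrite ?mulN1r ?mul1r ?normrN.
  apply: le_trans (ler_normD _ _) _; rewrite normrM (ger0_norm s0) ger0_norm//.
  by rewrite /K1 [leRHS]mulrDl; lra.
rewrite /frame_hamiltonian.
set s1 := \sum_i _; set s2 := \sum_i _; set s3 := \sum_i _.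
have -> : 2^-1 * s1 - 2^-1 * s2 - s3 = 2^-1 * (s1 - s2 - 2 * s3) by field.
rewrite normrM (ger0_norm (_ : 0 <= 2^-1 :> R)) ?invr_ge0// -!mulrA ler_wpM2l ?invr_ge0//.
rewrite /s3 mulr_sumr -!sumrB; apply: le_trans (ler_norm_sum _ _ _) _.
have -> : r%:R * (K1 * t ^+ 2) = \sum_(i < r) (K1 * t ^+ 2).
  by rewrite sumr_const card_ord -[RHS]mulr_natr mulrC.
by apply: ler_sum => i _; exact: term.
Qed.

End QuadraticEstimate.

(** * One-sided derivatives *)

Section DerivativeWithin.
Variables (R : realType) (V : normedModType R).
Implicit Types (f : R -> V) (A : set R).

Lemma has_derivative_within_eps A f t v : has_derivative_within A f t v ->
  forall e, 0 < e -> exists2 d, 0 < d & forall s, A s -> `|s - t| < d ->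
    `|f s - f t - (s - t) *: v| <= e * `|s - t|.
Proof.
move=> H e e0; move/cvgrPdist_lt: H => /(_ e e0)[d /= d0 Hd].
exists d => // s As st.
have [->|sNt] := eqVneq s t; first by rewrite !subrr scale0r subr0 !normr0 mulr0.
have st0 : s - t != 0 by rewrite subr_eq0.
have := Hd s; rewrite /= distrC => /(_ st sNt As) /ltW Hs.
have -> : f s - f t - (s - t) *: v = (s - t) *: ((s - t)^-1 *: (f s - f t) - v).
  by rewrite scalerBr scalerA divff// scale1r.
by rewrite normrZ mulrC ler_wpM2r// distrC.
Qed.

Lemma is_derive_eps f t v :
  (forall e, 0 < e -> exists2 d, 0 < d & forall s, `|s - t| < d ->
    `|f s - f t - (s - t) *: v| <= e * `|s - t|) ->
  is_derive t 1 f v.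
Proof.
move=> H.
have C : h^-1 *: ((f \o shift t) (h *: 1) - f t) @[h --> 0^'] --> v.
  apply/cvgrPdist_le => e e0; have [d d0 Hd] := H e e0.
  exists d => // h; rewrite /= sub0r normrN => hd h0.
  have := Hd (h + t); rewrite addrK => /(_ hd) Hh.
  rewrite -[h *: 1]/(h * 1) mulr1.
  have -> : v - h^-1 *: (f (h + t) - f t) = - (h^-1 *: (f (h + t) - f t - h *: v)).
    by rewrite [in RHS]scalerBr scalerA mulVf// scale1r opprB.
  rewrite normrN normrZ normfV mulrC ler_pdivrMr ?normr_gt0//.
apply: DeriveDef; first by apply/cvg_ex; exists v.
exact: cvg_lim C.
Qed.

Lemma has_derivative_within_interior a b f t v : a < t < b ->
  has_derivative_within [set` `[a, b]] f t v -> is_derive t 1 f v.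
Proof.
move=> /andP[at_ tb] /has_derivative_within_eps H; apply: is_derive_eps => e e0.
have [d d0 Hd] := H e e0.
exists (Num.min d (Num.min (t - a) (b - t))); first by rewrite !lt_min d0; lra.
move=> s; rewrite !lt_min => /andP[sd /andP[sa sb]]; apply: Hd => //=.
by move: sa sb; rewrite in_itv /= !ltr_norml; lra.
Qed.

Lemma has_derivative_within_lip A f t v : has_derivative_within A f t v ->
  exists2 d, 0 < d & forall s, A s -> `|s - t| < d ->
    `|f s - f t| <= (`|v| + 1) * `|s - t|.
Proof.
move=> /has_derivative_within_eps /(_ 1 ltr01) [d d0 Hd]; exists d => // s As st.
have := Hd s As st; set u := f s - f t - _ => Hu.
have -> : f s - f t = u + (s - t) *: v by rewrite /u subrK.
by apply: le_trans (ler_normD _ _) _; rewrite normrZ; lra.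
Qed.

Lemma has_derivative_within_near A f t v : has_derivative_within A f t v ->
  forall e, 0 < e -> exists2 d, 0 < d & forall s, A s -> `|s - t| < d ->
    `|f s - f t| < e.
Proof.
move=> /has_derivative_within_lip[d d0 Hd] e e0.
have v0 : 0 < `|v| + 1 by rewrite ltr_wpDl.
exists (Num.min d (e / (`|v| + 1))); first by rewrite lt_min d0 divr_gt0.
move=> s As; rewrite lt_min => /andP[sd se]; apply: le_lt_trans (Hd s As sd) _.
by rewrite mulrC -ltr_pdivlMr.
Qed.

Lemma within_continuous_eps (a b : R) (f : R -> V) :
  (forall x, a <= x <= b -> forall e, 0 < e -> exists2 d, 0 < d &
     forall y, a <= y <= b -> `|y - x| < d -> `|f y - f x| < e) ->
  {within [set` `[a, b]], continuous f}.
Proof.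
move=> H; apply/subspace_continuousP => x; rewrite /= in_itv /= => xab.
apply/cvgrPdist_lt => e e0.
have [d d0 Hd] := H x xab e e0.
by exists d => //= y; rewrite in_itv /= distrC => yx yab; rewrite distrC; exact: Hd.
Qed.

End DerivativeWithin.

(** Derivatives relative to [[a, b]] are two-sided inside and give continuity at the ends, which is
    all that the mean value theorem asks for; [s = a] and [t = b] are thus allowed. *)
Lemma mean_value_within (R : realType) (a b : R) (f : R -> R^o) (df : R -> R) (s t : R) :
  a <= s -> s <= t -> t <= b ->
  (forall x, s <= x <= t -> has_derivative_within [set` `[a, b]] f x (df x)) ->
  exists2 c, s <= c <= t & f t - f s = df c * (t - s).
Proof.
move=> as_ st tb Hf.
have [||c cst E] := @MVT_segment _ (f : R -> R) df _ _ st.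
- move=> x; rewrite in_itv /= => /andP[sx xt].
  apply: (@has_derivative_within_interior _ _ a b); first lra.
  by apply: Hf; lra.
- apply: (@within_continuous_eps _ R) => x /andP[sx xt] e e0.
  have [|d d0 Hd] := has_derivative_within_near (Hf x _) e0; first by rewrite sx.
  exists d => // y /andP[sy yt]; apply: Hd; rewrite /= in_itv /=; lra.
by exists c => //; move: cst; rewrite in_itv.
Qed.

Lemma has_derivative_within_coord (R : realType) (m n : nat) A
    (f : R -> 'M[R]_(m, n)) t v i j :
  has_derivative_within A f t v ->
  has_derivative_within A (fun s => f s i j : R^o) t (v i j).
Proof.
move=> H; apply/cvgrPdist_le => e e0; move/cvgrPdist_le: H => /(_ e e0).
apply: filterS => s; apply: le_trans.
by have := le_mx_norm (v - (s - t)^-1 *: (f s - f t)) i j; rewrite !mxE.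
Qed.

(* If [u] is differentiable at [theta s] and [u \o theta] at [s], then so is [theta]: Caratheodory's
   slope function of [u] turns difference quotients of [u \o theta] into those of [theta]. *)
Lemma is_derive_left_inverse (R : realType) (u theta : R -> R) (s du dw : R) :
  {for s, continuous theta} -> is_derive (theta s) 1 u du -> du != 0 ->
  is_derive s 1 (u \o theta) dw -> is_derive s 1 theta (dw / du).
Proof.
move=> ct Du du0 Dw.
pose q x := if x == theta s then du else (u x - u (theta s)) / (x - theta s).
have qE x : u x - u (theta s) = q x * (x - theta s).
  rewrite /q; case: eqVneq => [->|xs]; first by rewrite !subrr mulr0.
  by rewrite divfK// subr_eq0.
have cq : {for theta s, continuous q}.
  apply/cvgrPdist_le => e e0.
  have Cu : h^-1 *: ((u \o shift (theta s)) (h *: 1) - u (theta s)) @[h --> 0^'] --> du.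
    by rewrite -(@derive_val _ _ _ _ _ _ _ Du); exact: (@ex_derive _ _ _ _ _ _ _ Du).
  move/cvgrPdist_le : Cu => /(_ e e0)[d /= d0 Hd].
  exists d => // x; rewrite /= distrC => xd.
  rewrite /q eqxx; case: eqVneq => [_|xs]; first by rewrite subrr normr0 ltW.
  have := Hd (x - theta s); rewrite /= sub0r normrN => /(_ xd).
  rewrite subr_eq0 => /(_ xs); rewrite -[_ *: 1]/(_ * 1) mulr1 subrK.
  by rewrite -[_ *: _]/(_ * _) mulrC.
have qs : q (theta s) = du by rewrite /q eqxx.
have cqt : {for s, continuous (q \o theta)} by apply: continuous_comp.
have Cw : h^-1 *: (((u \o theta) \o shift s) (h *: 1) - (u \o theta) s) @[h --> 0^'] --> dw.
  by rewrite -(@derive_val _ _ _ _ _ _ _ Dw); exact: (@ex_derive _ _ _ _ _ _ _ Dw).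
have Cq : (q \o theta) (h + s) @[h --> (0 : R)^'] --> du.
  have cs : {for 0, continuous (fun h : R => (q \o theta) (h + s))}.
    apply: (@continuous_comp _ _ _ (fun h : R => h + s) (q \o theta)).
      by apply: (continuousD (f := id) (g := cst s)); [exact: cvg_id|exact: cst_continuous].
    by rewrite add0r.
  by move/continuous_withinNx : cs; rewrite add0r /= qs.
have C : h^-1 *: ((theta \o shift s) (h *: 1) - theta s) @[h --> 0^'] --> dw / du.
  apply: (cvg_trans _ (cvgM Cw (cvgV du0 Cq))); apply: near_eq_cvg.
  near=> h.
  have qh : (q \o theta) (h + s) != 0 by near: h; exact: (cvgr_neq0 _ Cq du0).
  rewrite /= -[h *: 1]/(h * 1) mulr1 qE /=.
  rewrite -![_ *: _]/(_ * _) -mulrA; congr (_ * _).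
  by rewrite mulrAC divff ?mul1r.
apply: DeriveDef; first by apply/cvg_ex; exists (dw / du).
exact: cvg_lim C.
Unshelve. all: by end_near. Qed.

Section HamiltonianVectorField.
Variables (R : realType) (n r : nat) (Y : 'I_r -> 'rV[R]_n -> 'rV[R]_n).

Definition ham (x : 'rV[R]_n) (l : 'cV[R]_n) : R := frame_hamiltonian (fun i => Y i x) l.

Definition ham_velocity (x : 'rV[R]_n) (l : 'cV[R]_n) : 'rV[R]_n :=
  horizontal_gradient (fun i => Y i x) l.

(** This is [- dH/dx] with the differentiation of the quadratic form carried out, just as
    [ham_velocity] is [dH/dl]. *)
Definition ham_force (x : 'rV[R]_n) (l : 'cV[R]_n) : 'cV[R]_n :=
  - \col_j \sum_i frame_sign R i * pairing l (Y i x)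
      * pairing l ('D_(delta_mx 0 j) (Y i) x).

Lemma pairing_ham_velocity x l : pairing l (ham_velocity x l) = 2 * ham x l.
Proof.
rewrite /ham_velocity pairing_horizontal_gradient /ham /frame_hamiltonian.
by rewrite mulrA divff ?mul1r// pnatr_eq0.
Qed.

Lemma pairing_ham_force x l y :
  - pairing (ham_force x l) y = \sum_i frame_sign R i * pairing l (Y i x) *
    pairing l (\sum_j y 0 j *: 'D_(delta_mx 0 j) (Y i) x).
Proof.
rewrite pairingE -sumrN.
transitivity (\sum_j \sum_i y 0 j * (frame_sign R i * pairing l (Y i x) *
   pairing l ('D_(delta_mx 0 j) (Y i) x))).
  by apply: eq_bigr => j _; rewrite !mxE mulrN opprK mulr_sumr.
rewrite exchange_big /=; apply: eq_bigr => i _.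
rewrite pairing_sum mulr_sumr; apply: eq_bigr => j _.
by rewrite pairingZ; ring.
Qed.

Lemma pairing_ham_velocity_sum x l d :
  pairing d (ham_velocity x l) =
  \sum_i frame_sign R i * pairing l (Y i x) * pairing d (Y i x).
Proof.
rewrite /ham_velocity pairing_sum; apply: eq_bigr => i _.
by rewrite pairingZ.
Qed.

Variables (A : set 'rV[R]_n) (x0 : 'rV[R]_n).
Hypotheses (oA : open A) (Ax0 : A x0) (SY : forall i, smooth_on A (Y i)).

(** The radius and the bounds on the frame come before [P] and [L], because the size [L] of the
    shift of the covector is itself computed from those bounds in [ham_calibration]. *)
Lemma ham_expansion : exists rho C, [/\ 0 < rho, 0 <= C,
  forall x, `|x - x0| < rho -> A x,
  forall x i, `|x - x0| < rho ->
    `|Y i x| <= C /\ forall j, `|'D_(delta_mx 0 j) (Y i) x| <= C &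
  forall P L, 0 <= P -> 0 <= L -> exists2 K, 0 <= K &
    forall x z p d t, `|x - x0| < rho -> `|z - x0| < rho -> `|z - x| <= t -> t <= 1 ->
      `|p| <= P -> `|d| <= L * t ->
      `|ham z (p + d) - ham x p -
        (pairing d (ham_velocity x p) - pairing (ham_force x p) (z - x))| <= K * t ^+ 2].
Proof.
have [rho [C [rho0 C0 HA H]]] := smooth_taylor_rV oA Ax0 SY.
exists rho, C; split => //.
  by move=> x i xr; have [] := H i x x xr xr.
(* The differential of [Y i] applied to [z - x] is a sum of [n] terms of size [C * t], hence the
   factor. *)
move=> P L P0 L0; pose C' := C * (n%:R + 1).
have n1 : 1 <= n%:R + 1 :> R by rewrite lerDr.
have C'0 : 0 <= C' by rewrite mulr_ge0// (le_trans _ n1).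
have CC' : C <= C' by rewrite ler_peMr.
have [K K0 HK] := frame_hamiltonian_expand n r P0 C'0 L0.
exists K => // x z p d t xr zr zxt t1 pP dL.
have t0 : 0 <= t by exact: le_trans zxt.
have -> : ham z (p + d) - ham x p - (pairing d (ham_velocity x p) - pairing (ham_force x p) (z - x))
  = ham z (p + d) - ham x p - \sum_i frame_sign R i * pairing p (Y i x) *
    (pairing p (\sum_j (z - x) 0 j *: 'D_(delta_mx 0 j) (Y i) x) + pairing d (Y i x)).
  congr (_ - _); rewrite pairing_ham_velocity_sum pairing_ham_force -big_split /=.
  by apply: eq_bigr => i _; ring.
apply: HK => //; first by rewrite t0.
move=> i; have [H1 H2 H3] := H i x z xr zr; split.
- exact: le_trans H1 CC'.
- apply: le_trans (ler_norm_sum _ _ _) _.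
  apply: (@le_trans _ _ (\sum_(j < n) t * C)).
    apply: ler_sum => j _; rewrite normrZ; apply: ler_pM => //.
    by apply: le_trans zxt; exact: le_mx_norm.
  rewrite sumr_const card_ord -[leLHS]mulr_natr /C'.
  have : 0 <= C * t by rewrite mulr_ge0.
  by rewrite mulrDr mulr1 mulrDl; lra.
- apply: le_trans H3 _; apply: ler_pM; rewrite ?exprn_ge0//.
  by rewrite ler_sqr ?nnegrE.
Qed.

End HamiltonianVectorField.

Lemma has_derivative_within_of_eps (R : realType) (V : normedModType R) (A : set R)
    (f : R -> V) t v :
  (forall e, 0 < e -> exists2 d, 0 < d & forall s, A s -> `|s - t| < d ->
    `|f s - f t - (s - t) *: v| <= e * `|s - t|) ->
  has_derivative_within A f t v.
Proof.
move=> H; apply/cvgrPdist_le => e e0; have [d d0 Hd] := H e e0.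
exists d => // s; rewrite /= distrC => sd sNt As.
have st0 : s - t != 0 by rewrite subr_eq0.
have := Hd s As sd.
have -> : f s - f t - (s - t) *: v = (s - t) *: ((s - t)^-1 *: (f s - f t) - v).
  by rewrite scalerBr scalerA divff// scale1r.
by rewrite normrZ mulrC ler_pM2r ?normr_gt0// distrC.
Qed.

(** * Conservation of the Hamiltonian and the strict subsolution *)

Section Calibration.
Variables (R : realType) (n r : nat) (Y : 'I_r -> 'rV[R]_n -> 'rV[R]_n).
Variables (A : set 'rV[R]_n).
Hypotheses (oA : open A) (SY : forall i, smooth_on A (Y i)).

(** For increments along the Hamiltonian field, [dl *: v] of the point and [dl *: f] of the
    covector, the linear part of [ham_expansion] is [dl * (<f, v> - <f, v>) = 0]. Hence the
    derivative of [H] vanishes, also in the one-sided sense at the ends. *)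
Lemma ham_conserved (a b s0 s1 : R) (x : R -> 'rV[R]_n) (p : R -> 'cV[R]_n) :
  a <= s0 -> s0 <= s1 -> s1 <= b ->
  (forall s, s0 <= s <= s1 -> [/\ A (x s),
     has_derivative_within [set` `[a, b]] x s (ham_velocity Y (x s) (p s)) &
     has_derivative_within [set` `[a, b]] p s (ham_force Y (x s) (p s))]) ->
  ham Y (x s1) (p s1) = ham Y (x s0) (p s0).
Proof.
move=> as0 s01 s1b H.
suff D0 s : s0 <= s <= s1 ->
    has_derivative_within [set` `[a, b]] (fun s => ham Y (x s) (p s) : R^o) s (0 : R).
  have [c _] := mean_value_within as0 s01 s1b D0.
  by rewrite mul0r => /eqP; rewrite subr_eq0 => /eqP.
move=> sI; have [As Dx Dp] := H s sI.
set v := ham_velocity _ _ _ in Dx; set f := ham_force _ _ _ in Dp.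
have [rho [C [rho0 C0 _ _ HE]]] := ham_expansion oA As SY.
have [K K0 HK] := HE (`|p s|) 1 (normr_ge0 _) ler01.
have [dx dx0 Hdx] := has_derivative_within_lip Dx.
have [dp dp0 Hdp] := has_derivative_within_lip Dp.
have [dr dr0 Hdr] := has_derivative_within_near Dx rho0.
pose X := `|v| + 1 + (`|f| + 1).
have vX : `|v| + 1 <= X by rewrite /X lerDl addr_ge0.
have fX : `|f| + 1 <= X by rewrite /X lerDr addr_ge0.
have X1 : 1 <= X by apply: le_trans vX; rewrite lerDr.
have X0 : 0 < X by exact: lt_le_trans X1.
(* The coefficients of the three errors: the quadratic remainder at [t = X * |dl|], and the pairings
   of [v] and [f] with the errors [up] and [ux] of the linearised increments. *)
pose M := K * X ^+ 2 + n%:R * `|v| + n%:R * `|f|.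
have M0 : 0 <= M by rewrite !addr_ge0// mulr_ge0// exprn_ge0// ltW.
apply: has_derivative_within_of_eps => e e0.
have e'0 : 0 < e / (M + 1) by rewrite divr_gt0// ltr_wpDl.
have [ex ex0 Hex] := has_derivative_within_eps Dx e'0.
have [ep ep0 Hep] := has_derivative_within_eps Dp e'0.
pose d1 := Num.min (Num.min dx dp) (Num.min ex ep).
(* [X^-1] ensures [t <= 1], [dr] keeps the curve in the ball of the expansion, and the last bound
   makes one factor [|dl|] of the quadratic remainder small. *)
pose d2 := Num.min (Num.min X^-1 dr) (e / (M + 1)).
exists (Num.min d1 d2).
  by rewrite !lt_min dx0 dp0 ex0 ep0 dr0 e'0 invr_gt0 X0.
move=> s' As'; rewrite !lt_min => /andP[/andP[/andP[h1 h2] /andP[h3 h4]] /andP[/andP[h5 h6] h7]].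
rewrite scaler0 subr0.
set dl := s' - s in h1 h2 h3 h4 h5 h6 h7 *.
pose t := X * `|dl|.
have yt : `|x s' - x s| <= t.
  by apply: le_trans (Hdx _ As' h1) _; rewrite /t ler_wpM2r.
have dt : `|p s' - p s| <= 1 * t.
  by rewrite mul1r; apply: le_trans (Hdp _ As' h2) _; rewrite /t ler_wpM2r.
have t1 : t <= 1.
  by rewrite /t mulrC -ler_pdivlMr// div1r ltW.
have := HK (x s) (x s') (p s) (p s' - p s) t _ _ yt t1 (lexx _) dt.
rewrite subrr normr0 => /(_ rho0 (Hdr _ As' h6)).
rewrite [p s + _]addrC subrK -/v -/f.
set E := ham Y (x s') (p s') - ham Y (x s) (p s).
pose ux := x s' - x s - dl *: v; pose up := p s' - p s - dl *: f.
have -> : x s' - x s = ux + dl *: v by rewrite /ux subrK.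
have -> : p s' - p s = up + dl *: f by rewrite /up subrK.
rewrite pairingDl pairingZl pairingDr pairingZ.
have Hux : `|ux| <= e / (M + 1) * `|dl| by exact: Hex.
have Hup : `|up| <= e / (M + 1) * `|dl| by exact: Hep.
set e' := e / (M + 1) in e'0 h7 Hux Hup *.
have -> : pairing up v + dl * pairing f v - (pairing f ux + dl * pairing f v) =
   pairing up v - pairing f ux by ring.
move=> HH.
have b1 := le_pairing up v; have b2 := le_pairing f ux.
have c1 : n%:R * `|up| * `|v| <= n%:R * `|v| * (e' * `|dl|).
  by rewrite mulrAC ler_wpM2l// mulr_ge0.
have c2 : n%:R * `|f| * `|ux| <= n%:R * `|f| * (e' * `|dl|).
  by rewrite ler_wpM2l// mulr_ge0.
have c3 : K * t ^+ 2 <= K * X ^+ 2 * (e' * `|dl|).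
  rewrite /t exprMn -mulrA; apply: ler_wpM2l => //.
  apply: ler_wpM2l; first by rewrite exprn_ge0// ltW.
  by rewrite expr2; apply: ler_wpM2r => //; exact: ltW.
have eE : e' * (M + 1) = e by rewrite /e' divfK// gt_eqF// ltr_wpDl.
have -> : E = (E - (pairing up v - pairing f ux)) + (pairing up v - pairing f ux).
  by rewrite subrK.
apply: le_trans (ler_normD _ _) _.
have := ler_normB (pairing up v) (pairing f ux).
have ed0 : 0 <= e' * `|dl| by rewrite mulr_ge0// ltW.
have : e * `|dl| = M * (e' * `|dl|) + e' * `|dl| by rewrite -eE; ring.
rewrite /M !mulrDl; lra.
Qed.

Variable x0 : 'rV[R]_n.
Hypothesis Ax0 : A x0.

(* With [S (z) = 2 h tau + <p, y> + Q |y|^2 / 2], [y = z - x (tau)], where [tau] is the function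
   of [z] with [<p0, z> = <p0, x (tau)>] and [Q' = - 2 K], the differential of [S] is
   [p + calibration_shift]. *)
Definition calibration_shift (x : 'rV[R]_n) (p p0 : 'cV[R]_n) (K Q : R) (y : 'rV[R]_n) :
    'cV[R]_n :=
  Q *: y^T + ((pairing (ham_force Y x p) y - K * \sum_k y 0 k ^+ 2
    - Q * \sum_k y 0 k * ham_velocity Y x p 0 k) / pairing p0 (ham_velocity Y x p)) *: p0.

(** The left-hand side is the linear part of [ham_expansion]. The coefficient of [p0] in the shift,
    divided by [<p0, dH/dl>], cancels both the force and the contribution of [Q]. *)
Lemma pairing_calibration_shift x p p0 K Q y :
  pairing p0 (ham_velocity Y x p) != 0 ->
  pairing (calibration_shift x p p0 K Q y) (ham_velocity Y x p) -
    pairing (ham_force Y x p) y = - K * \sum_k y 0 k ^+ 2.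
Proof.
move=> u0; rewrite /calibration_shift pairingDl !pairingZl divfK//.
have -> : pairing y^T (ham_velocity Y x p) = \sum_k y 0 k * ham_velocity Y x p 0 k.
  by rewrite pairingE; apply: eq_bigr => k _; rewrite mxE mulrC.
ring.
Qed.

(** The conditions [K * |y| <= 1] and [|Q| <= 1] keep the shift below [L * |y|] for an [L] fixed
    before [K]; the linear part of [ham_expansion] then outweighs its remainder. *)
Lemma ham_calibration : exists2 rho, 0 < rho & (forall x, `|x - x0| < rho -> A x) /\
  forall P m, 0 <= P -> 0 < m -> exists K L B, [/\ 0 <= K, 0 <= L,
    forall x p, `|x - x0| < rho -> `|p| <= P ->
      `|ham_velocity Y x p| <= B /\ `|ham_force Y x p| <= B &
    forall x z p p0 Q, `|x - x0| < rho -> `|z - x0| < rho -> `|z - x| <= 1 ->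
      K * `|z - x| <= 1 -> `|Q| <= 1 -> `|p| <= P -> `|p0| <= P ->
      pairing p0 (ham_velocity Y x p) <= - m ->
      let d := calibration_shift x p p0 K Q (z - x) in
      `|d| <= L * `|z - x| /\ ham Y z (p + d) <= ham Y x p - `|z - x| ^+ 2].
Proof.
have [rho [C [rho0 C0 HA HC HE]]] := ham_expansion oA Ax0 SY.
exists rho => //; split => // P m P0 m0.
pose N : R := n%:R; have N0 : 0 <= N by [].
pose b := N * P * C; have b0 : 0 <= b by rewrite !mulr_ge0.
pose V : R := r%:R * (b * C); have V0 : 0 <= V by rewrite !mulr_ge0.
pose F : R := r%:R * (b * b); have F0 : 0 <= F by rewrite !mulr_ge0.
(* The summand 1 bounds [Q *: y^T]. In the coefficient of [p0] the three summands bound the force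
   term, the quadratic term after use of [K * |y| <= 1], and the term with [Q]; [m] bounds the
   denominator from below. *)
pose L := 1 + (N * F + N + N * V) / m * P.
have L0 : 0 <= L by rewrite addr_ge0// !mulr_ge0 ?addr_ge0 ?mulr_ge0// invr_ge0 ltW.
have [K K0 HK] := HE P L P0 L0.
have hfs (i : 'I_r) (u : R) : `|frame_sign R i * u| = `|u|.
  by rewrite /frame_sign; case: ifP => _; rewrite ?mulN1r ?mul1r ?normrN.
have sumE (m' : nat) (u : R) : \sum_(i < m') u = m'%:R * u.
  by rewrite sumr_const card_ord -[LHS]mulr_natr mulrC.
have VF x p : `|x - x0| < rho -> `|p| <= P ->
    `|ham_velocity Y x p| <= V /\ `|ham_force Y x p| <= F.
  move=> xr pP.
  have hb i : `|pairing p (Y i x)| <= b.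
    apply: le_trans (le_pairing _ _) _; have [H _] := HC x i xr.
    by apply: ler_pM; rewrite ?mulr_ge0 ?ler_wpM2l.
  split.
    apply: le_trans (ler_norm_sum _ _ _) _; rewrite /V -sumE; apply: ler_sum => i _.
    by rewrite normrZ hfs; apply: ler_pM => //; have [] := HC x i xr.
  rewrite /ham_force normrN; apply: mx_norm_le => // j k; rewrite mxE.
  apply: le_trans (ler_norm_sum _ _ _) _; rewrite /F -sumE; apply: ler_sum => i _.
  rewrite -mulrA hfs normrM; apply: ler_pM => //.
  apply: le_trans (le_pairing _ _) _; have [_ /(_ j) H] := HC x i xr.
  by apply: ler_pM; rewrite ?mulr_ge0 ?ler_wpM2l.
(* The part [K] absorbs the remainder and the additional 1 leaves [- |y| ^+ 2]; the sum of squares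
   in the shift dominates the square of the sup norm. *)
exists (K + 1), L, (V + F); split => //; first by rewrite addr_ge0.
  move=> x p xr pP; have [v_ f_] := VF x p xr pP; split.
    by apply: le_trans v_ _; rewrite lerDl.
  by apply: le_trans f_ _; rewrite lerDr.
move=> x z p p0 Q xr zr y1 Ky Q1 pP p0P um d.
have [vV fF] := VF x p xr pP.
set y := z - x in y1 Ky d *; pose t := `|y|.
have t0 : 0 <= t by exact: normr_ge0.
set v := ham_velocity Y x p in um vV; set f := ham_force Y x p in fF.
set u := pairing p0 v in um; have u0 : u < 0 by lra.
have un0 : u != 0 by rewrite lt_eqF.
have yk k : `|y 0 k| <= t by exact: le_mx_norm.
set q := \sum_k y 0 k ^+ 2; set g := \sum_k y 0 k * v 0 k.
have q0 : 0 <= q by apply: sumr_ge0 => k _; exact: sqr_ge0.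
have qN : q <= N * (t * t).
  rewrite /q /N -sumE; apply: ler_sum => k _.
  by rewrite -[leLHS]real_normK ?num_real// expr2; exact: ler_pM.
have tq : t ^+ 2 <= q.
  have [/mx_norm_eq0 y0|/mx_norm_neq0 [[i k] /= E]] := eqVneq (mx_norm y) 0.
    by rewrite /t y0 normr0 expr0n.
  rewrite /t [`|y|]E ord1 real_normK ?num_real// /q (bigD1 k)//= lerDl.
  by apply: sumr_ge0 => l _; exact: sqr_ge0.
have gN : `|g| <= N * (t * V).
  apply: le_trans (ler_norm_sum _ _ _) _; rewrite /N -sumE; apply: ler_sum => k _.
  rewrite normrM; apply: ler_pM => //.
  by apply: le_trans vV; exact: le_mx_norm.
have dE : d = Q *: y^T + ((pairing f y - (K + 1) * q - Q * g) / u) *: p0 by [].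
have dL : `|d| <= L * t.
  rewrite dE; apply: le_trans (ler_normD _ _) _; rewrite !normrZ.
  have h1 : `|Q| * `|y^T| <= t.
    have yT : `|y^T| <= t by apply: mx_norm_le => // i j; rewrite mxE ord1.
    by rewrite -[leRHS]mul1r; apply: ler_pM.
  have h2 : `|pairing f y - (K + 1) * q - Q * g| <= (N * F + N + N * V) * t.
    apply: le_trans (ler_normB _ _) _; rewrite [leRHS]mulrDl lerD//; last first.
      rewrite normrM; apply: (@le_trans _ _ (1 * (N * (t * V)))); first exact: ler_pM.
      by rewrite mul1r le_eqVlt; apply/orP; left; apply/eqP; ring.
    apply: le_trans (ler_normB _ _) _; rewrite [leRHS]mulrDl lerD//.
      by apply: le_trans (le_pairing _ _) _; rewrite ler_wpM2r// ler_wpM2l.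
    rewrite ger0_norm; last by rewrite mulr_ge0// addr_ge0.
    apply: (@le_trans _ _ ((K + 1) * (N * (t * t)))).
      by rewrite ler_wpM2l// addr_ge0.
    have -> : (K + 1) * (N * (t * t)) = (K + 1) * t * (N * t) by ring.
    by rewrite -[leRHS]mul1r ler_wpM2r// mulr_ge0.
  rewrite /L [leRHS]mulrDl mul1r; apply: lerD => //; rewrite normfV.
  have mu : m <= `|u| by rewrite ltr0_norm//; lra.
  have -> : (N * F + N + N * V) / m * P * t = (N * F + N + N * V) * t * (m^-1 * P) by ring.
  rewrite -mulrA; apply: ler_pM; rewrite ?mulr_ge0 ?invr_ge0//.
  apply: ler_pM; rewrite ?invr_ge0//.
  by rewrite lef_pV2// posrE//; lra.
split => //.
have := HK x z p d t xr zr (lexx _) y1 pP dL.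
rewrite (pairing_calibration_shift (K + 1) Q (z - x) un0) -/y -/q.
move=> /ler_normlW; rewrite -/t.
have : K * t ^+ 2 <= K * q by rewrite ler_wpM2l.
lra.
Qed.

End Calibration.

Section TimeCone.
Variables (R : realType) (n r : nat).

(* [w] is the Lorentzian length of the future directed causal vector [v]; [X] gives the time
   orientation and [Y] an orthonormal frame, all at one point. *)
Definition causal_vector (Y : 'I_r -> 'rV[R]_n) (X v : 'rV[R]_n) (w : R) : Prop :=
  exists a c : 'I_r -> R,
    [/\ v = \sum_i a i *: Y i /\ X = \sum_i c i *: Y i,
        lorentz_form c c < 0, lorentz_form a a <= 0, lorentz_form a c < 0 &
        w = Num.sqrt (- lorentz_form a a)].

(** Reversed Cauchy-Schwarz between [v] and the metric dual [b] of [l]: the square of [b] is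
    [2 H(l) < 0], and [b] is future directed because [l] is negative on [X]. *)
Lemma causal_vector_pairing (Y : 'I_r -> 'rV[R]_n) (X v : 'rV[R]_n) (w : R) (l : 'cV[R]_n) :
  causal_vector Y X v w -> frame_hamiltonian Y l < 0 -> pairing l X < 0 ->
  pairing l v < 0 /\ Num.sqrt (- (2 * frame_hamiltonian Y l)) * w <= - pairing l v.
Proof.
move=> [a [c [[-> ->] cc aa ac ->]]] hl hX.
pose b i := frame_sign R i * pairing l (Y i).
have pE d : pairing l (\sum_i d i *: Y i) = lorentz_form d b.
  rewrite pairing_sum; apply: eq_bigr => i _; rewrite pairingZ /b.
  by rewrite mulrCA !mulrA frame_sign_sqr mul1r mulrC.
have bb : lorentz_form b b = 2 * frame_hamiltonian Y l.
  rewrite /frame_hamiltonian mulrA divff ?mul1r ?pnatr_eq0//.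
  apply: eq_bigr => i _; rewrite /b.
  rewrite (_ : _ * _ * _ = frame_sign R i * frame_sign R i * frame_sign R i * pairing l (Y i) ^+ 2).
    by rewrite frame_sign_sqr mul1r.
  by ring.
rewrite !pE -bb; apply: (reversed_cauchy_schwarz cc aa).
- by rewrite bb; lra.
- exact: ac.
- by rewrite lorentz_formC -pE.
Qed.

End TimeCone.

Section PhaseNeighborhood.
Variables (R : realType) (n r : nat) (Y : 'I_r -> 'rV[R]_n -> 'rV[R]_n).
Variables (T : 'rV[R]_n -> 'rV[R]_n) (x0 : 'rV[R]_n) (p0 : 'cV[R]_n).
Hypotheses (cY : forall i, {for x0, continuous (Y i)}) (cT : {for x0, continuous T}).

Let cpair (G : 'rV[R]_n -> 'rV[R]_n) : {for x0, continuous G} ->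
  {for (x0, p0), continuous (fun w : 'rV[R]_n * 'cV[R]_n => pairing w.2 (G w.1))}.
Proof.
move=> cG.
have -> : (fun w : 'rV[R]_n * 'cV[R]_n => pairing w.2 (G w.1)) =
    (fun w : 'rV[R]_n * 'cV[R]_n => \sum_k G w.1 0 k * w.2 k 0).
  by apply/funext => w; rewrite pairingE.
apply: continuous_sum => k.
apply: (@continuousM _ _ (fun w : 'rV[R]_n * 'cV[R]_n => G w.1 0 k) (fun w => w.2 k 0)).
  apply: (@continuous_comp _ _ _ fst (fun z => G z 0 k)); first exact: cvg_fst.
  exact: continuous_mx_coord.
apply: (@continuous_comp _ _ _ snd (fun l : 'cV[R]_n => l k 0)); first exact: cvg_snd.
exact: coord_continuous.
Qed.

Let cpair0 (G : 'rV[R]_n -> 'rV[R]_n) : {for x0, continuous G} ->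
  {for (x0, p0), continuous (fun w : 'rV[R]_n * 'cV[R]_n => pairing p0 (G w.1))}.
Proof.
move=> cG.
have -> : (fun w : 'rV[R]_n * 'cV[R]_n => pairing p0 (G w.1)) =
    (fun w : 'rV[R]_n * 'cV[R]_n => \sum_k G w.1 0 k * p0 k 0).
  by apply/funext => w; rewrite pairingE.
apply: continuous_sum => k.
apply: (@continuousM _ _ (fun w : 'rV[R]_n * 'cV[R]_n => G w.1 0 k) (fun w => p0 k 0)).
  apply: (@continuous_comp _ _ _ fst (fun z => G z 0 k)); first exact: cvg_fst.
  exact: continuous_mx_coord.
exact: cst_continuous.
Qed.

(** Three strict inequalities that hold at [(x0, p0)] and are open. The last one holds there because
    [<p0, dH/dl> = 2 h < h]. *)
Lemma phase_neighborhood : ham Y x0 p0 < 0 -> pairing p0 (T x0) < 0 ->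
  exists2 d, 0 < d & forall z l, `|z - x0| < d -> `|l - p0| < d ->
    [/\ ham Y z l < 0, pairing l (T z) < 0 &
        pairing p0 (ham_velocity Y z l) < ham Y x0 p0].
Proof.
move=> h0 pT.
pose f1 (w : 'rV[R]_n * 'cV[R]_n) := ham Y w.1 w.2.
pose f2 (w : 'rV[R]_n * 'cV[R]_n) := pairing w.2 (T w.1).
pose f3 (w : 'rV[R]_n * 'cV[R]_n) := pairing p0 (ham_velocity Y w.1 w.2).
have c1 : {for (x0, p0), continuous f1}.
  rewrite /f1 /ham /frame_hamiltonian.
  apply: (@continuousM _ _ (cst 2^-1)); first exact: cst_continuous.
  apply: continuous_sum => i.
  apply: (@continuousM _ _ (cst (frame_sign R i))); first exact: cst_continuous.
  by apply: (@continuousM _ _ (fun w : 'rV[R]_n * 'cV[R]_n => pairing w.2 (Y i w.1)));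
    exact: cpair.
have c3 : {for (x0, p0), continuous f3}.
  have -> : f3 = (fun w => \sum_i frame_sign R i * pairing w.2 (Y i w.1) * pairing p0 (Y i w.1)).
    by apply/funext => w; rewrite /f3 pairing_ham_velocity_sum.
  apply: continuous_sum => i.
  apply: (@continuousM _ _ (fun w : 'rV[R]_n * 'cV[R]_n => frame_sign R i * pairing w.2 (Y i w.1))).
    apply: (@continuousM _ _ (cst (frame_sign R i))); first exact: cst_continuous.
    exact: cpair.
  exact: cpair0.
have near_lt (f : 'rV[R]_n * 'cV[R]_n -> R) c : {for (x0, p0), continuous f} ->
    f (x0, p0) < c -> exists2 d, 0 < d &
      forall z l, `|z - x0| < d -> `|l - p0| < d -> f (z, l) < c.
  move=> cf fc; have e0 : 0 < c - f (x0, p0) by rewrite subr_gt0.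
  move: cf => /cvgrPdist_lt /(_ _ e0) /nbhs_ballP[d /= d0 Hd].
  exists d => // z l zd ld.
  have /Hd /= : ball (x0, p0) d (z, l).
    by split => /=; rewrite -ball_normE /= distrC.
  by rewrite ltr_norml; lra.
have [d1 d10 H1] := near_lt f1 0 c1 h0.
have [d2 d20 H2] := near_lt f2 0 (cpair cT) pT.
have [|d3 d30 H3] := near_lt f3 (ham Y x0 p0) c3.
  by rewrite /f3 pairing_ham_velocity; lra.
exists (Num.min d1 (Num.min d2 d3)); first by rewrite !lt_min d10 d20.
move=> z l; rewrite !lt_min => /andP[z1 /andP[z2 z3]] /andP[l1 /andP[l2 l3]].
by split; [exact: H1|exact: H2|exact: H3].
Qed.

End PhaseNeighborhood.

(** * Choice of the constants and of the neighbourhood *)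

Section LocalData.
Variables (R : realType) (n r : nat) (Y : 'I_r -> 'rV[R]_n -> 'rV[R]_n).
Variables (A : set 'rV[R]_n) (T : 'rV[R]_n -> 'rV[R]_n).
Variables (a b t0 : R) (x : R -> 'rV[R]_n) (p : R -> 'cV[R]_n).

Local Notation x0 := (x t0).
Local Notation p0 := (p t0).
Local Notation h := (ham Y x0 p0).

Definition hamilton_at (s : R) : Prop :=
  has_derivative_within [set` `[a, b]] x s (ham_velocity Y (x s) (p s)) /\
  has_derivative_within [set` `[a, b]] p s (ham_force Y (x s) (p s)).

(** The differential of [S] at [z] when [tau (z) = s], with [Q (s) = - 2 K (s - t0)]. *)
Definition calibrating_covector (K s : R) (z : 'rV[R]_n) : 'cV[R]_n :=
  p s + calibration_shift Y (x s) (p s) p0 K (- (2 * K * (s - t0))) (z - x s).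

(** All that the comparison with competitors uses. The second clause makes [<p0, z>] a time function
    on the ball, the third describes the extremal, the fourth is the strict subsolution. By the last
    one the extremal is outside the ball when [|s - t0| = eps]. *)
Definition calibrated (rho eps K m B : R) : Prop :=
  [/\ [/\ 0 < rho, 0 < eps & 0 < m],
      forall z, `|z - x0| < rho -> [/\ A z, ham Y z p0 < 0 & pairing p0 (T z) < 0],
      forall s, a <= s <= b -> `|s - t0| <= eps ->
        [/\ hamilton_at s, ham Y (x s) (p s) = h,
            pairing p0 (ham_velocity Y (x s) (p s)) <= - m,
            `|ham_velocity Y (x s) (p s)| <= B /\ `|ham_force Y (x s) (p s)| <= B &
            `|p s| <= B /\ `|x s - x0| <= 1],
      forall s z, a <= s <= b -> `|s - t0| <= eps -> `|z - x0| < rho ->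
        ham Y z (calibrating_covector K s z) <= h - `|z - x s| ^+ 2 /\
        pairing (calibrating_covector K s z) (T z) < 0 &
      forall s, a <= s <= b -> `|s - t0| = eps -> rho <= `|x s - x0|].

Hypotheses (oA : open A) (Ax0 : A x0) (SY : forall i, smooth_on A (Y i)).
Hypotheses (cT : {for x0, continuous T}) (h0 : h < 0) (pT : pairing p0 (T x0) < 0).
Hypotheses (t0ab : a <= t0 <= b).
Variable e0 : R.
Hypothesis e00 : 0 < e0.
Hypothesis hamilton : forall s, a <= s <= b -> `|s - t0| < e0 -> hamilton_at s.

Lemma ham_conserved_near eps :
  (forall s, a <= s <= b -> `|s - t0| <= eps -> A (x s) /\ hamilton_at s) ->
  forall s, a <= s <= b -> `|s - t0| <= eps -> ham Y (x s) (p s) = h.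
Proof.
move=> HA s /andP[as_ sb]; rewrite ler_norml => /andP[se1 se2].
have [at0 t0b] := andP t0ab.
have HAs u : a <= u -> u <= b -> - eps <= u - t0 -> u - t0 <= eps -> [/\ A (x u),
     has_derivative_within [set` `[a, b]] x u (ham_velocity Y (x u) (p u)) &
     has_derivative_within [set` `[a, b]] p u (ham_force Y (x u) (p u))].
  move=> au ub ue1 ue2; have [||? []] := HA u => //; first by rewrite au.
  by rewrite ler_norml ue1.
clear HA.
have [st|/ltW ts] := leP t0 s.
- apply: (ham_conserved oA SY at0 st sb) => u /andP[u1 u2].
  by apply: HAs; lra.
- apply/esym; apply: (ham_conserved oA SY as_ ts t0b) => u /andP[u1 u2].
  by apply: HAs; lra.
Qed.

Lemma has_derivative_within_pairing (l : 'cV[R]_n) c v :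
  has_derivative_within [set` `[a, b]] x c v ->
  has_derivative_within [set` `[a, b]] ((fun c => pairing l (x c)) : R -> R^o) c (pairing l v).
Proof.
move=> Dc; pose N : R := n%:R * `|l|.
have N0 : 0 <= N by rewrite mulr_ge0.
have N1 : 0 < N + 1 by rewrite ltr_wpDl.
apply: has_derivative_within_of_eps => e e_gt0.
have e'0 : 0 < e / (N + 1) by rewrite divr_gt0.
have [dl dl0 Hdl] := has_derivative_within_eps Dc e'0.
exists dl => // c' c'ab c'd; have := Hdl c' c'ab c'd.
have -> : pairing l (x c') - pairing l (x c) - (c' - c) *: pairing l v
    = pairing l (x c' - x c - (c' - c) *: v).
  by rewrite !pairingDr !pairingNr pairingZ.
move=> Hv; apply: le_trans (le_pairing _ _) _; rewrite -/N.
apply: (@le_trans _ _ ((N + 1) * (e / (N + 1) * `|c' - c|))).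
  by apply: ler_pM => //; rewrite lerDl.
by rewrite mulrA mulrCA divff ?mulr1// gt_eqF.
Qed.

(** This lower bound on the fall of [<p0, x>] makes the time [tau] unique and Lipschitz, and forces
    the extremal out of small balls. *)
Lemma velocity_gap s s' m : a <= s -> s <= s' -> s' <= b ->
  (forall c, s <= c <= s' -> hamilton_at c /\
     pairing p0 (ham_velocity Y (x c) (p c)) <= - m) ->
  m * (s' - s) <= pairing p0 (x s) - pairing p0 (x s').
Proof.
move=> as_ ss' s'b H.
have [|c cI E] := @mean_value_within R a b (fun c => pairing p0 (x c))
   (fun c => pairing p0 (ham_velocity Y (x c) (p c))) s s' as_ ss' s'b.
  by move=> c cI; apply: has_derivative_within_pairing; have [[]] := H c cI.
have [_ cv] := H c cI.
move: E => /= E; rewrite -[leRHS]opprB E -mulNr ler_wpM2r ?subr_ge0//.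
by rewrite lerNr.
Qed.

Lemma calibrated_exists : exists rho eps K m B, calibrated rho eps K m B.
Proof.
have cY i : {for x0, continuous (Y i)} by exact: (SY i 0%N x0 Ax0).
have [d d0 Hd] := phase_neighborhood cY cT h0 pT.
have [rho1 rho10 [HA HC]] := ham_calibration oA SY Ax0.
pose P := `|p0| + 1; pose m := - h.
have P0 : 0 <= P by rewrite addr_ge0.
have m0 : 0 < m by rewrite oppr_gt0.
have [K [L [B [K0 L0 HB HK]]]] := HC P m P0 m0.
have K10 : 0 < (2 * (K + 1))^-1 by rewrite invr_gt0 mulr_gt0// ltr_wpDl.
have L10 : 0 < d / (4 * (L + 1)) by rewrite divr_gt0// mulr_gt0// ltr_wpDl.
(* Two points within [eta] of [x0] differ by less than [2 * eta]. The bounds give in turn the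
   validity of [ham_calibration], [|y| <= 1], [K * |y| <= 1], a shift of size at most [d / 2], and
   points within [d] of [x0]. *)
pose eta := Num.min (Num.min rho1 2^-1)
  (Num.min (2 * (K + 1))^-1 (Num.min (d / (4 * (L + 1))) (d / 2))).
have eta0 : 0 < eta by rewrite !lt_min rho10 K10 L10 invr_gt0 ltr0n divr_gt0.
have eta_rho : eta <= rho1 by rewrite !ge_min lexx.
have eta_half : eta <= 2^-1 by rewrite !ge_min lexx !orbT.
have eta_K : eta <= (2 * (K + 1))^-1 by rewrite !ge_min lexx !orbT.
have eta_L : eta <= d / (4 * (L + 1)) by rewrite !ge_min lexx !orbT.
have eta_d : eta <= d / 2 by rewrite !ge_min lexx !orbT.
have [Dx0 Dp0] : hamilton_at t0 by apply: hamilton; rewrite // subrr normr0.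
have [ex ex0 Hex] := has_derivative_within_near Dx0 eta0.
have dp0 : 0 < Num.min (d / 2) 1 by rewrite lt_min ltr01 divr_gt0.
have [ep ep0 Hep] := has_derivative_within_near Dp0 dp0.
(* The bound with [K] yields [|Q| <= 1]; halving makes the inequalities strict, so that they hold on
   the closed interval of radius [eps]. *)
pose eps := Num.min (Num.min e0 (2 * (K + 1))^-1) (Num.min ex ep) / 2.
have eps0 : 0 < eps by rewrite divr_gt0// !lt_min e00 K10 ex0.
have eps2 : eps * 2 = Num.min (Num.min e0 (2 * (K + 1))^-1) (Num.min ex ep).
  by rewrite /eps divfK// pnatr_eq0.
have eps_lt u : Num.min (Num.min e0 (2 * (K + 1))^-1) (Num.min ex ep) <= u -> eps < u.
  by rewrite -eps2; apply: lt_le_trans; rewrite ltr_pMr// ltr1n.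
have eps_e0 : eps < e0 by apply: eps_lt; rewrite !ge_min lexx.
have eps_K : eps < (2 * (K + 1))^-1 by apply: eps_lt; rewrite !ge_min lexx !orbT.
have eps_x : eps < ex by apply: eps_lt; rewrite !ge_min lexx !orbT.
have eps_p : eps < ep by apply: eps_lt; rewrite !ge_min lexx !orbT.
have eta_ltd : eta < d by apply: le_lt_trans eta_d _; rewrite gtr_pMr// invf_lt1// ltr1n.
have eta2 : 2 * eta <= 1 by rewrite mulrC -ler_pdivlMr// div1r.
clearbody eps eta.
have near_x s : a <= s <= b -> `|s - t0| <= eps -> `|x s - x0| < eta.
  by move=> sab se; apply: Hex => //; exact: le_lt_trans eps_x.
have near_p s : a <= s <= b -> `|s - t0| <= eps -> `|p s - p0| < d / 2 /\ `|p s - p0| < 1.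
  move=> sab se; have := Hep s; rewrite lt_min => H.
  by apply/andP; apply: H => //; exact: le_lt_trans eps_p.
have Ham s : a <= s <= b -> `|s - t0| <= eps -> hamilton_at s.
  by move=> sab se; apply: hamilton => //; exact: le_lt_trans eps_e0.
have normP s : a <= s <= b -> `|s - t0| <= eps -> `|p s| <= P.
  move=> sab se; have [_ H] := near_p s sab se.
  have -> : p s = p0 + (p s - p0) by rewrite addrC subrK.
  by apply: le_trans (ler_normD _ _) _; rewrite /P lerD2l ltW.
have vel s : a <= s <= b -> `|s - t0| <= eps ->
    pairing p0 (ham_velocity Y (x s) (p s)) <= - m.
  move=> sab se; have [||_ _ H] := Hd (x s) (p s).
  - by apply: lt_trans (near_x s sab se) _.
  - have [pd _] := near_p s sab se; apply: lt_trans pd _.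
    by rewrite gtr_pMr// invf_lt1// ltr1n.
  by rewrite opprK ltW.
have HAeps u : a <= u <= b -> `|u - t0| <= eps -> A (x u) /\ hamilton_at u.
  move=> uab ue; split; last exact: Ham.
  by apply: HA; apply: lt_le_trans (near_x u uab ue) _.
have cons := ham_conserved_near HAeps.
pose N : R := n%:R * `|p0|.
have N0 : 0 <= N by rewrite mulr_ge0.
(* During a time [eps] the pairing with [p0] falls by at least [m * eps], while inside the ball of
   radius [rho] it differs from its value at the centre by less than that. *)
pose rho := Num.min eta (m * eps / (N + 1)).
have N1 : 0 < N + 1 by rewrite ltr_wpDl.
have rho_eta : rho <= eta by rewrite ge_min lexx.
exists rho, eps, K, m, (P + B); split.
- by split => //; rewrite lt_min eta0 divr_gt0// mulr_gt0.
- move=> z zr; have zeta : `|z - x0| < eta by exact: lt_le_trans rho_eta.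
  have [||? ? _] := Hd z p0; first exact: lt_trans zeta _.
    by rewrite subrr normr0.
  by split => //; apply: HA; exact: lt_le_trans eta_rho.
- move=> s sab se.
  have xr : `|x s - x0| < rho1 by apply: lt_le_trans (near_x s sab se) _.
  have [Bv Bf] := HB (x s) (p s) xr (normP s sab se).
  have Bge0 : 0 <= B by exact: le_trans Bv.
  split; [exact: Ham|exact: cons|exact: vel| |].
  + by split; [apply: le_trans Bv _|apply: le_trans Bf _]; rewrite lerDr.
  + split; first by apply: le_trans (normP s sab se) _; rewrite lerDl.
    apply: ltW; apply: lt_le_trans (near_x s sab se) (le_trans eta_half _).
    by rewrite invf_le1// ler1n.
- move=> s z sab se zr.
  have zeta : `|z - x0| < eta by exact: lt_le_trans rho_eta.
  have xeta := near_x s sab se.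
  have yeta : `|z - x s| < 2 * eta.
    have -> : z - x s = (z - x0) - (x s - x0) by rewrite opprB addrA subrK.
    by apply: le_lt_trans (ler_normB _ _) _; rewrite mulr_natl mulr2n ltrD.
  have y0 : 0 <= `|z - x s| by [].
  have y1 : `|z - x s| <= 1 by apply: le_trans (ltW yeta) eta2.
  have K1p : 0 < K + 1 by rewrite ltr_wpDl.
  have KK : (2 * (K + 1))^-1 * (2 * (K + 1)) = 1.
    by rewrite mulVf// mulf_neq0// ?pnatr_eq0// gt_eqF.
  have Ky : K * `|z - x s| <= 1.
    have h1 : K * `|z - x s| <= (K + 1) * (2 * eta).
      by apply: ler_pM => //; rewrite ?lerDl// ltW.
    have h2 : (K + 1) * (2 * eta) <= (K + 1) * (2 * (2 * (K + 1))^-1).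
      by rewrite ler_wpM2l ?ler_wpM2l// ltW.
    apply: le_trans h1 (le_trans h2 _); rewrite -[leRHS]KK le_eqVlt; apply/orP; left; apply/eqP.
    by ring.
  have Q1 : `|- (2 * K * (s - t0))| <= 1.
    rewrite normrN normrM ger0_norm ?mulr_ge0//.
    apply: (@le_trans _ _ (2 * (K + 1) * (2 * (K + 1))^-1)).
      apply: ler_pM; rewrite ?mulr_ge0//; first by rewrite ler_wpM2l// lerDl.
      by apply: le_trans se _; exact: ltW.
    by rewrite mulrC KK.
  have xr : `|x s - x0| < rho1 by exact: lt_le_trans eta_rho.
  have zr1 : `|z - x0| < rho1 by exact: lt_le_trans eta_rho.
  have p0P : `|p0| <= P by rewrite lerDl.
  have [HL HH] := HK (x s) z (p s) p0 _ xr zr1 y1 Ky Q1 (normP s sab se) p0P (vel s sab se).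
  split; first by rewrite -(cons s sab se).
  have zd : `|z - x0| < d by exact: lt_trans zeta _.
  suff ld : `|calibrating_covector K s z - p0| < d by have [] := Hd z _ zd ld.
  rewrite /calibrating_covector addrAC.
  apply: le_lt_trans (ler_normD _ _) _.
  have [pd _] := near_p s sab se.
  suff Ld : L * `|z - x s| <= d / 2.
    by rewrite [ltRHS]splitr; apply: ltr_leD => //; exact: le_trans Ld.
  have L1p : 0 < L + 1 by rewrite ltr_wpDl.
  apply: (@le_trans _ _ ((L + 1) * (2 * (d / (4 * (L + 1)))))).
    apply: ler_pM => //; first by rewrite lerDl.
    by apply: le_trans (ltW yeta) _; rewrite ler_wpM2l.
  have -> : (L + 1) * (2 * (d / (4 * (L + 1)))) = d / 2 by field; rewrite gt_eqF.
  exact: lexx.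
- move=> s sab se; rewrite leNgt; apply/negP => xr.
  have xr' : `|x s - x0| < m * eps / (N + 1) by apply: lt_le_trans xr _; rewrite ge_min lexx orbT.
  have gap : m * eps <= `|pairing p0 (x s) - pairing p0 x0|.
    have Hc c : a <= c -> c <= b -> - eps <= c - t0 -> c - t0 <= eps -> hamilton_at c /\
        pairing p0 (ham_velocity Y (x c) (p c)) <= - m.
      move=> ac cb c1 c2; have cab : a <= c <= b by rewrite ac.
      have ce : `|c - t0| <= eps by rewrite ler_norml c1.
      by split; [exact: Ham|exact: vel].
    have [as_ sb] := andP sab; have [at0 t0b] := andP t0ab.
    have e0' := ltW eps0.
    have [st|/ltW ts] := leP t0 s.
    - have st0 : s - t0 = eps by rewrite -se ger0_norm// subr_ge0.
      rewrite distrC; apply: le_trans (ler_norm _); rewrite -st0.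
      apply: (velocity_gap at0 st sb) => c /andP[c1 c2].
      apply: Hc; [exact: le_trans at0 c1|exact: le_trans c2 sb| |].
        by apply: le_trans (_ : 0 <= _); rewrite ?oppr_le0 ?subr_ge0.
      by rewrite -st0 lerD2r.
    - have st0 : t0 - s = eps by rewrite -se distrC ger0_norm// subr_ge0.
      apply: le_trans (ler_norm _); rewrite -st0.
      apply: (velocity_gap as_ ts t0b) => c /andP[c1 c2].
      apply: Hc; [exact: le_trans as_ c1|exact: le_trans c2 t0b| |].
        by rewrite -st0 opprB lerD2r.
      by apply: le_trans (_ : 0 <= _); rewrite ?subr_le0.
  have : `|pairing p0 (x s) - pairing p0 x0| <= N * `|x s - x0|.
    have -> : pairing p0 (x s) - pairing p0 x0 = pairing p0 (x s - x0).
      by rewrite pairingDr pairingNr.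
    exact: le_pairing.
  move: xr'; rewrite ltr_pdivlMr// => xr' uN.
  have := lt_le_trans xr' (le_trans gap uN).
  by rewrite mulrDr mulr1 mulrC -ltrBrDl subrr ltNge normr_ge0.
Qed.

End LocalData.

(** * The calibrating function along a competitor *)

Section LipschitzAlong.
Variables (R : realType) (n : nat) (alpha beta : R) (z : R -> 'rV[R]_n).
Implicit Types f g : R -> R.

(* Oscillation controlled by that of [z]: unlike absolute continuity, this is closed under
   products at no cost, and it transfers the absolute continuity of [z]. *)
Definition lip_along f : Prop := exists L B, [/\ 0 <= L, 0 <= B &
  forall s t, alpha <= s <= beta -> alpha <= t <= beta ->
    `|f t - f s| <= L * `|z t - z s| /\ `|f s| <= B].

Lemma lip_along_cst c : lip_along (cst c).
Proof.
exists 0, `|c|; split => // s t _ _.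
by rewrite subrr normr0 mul0r.
Qed.

Lemma lip_along_add f g : lip_along f -> lip_along g -> lip_along (fun s => f s + g s).
Proof.
move=> [L [B [L0 B0 H]]] [L' [B' [L'0 B'0 H']]].
exists (L + L'), (B + B'); split; [exact: addr_ge0|exact: addr_ge0|].
move=> s t sI tI; have [h1 h2] := H s t sI tI; have [h3 h4] := H' s t sI tI.
split; last by apply: le_trans (ler_normD _ _) _; exact: lerD.
have -> : f t + g t - (f s + g s) = (f t - f s) + (g t - g s) by ring.
by apply: le_trans (ler_normD _ _) _; rewrite [leRHS]mulrDl; exact: lerD.
Qed.

Lemma lip_along_mul f g : lip_along f -> lip_along g -> lip_along (fun s => f s * g s).
Proof.
move=> [L [B [L0 B0 H]]] [L' [B' [L'0 B'0 H']]].
exists (L * B' + B * L'), (B * B').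
split; [by rewrite addr_ge0// mulr_ge0|exact: mulr_ge0|].
move=> s t sI tI; have [h1 h2] := H s t sI tI; have [h3 h4] := H' s t sI tI.
have [_ h5] := H' t s tI sI.
split; last by rewrite normrM; exact: ler_pM.
have -> : f t * g t - f s * g s = (f t - f s) * g t + f s * (g t - g s) by ring.
apply: le_trans (ler_normD _ _) _; rewrite [leRHS]mulrDl !normrM; apply: lerD.
  by rewrite mulrAC; exact: ler_pM.
by rewrite -mulrA; exact: ler_pM.
Qed.

Lemma lip_along_sum (I : Type) (s : seq I) (F : I -> R -> R) :
  (forall i, lip_along (F i)) -> lip_along (fun u => \sum_(i <- s) F i u).
Proof.
move=> HF; elim: s => [|i s IH].
  have -> : (fun u => \sum_(i <- [::]) F i u) = cst 0.
    by apply/funext => u; rewrite big_nil.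
  exact: lip_along_cst.
have -> : (fun u => \sum_(j <- i :: s) F j u) = (fun u => F i u + \sum_(j <- s) F j u).
  by apply/funext => u; rewrite big_cons.
exact: lip_along_add.
Qed.

Lemma lip_along_ac f : absolutely_continuous alpha beta z -> lip_along f ->
  absolutely_continuous alpha beta (f : R -> R^o).
Proof.
move=> acz [L [B [L0 B0 H]]]; apply: (ac_dominated (L := L) acz) => s t as_ st tb.
by have [] := H s t; rewrite ?as_ ?tb ?(le_trans st tb) ?(le_trans as_ st).
Qed.

End LipschitzAlong.

Lemma is_derive_coord (R : realType) (m n : nat) (f : R -> 'M[R]_(m, n))
    (s : R) (v : 'M[R]_(m, n)) i j :
  is_derive s 1 f v -> is_derive s 1 (fun u => f u i j : R^o) (v i j).
Proof.
move=> [df <-]; apply: DeriveDef; first by move/derivable_mxP : df.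
by rewrite (derive_mx df) mxE.
Qed.

Lemma is_derive_sum_ord (R : realType) (n : nat) (f : 'I_n -> R -> R) (s : R) (d : 'I_n -> R) :
  (forall i, is_derive s 1 (f i) (d i)) ->
  is_derive s 1 (fun u => \sum_i f i u) (\sum_i d i).
Proof.
move=> H; have -> : (fun u => \sum_i f i u) = \sum_i f i.
  by apply/funext => u; rewrite fct_sumE.
exact: is_derive_sum.
Qed.

Lemma is_derive_pairing (R : realType) (n : nat) (l : 'cV[R]_n) (z : R -> 'rV[R]_n)
    (s : R) (v : 'rV[R]_n) :
  is_derive s 1 z v -> is_derive s 1 (fun u => pairing l (z u)) (pairing l v).
Proof.
move=> dz; rewrite pairingE.
have -> : (fun u => pairing l (z u)) = (fun u => \sum_k z u 0 k * l k 0).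
  by apply/funext => u; rewrite pairingE.
apply: is_derive_sum_ord => k; have dk := is_derive_coord 0 k dz.
have -> : (fun u => z u 0 k * l k 0) = (fun u => z u 0 k) * cst (l k 0) by [].
apply: is_derive_eq; rewrite scaler0 add0r -[_ *: _]/(_ * _).
by rewrite mulrC.
Qed.

Lemma is_derive_comp1 (R : realType) (f theta : R -> R) (s df dt : R) :
  is_derive s 1 theta dt -> is_derive (theta s) 1 f df ->
  is_derive s 1 (f \o theta) (df * dt).
Proof.
move=> Dt Df.
have dt_ := @ex_derive _ _ _ _ _ _ _ Dt; have df_ := @ex_derive _ _ _ _ _ _ _ Df.
apply: DeriveDef.
  by apply/derivable1_diffP/differentiable_comp; exact/derivable1_diffP.
rewrite -derive1E derive1_comp// !derive1E.
by rewrite (@derive_val _ _ _ _ _ _ _ Dt) (@derive_val _ _ _ _ _ _ _ Df).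
Qed.

Section CalibratingFunction.
Variables (R : realType) (n : nat).
Variables (x : R -> 'rV[R]_n) (p : R -> 'cV[R]_n) (theta : R -> R) (z : R -> 'rV[R]_n).
Variables (h K t0 : R).

(** The value of [S] at [z s], with [theta s] in the place of [tau (z s)]; the coefficient of the
    last sum is [Q / 2]. *)
Definition calibrating_function (s : R) : R :=
  2 * h * theta s + \sum_k (z s 0 k - x (theta s) 0 k) * p (theta s) k 0
  + (- K * (theta s - t0)) * \sum_k (z s 0 k - x (theta s) 0 k) * (z s 0 k - x (theta s) 0 k).

Lemma is_derive_mul (f g : R -> R) (s df dg : R) :
  is_derive s 1 f df -> is_derive s 1 g dg ->
  is_derive s 1 (fun u => f u * g u) (f s * dg + g s * df).
Proof. by move=> Df Dg; exact: is_deriveM. Qed.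

Lemma is_derive_add (f g : R -> R) (s df dg : R) :
  is_derive s 1 f df -> is_derive s 1 g dg ->
  is_derive s 1 (fun u => f u + g u) (df + dg).
Proof. by move=> Df Dg; exact: is_deriveD. Qed.

Lemma is_derive_scale (c : R) (f : R -> R) (s df : R) :
  is_derive s 1 f df -> is_derive s 1 (fun u => c * f u) (c * df).
Proof. by move=> Df; exact: is_deriveZ. Qed.

(** Since [<p, dx> = 2 h], the derivative of [2 * h * theta] cancels the one that [<p, y>] owes to
    the motion of the base point [x (theta s)]. What is left besides [<p + Q y, v>] is proportional
    to [dt]. *)
Lemma is_derive_calibrating_function (s dt : R) (v dx : 'rV[R]_n) (dp : 'cV[R]_n) :
  is_derive s 1 z v -> is_derive s 1 theta dt ->
  is_derive (theta s) 1 x dx -> is_derive (theta s) 1 p dp ->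
  pairing (p (theta s)) dx = 2 * h ->
  let y := z s - x (theta s) in let Q := - (2 * K * (theta s - t0)) in
  is_derive s 1 calibrating_function
    (pairing (p (theta s)) v + Q * (\sum_k y 0 k * v 0 k)
     + dt * (pairing dp y - K * (\sum_k y 0 k ^+ 2) - Q * \sum_k y 0 k * dx 0 k)).
Proof.
move=> Dz Dt Dx Dp hE y Q.
have Dzk k : is_derive s 1 (fun u => z u 0 k) (v 0 k) by exact: is_derive_coord.
have Dxk k : is_derive s 1 (fun u => x (theta u) 0 k) (dx 0 k * dt).
  exact: (@is_derive_comp1 _ (fun u => x u 0 k) theta s _ _ Dt (is_derive_coord 0 k Dx)).
have Dpk k : is_derive s 1 (fun u => p (theta u) k 0) (dp k 0 * dt).
  exact: (@is_derive_comp1 _ (fun u => p u k 0) theta s _ _ Dt (is_derive_coord k 0 Dp)).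
have Dyk k : is_derive s 1 (fun u => z u 0 k - x (theta u) 0 k) (v 0 k - dx 0 k * dt).
  have -> : v 0 k - dx 0 k * dt = v 0 k + -1 * (dx 0 k * dt) by ring.
  have -> : (fun u => z u 0 k - x (theta u) 0 k) = (fun u => z u 0 k + -1 * x (theta u) 0 k).
    by apply/funext => u; rewrite mulN1r.
  by apply: is_derive_add => //; exact: is_derive_scale.
have yE k : z s 0 k - x (theta s) 0 k = y 0 k by rewrite /y !mxE.
have D1 := is_derive_scale (2 * h) Dt.
have D2 := is_derive_sum_ord (fun k => is_derive_mul (Dyk k) (Dpk k)).
have D3 := is_derive_sum_ord (fun k => is_derive_mul (Dyk k) (Dyk k)).
have D4 : is_derive s 1 (fun u => - K * (theta u - t0)) (- K * dt).
  apply: is_derive_scale.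
  have := is_derive_add Dt (is_derive_cst (- t0) s 1); rewrite addr0; exact.
have D := is_derive_add (is_derive_add D1 D2) (is_derive_mul D4 D3).
apply: (is_derive_eq D); rewrite /= {D D1 D2 D3 D4}.
pose s1 := \sum_k y 0 k * v 0 k; pose s2 := \sum_k y 0 k * dx 0 k.
pose s3 := \sum_k y 0 k ^+ 2.
have -> : \sum_i ((z s 0 i - x (theta s) 0 i) * (dp i 0 * dt) +
    p (theta s) i 0 * (v 0 i - dx 0 i * dt)) =
    dt * pairing dp y + pairing (p (theta s)) v - dt * pairing (p (theta s)) dx.
  rewrite !pairingE !mulr_sumr -big_split /= -sumrB; apply: eq_bigr => k _.
  by rewrite yE; ring.
have -> : \sum_i ((z s 0 i - x (theta s) 0 i) * (v 0 i - dx 0 i * dt) +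
     (z s 0 i - x (theta s) 0 i) * (v 0 i - dx 0 i * dt)) = 2 * s1 - 2 * dt * s2.
  rewrite /s1 /s2 !mulr_sumr -sumrB; apply: eq_bigr => k _.
  by rewrite yE; ring.
have -> : \sum_i (z s 0 i - x (theta s) 0 i) * (z s 0 i - x (theta s) 0 i) = s3.
  by apply: eq_bigr => k _; rewrite yE expr2.
rewrite hE -/s1 -/s2 -/s3 /Q; ring.
Qed.

Variables (alpha beta : R).

Lemma lip_along_calibrating_function :
  (forall k, lip_along alpha beta z (fun s => z s 0 k)) ->
  lip_along alpha beta z theta ->
  (forall k, lip_along alpha beta z (fun s => x (theta s) 0 k)) ->
  (forall k, lip_along alpha beta z (fun s => p (theta s) k 0)) ->
  lip_along alpha beta z calibrating_function.
Proof.
move=> Lz Lt Lx Lp.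
have Lc c f : lip_along alpha beta z f -> lip_along alpha beta z (fun s => c * f s).
  by move=> Lf; apply: lip_along_mul => //; exact: lip_along_cst.
have Ly k : lip_along alpha beta z (fun s => z s 0 k - x (theta s) 0 k).
  have -> : (fun s => z s 0 k - x (theta s) 0 k) = (fun s => z s 0 k + -1 * x (theta s) 0 k).
    by apply/funext => u; rewrite mulN1r.
  by apply: lip_along_add => //; exact: Lc.
apply: lip_along_add; first apply: lip_along_add.
- exact: Lc.
- by apply: lip_along_sum => k; exact: lip_along_mul.
- apply: lip_along_mul; last by apply: lip_along_sum => k; exact: lip_along_mul.
  by apply: Lc; apply: lip_along_add => //; exact: lip_along_cst.
Qed.

End CalibratingFunction.

(** * Comparison of a competitor with the extremal *)

Section Competitor.
Variables (R : realType) (n r : nat) (Y : 'I_r -> 'rV[R]_n -> 'rV[R]_n).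
Variables (A : set 'rV[R]_n) (T : 'rV[R]_n -> 'rV[R]_n).
Variables (a b t0 : R) (x : R -> 'rV[R]_n) (p : R -> 'cV[R]_n).
Variables (rho eps K m B : R).
Notation mu := (@lebesgue_measure R).

Local Notation x0 := (x t0).
Local Notation p0 := (p t0).
Local Notation h := (ham Y x0 p0).

Hypothesis cal : calibrated Y A T a b t0 x p rho eps K m B.
Hypothesis h0 : h < 0.

Variables (t1 t2 : R).
Hypotheses (at1 : a <= t1) (t12 : t1 < t2) (t2b : t2 <= b).
Hypotheses (t1e : `|t1 - t0| <= eps) (t2e : `|t2 - t0| <= eps).

Lemma calibrated_itv s : t1 <= s <= t2 -> a <= s <= b /\ `|s - t0| <= eps.
Proof.
move=> /andP[s1 s2]; split; first by rewrite (le_trans at1 s1) (le_trans s2 t2b).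
by move: t1e t2e; rewrite !ler_norml => /andP[e1 e2] /andP[e3 e4]; lra.
Qed.

Lemma calibrated_data s : t1 <= s <= t2 ->
  [/\ hamilton_at Y a b x p s, ham Y (x s) (p s) = h,
      pairing p0 (ham_velocity Y (x s) (p s)) <= - m,
      `|ham_velocity Y (x s) (p s)| <= B /\ `|ham_force Y (x s) (p s)| <= B &
      `|p s| <= B /\ `|x s - x0| <= 1].
Proof. by move=> /calibrated_itv[sab se]; have [_ _ H _ _] := cal; exact: H. Qed.

Lemma calibrated_gap s s' : t1 <= s -> s <= s' -> s' <= t2 ->
  m * (s' - s) <= pairing p0 (x s) - pairing p0 (x s').
Proof.
move=> s1 ss' s2; apply: (@velocity_gap _ _ _ Y a b) => //; first exact: le_trans s1.
  exact: le_trans t2b.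
move=> c /andP[c1 c2]; have [|? _ ? _ _] := @calibrated_data c.
  by rewrite (le_trans s1 c1) (le_trans c2 s2).
by split.
Qed.

Lemma calibrated_lipschitz s s' : t1 <= s <= t2 -> t1 <= s' <= t2 ->
  (forall k, `|x s' 0 k - x s 0 k| <= B * `|s' - s|) /\
  (forall k, `|p s' k 0 - p s k 0| <= B * `|s' - s|).
Proof.
wlog ss' : s s' / s <= s' => [hw|] sI s'I.
  have [ss'|/ltW s's] := leP s s'; first exact: hw.
  have [hx hp] := hw s' s s's s'I sI.
  by split=> k; [have := hx k|have := hp k]; rewrite distrC [`|s' - s|]distrC.
have [/andP[s1 s2] /andP[s1' s2']] := (sI, s'I).
have cI c : s <= c <= s' -> t1 <= c <= t2.
  by move=> /andP[c1 c2]; rewrite (le_trans s1 c1) (le_trans c2 s2').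
have as_ := le_trans at1 s1; have s'b := le_trans s2' t2b.
split=> k.
- have [|c ccI E] := @mean_value_within R a b (fun s => x s 0 k)
     (fun c => ham_velocity Y (x c) (p c) 0 k) s s' as_ ss' s'b.
    move=> c /cI/calibrated_data[[Dx _] _ _ _ _].
    exact: has_derivative_within_coord.
  move: E => /= ->; rewrite normrM ler_wpM2r//.
  have [_ _ _ [H _] _] := calibrated_data (cI c ccI).
  by apply: le_trans H; exact: le_mx_norm.
- have [|c ccI E] := @mean_value_within R a b (fun s => p s k 0)
     (fun c => ham_force Y (x c) (p c) k 0) s s' as_ ss' s'b.
    move=> c /cI/calibrated_data[[_ Dp] _ _ _ _].
    exact: has_derivative_within_coord.
  move: E => /= ->; rewrite normrM ler_wpM2r//.
  have [_ _ _ [_ H] _] := calibrated_data (cI c ccI).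
  by apply: le_trans H; exact: le_mx_norm.
Qed.

Variables (alpha beta : R) (z : R -> 'rV[R]_n) (w : R -> R).
Hypotheses (ab : alpha < beta) (acz : absolutely_continuous alpha beta z).
Hypotheses (zalpha : z alpha = x t1) (zbeta : z beta = x t2).
Hypothesis zball : forall s, alpha <= s <= beta -> `|z s - x0| < rho.
Hypothesis w0 : forall s, 0 <= w s.
Hypothesis aez : {ae mu, forall s, s \in `]alpha, beta[ -> derivable z s 1 /\
  causal_vector (fun i => Y i (z s)) (T (z s)) (derive1 z s) (w s)}.

(** Everywhere in the ball the constant covector [p0] has negative Hamiltonian and is negative on
    the time orientation, so it is negative on all future directed causal vectors. *)
Lemma competitor_decreasing s t : alpha <= s -> s < t -> t <= beta ->
  pairing p0 (z t) < pairing p0 (z s).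
Proof.
move=> as_ st tb.
pose F u := pairing (- p0) (z u).
have FE u : F u = - pairing p0 (z u).
  by rewrite /F -scaleN1r pairingZl mulN1r.
have acF : absolutely_continuous alpha beta (F : R -> R^o).
  apply: (ac_dominated (L := n%:R * `|- p0|) acz) => u v _ _ _.
  rewrite /F (_ : _ - _ = pairing (- p0) (z v - z u)); first exact: le_pairing.
  by rewrite pairingDr pairingNr.
suff : F s < F t by rewrite !FE ltrN2.
apply: (ac_increasing acF) => //.
have FF := ae_filter_ringOfSetsType mu.
move: aez; apply: filterS => u Hu uab; have [dz cv] := Hu uab.
have Dz : is_derive u 1 z (derive1 z u) by apply: DeriveDef => //; rewrite derive1E.
have DF := is_derive_pairing (- p0) Dz.
split; first exact: (@ex_derive _ _ _ _ _ _ _ DF).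
rewrite derive1E (@derive_val _ _ _ _ _ _ _ DF).
have ub : alpha <= u <= beta by move: uab; rewrite in_itv /= => /andP[? ?]; rewrite !ltW.
have [_ H _ _ _] := cal; have [_ hz pT] := H _ (zball ub).
have [H1 _] := causal_vector_pairing cv hz pT.
by rewrite -scaleN1r pairingZl mulN1r oppr_gt0.
Qed.

(** By monotonicity [<p0, z>] stays between its values at the ends, which are those of the extremal
    at [t1] and [t2]; the intermediate value theorem then provides the time. *)
Lemma competitor_time_exists : exists theta : R -> R, forall s, alpha <= s <= beta ->
  t1 <= theta s <= t2 /\ pairing p0 (x (theta s)) = pairing p0 (z s).
Proof.
have ht12 := ltW t12.
have cu : {within [set` `[t1, t2]], continuous (fun s => pairing p0 (x s))}.
  apply: (@within_continuous_eps _ R) => s sI e e0.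
  have [[Dx _] _ _ _ _] := calibrated_data sI.
  have Du := has_derivative_within_pairing (l := p0) Dx.
  have [d d0 Hd] := has_derivative_within_near Du e0.
  exists d => // y /calibrated_itv[yab _]; apply: Hd => /=.
  by rewrite in_itv.
have ivt s : exists c, alpha <= s <= beta -> t1 <= c <= t2 /\
    pairing p0 (x c) = pairing p0 (z s).
  have [sI|] := boolP (alpha <= s <= beta); last by exists 0.
  have /andP[s1 s2] := sI.
  have u1 : pairing p0 (z s) <= pairing p0 (x t1).
    rewrite -zalpha; move: s1; rewrite le_eqVlt => /orP[/eqP <-//|s1].
    exact/ltW/competitor_decreasing.
  have u2 : pairing p0 (x t2) <= pairing p0 (z s).
    rewrite -zbeta; move: s2; rewrite le_eqVlt => /orP[/eqP ->//|s2].
    exact/ltW/competitor_decreasing.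
  have u12 := le_trans u2 u1.
  have [|c cI E] := IVT ht12 cu (v := pairing p0 (z s)).
    by rewrite ge_min u2 orbT le_max u1.
  by exists c; move: cI; rewrite in_itv.
have [theta Htheta] := choice ivt.
by exists theta.
Qed.

Variable theta : R -> R.
Hypothesis Htheta : forall s, alpha <= s <= beta ->
  t1 <= theta s <= t2 /\ pairing p0 (x (theta s)) = pairing p0 (z s).

Let theta_inj s c : alpha <= s <= beta -> t1 <= c <= t2 ->
  pairing p0 (x c) = pairing p0 (z s) -> theta s = c.
Proof.
move=> sI /andP[c1 c2] E; have [/andP[h1 h2] E'] := Htheta sI.
have [[_ _ m0] _ _ _ _] := cal.
have [H|H|//] := ltgtP (theta s) c.
- have := calibrated_gap h1 (ltW H) c2; rewrite E' E subrr.
  by rewrite leNgt mulr_gt0// subr_gt0.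
- have := calibrated_gap c1 (ltW H) h2; rewrite E' E subrr.
  by rewrite leNgt mulr_gt0// subr_gt0.
Qed.

Lemma competitor_time_alpha : theta alpha = t1.
Proof.
by apply: theta_inj; rewrite ?lexx ?(ltW t12) ?(ltW ab)// zalpha.
Qed.

Lemma competitor_time_beta : theta beta = t2.
Proof.
by apply: theta_inj; rewrite ?lexx ?(ltW t12) ?(ltW ab)// zbeta.
Qed.

Lemma competitor_time_increasing s t : alpha <= s -> s < t -> t <= beta ->
  theta s < theta t.
Proof.
move=> as_ st tb.
have sI : alpha <= s <= beta by rewrite as_ (le_trans (ltW st) tb).
have tI : alpha <= t <= beta by rewrite tb (le_trans as_ (ltW st)).
have [/andP[s1 s2] Es] := Htheta sI; have [/andP[t1' t2'] Et] := Htheta tI.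
have dec := competitor_decreasing as_ st tb.
have [[_ _ m0] _ _ _ _] := cal.
rewrite ltNge; apply/negP => H.
have := calibrated_gap t1' H s2; rewrite Es Et.
have : 0 <= m * (theta s - theta t) by rewrite mulr_ge0 ?subr_ge0// ltW.
move=> g1 g2; have := le_trans g1 g2.
by rewrite subr_ge0 leNgt dec.
Qed.

(** By [calibrated_gap], [m] times the change of [theta] is at most the change of [<p0, z>]. So
    [theta], and with it everything evaluated at [theta], inherits absolute continuity from [z]. *)
Lemma competitor_time_lipschitz s t : alpha <= s <= beta -> alpha <= t <= beta ->
  `|theta t - theta s| <= n%:R * `|p0| / m * `|z t - z s|.
Proof.
wlog st : s t / s <= t => [hw|] sI tI.
  have [st|/ltW ts] := leP s t; first exact: hw.
  by rewrite distrC [`|z t - z s|]distrC; exact: hw.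
have [[_ _ m0] _ _ _ _] := cal.
have [/andP[s1 s2] Es] := Htheta sI; have [/andP[t1' t2'] Et] := Htheta tI.
have th : theta s <= theta t.
  move: st; rewrite le_eqVlt => /orP[/eqP -> //|st].
  by have [/andP[as_ _] /andP[_ tb]] := (sI, tI); exact/ltW/competitor_time_increasing.
have := calibrated_gap s1 th t2'; rewrite Es Et => g.
have -> : n%:R * `|p0| / m * `|z t - z s| = n%:R * `|p0| * `|z t - z s| / m by ring.
rewrite ler_pdivlMr// ger0_norm ?subr_ge0// mulrC.
apply: le_trans g _; apply: le_trans (ler_norm _) _.
rewrite distrC (_ : _ - _ = pairing p0 (z t - z s)); first exact: le_pairing.
by rewrite pairingDr pairingNr.
Qed.

Lemma competitor_time_interior s : alpha < s < beta -> t1 < theta s < t2.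
Proof.
move=> /andP[as_ sb]; rewrite -competitor_time_alpha -competitor_time_beta.
by rewrite !competitor_time_increasing// ltW.
Qed.

Lemma lip_along_competitor (f : R -> R) C L :
  (forall s s', t1 <= s <= t2 -> t1 <= s' <= t2 -> `|f s' - f s| <= L * `|s' - s|) ->
  (forall s, t1 <= s <= t2 -> `|f s| <= C) -> 0 <= L -> 0 <= C ->
  lip_along alpha beta z (f \o theta).
Proof.
move=> fL fC L0 C0; have [[_ _ m0] _ _ _ _] := cal.
exists (L * (n%:R * `|p0| / m)), C; split => //.
  by rewrite !mulr_ge0 ?invr_ge0//; exact: ltW.
move=> s t sI tI; have [sJ _] := Htheta sI; have [tJ _] := Htheta tI.
split; last exact: fC.
apply: le_trans (fL _ _ sJ tJ) _; rewrite -[leRHS]mulrA; apply: ler_wpM2l => //.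
exact: competitor_time_lipschitz.
Qed.

Local Notation S := (calibrating_function x p theta z h K t0).

Lemma competitor_calibration_lip : lip_along alpha beta z S.
Proof.
have [[rho0 eps0 m0] _ _ _ _] := cal.
have t11 : t1 <= t1 <= t2 by rewrite lexx ltW.
have B0 : 0 <= B by have [_ _ _ [H _] _] := calibrated_data t11; exact: le_trans H.
have x0k k (y : 'rV[R]_n) c : `|y - x0| <= c -> `|y 0 k| <= `|x0| + c.
  move=> yc; rewrite (_ : y = x0 + (y - x0)); last by rewrite addrC subrK.
  apply: le_trans (le_mx_norm _ 0 k) _; apply: le_trans (ler_normD _ _) _.
  by rewrite lerD2l.
apply: lip_along_calibrating_function => [k||k|k].
- exists 1, (`|x0| + rho); split => //; first by rewrite addr_ge0// ltW.
  move=> s t sI tI; rewrite mul1r; split.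
    by have := le_mx_norm (z t - z s) 0 k; rewrite !mxE.
  by apply: x0k; exact/ltW/zball.
- apply: (@lip_along_competitor id (`|t1| + `|t2|) 1) => //.
    by move=> s s' _ _; rewrite mul1r.
  move=> s /andP[s1 s2]; have := ler_norm (- t1); have := ler_norm t2.
  rewrite normrN => n1 n2; have p1 := normr_ge0 t1; have p2 := normr_ge0 t2.
  by rewrite ler_norml; lra.
- apply: (@lip_along_competitor (fun s => x s 0 k) (`|x0| + 1) B) => //.
  + by move=> s s' sI s'I; have [H _] := calibrated_lipschitz sI s'I; exact: H.
  + by move=> s sI; apply: x0k; have [_ _ _ _ []] := calibrated_data sI.
- apply: (@lip_along_competitor (fun s => p s k 0) B B) => //.
  + by move=> s s' sI s'I; have [_ H] := calibrated_lipschitz sI s'I; exact: H.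
  + move=> s sI; have [_ _ _ _ [H _]] := calibrated_data sI.
    by apply: le_trans H; exact: le_mx_norm.
Qed.

(** From [<p0, x (theta s)> = <p0, z s>] the function [theta] is differentiable wherever [z] is,
    with derivative [<p0, z'> / <p0, x'>]; this quotient is the one in [calibration_shift]. *)
Lemma competitor_calibration_derive s : alpha < s < beta -> derivable z s 1 ->
  is_derive s 1 S (pairing (calibrating_covector Y t0 x p K (theta s) (z s)) (derive1 z s)).
Proof.
move=> sI dz; have sJ : alpha <= s <= beta by move: sI => /andP[? ?]; rewrite !ltW.
have [_ _ Hcal _ _] := cal.
have [tI E] := Htheta sJ; have tint := competitor_time_interior sI.
(* By strict monotonicity [theta s] is an interior time, so the extremal has two-sided derivatives
   there. *)
have tab : a < theta s < b.
  have /andP[u1 u2] := tint; rewrite (le_lt_trans at1 u1).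
  exact: lt_le_trans u2 t2b.
have [[Dx Dp] hE um _ _] := calibrated_data tI.
have [[_ _ m0] _ _ _ _] := cal.
have Dx' := has_derivative_within_interior tab Dx.
have Dp' := has_derivative_within_interior tab Dp.
have Dz : is_derive s 1 z (derive1 z s) by apply: DeriveDef => //; rewrite derive1E.
set v := derive1 z s in Dz *.
have cz : {for s, continuous z}.
  by apply: differentiable_continuous; exact/derivable1_diffP.
have Du := is_derive_pairing p0 Dx'.
have Dw := is_derive_pairing p0 Dz.
set u' := pairing p0 (ham_velocity _ _ _) in um Du.
have u'0 : u' != 0 by rewrite lt_eqF// (le_lt_trans um)// oppr_lt0.
have near_in : \forall y \near s, alpha <= y <= beta.
  have := sI => /andP[s1 s2]; near=> y; apply/andP; split; apply: ltW.
    by near: y; exact: lt_nbhsr.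
  by near: y; exact: lt_nbhsl.
have ct : {for s, continuous theta}.
  apply: continuous_at_norm => e e0.
  pose N := n%:R * `|p0| / m.
  have N0 : 0 <= N by rewrite /N !mulr_ge0// invr_ge0 ltW.
  have e'0 : 0 < e / (N + 1) by rewrite divr_gt0// ltr_wpDl.
  move: cz => /cvgrPdist_le /(_ _ e'0); apply: filterS2 near_in => y yI zy.
  apply: le_trans (competitor_time_lipschitz yI sJ) _; rewrite -/N.
  apply: (@le_trans _ _ ((N + 1) * (e / (N + 1)))).
    by apply: ler_pM => //; rewrite lerDl.
  by rewrite mulrC divfK// gt_eqF// ltr_wpDl.
have Dut : is_derive s 1 ((fun c => pairing p0 (x c)) \o theta) (pairing p0 v).
  apply: near_eq_is_derive Dw; move: near_in; apply: filterS => y yI.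
  by rewrite /= (Htheta yI).2.
have Dt := is_derive_left_inverse ct Du u'0 Dut.
have pv : pairing (p (theta s)) (ham_velocity Y (x (theta s)) (p (theta s))) = 2 * h.
  by rewrite pairing_ham_velocity hE.
have DS := is_derive_calibrating_function K t0 Dz Dt Dx' Dp' pv.
cbv zeta in DS; apply: (is_derive_eq DS) => {DS}.
rewrite /calibrating_covector /calibration_shift -/u' !pairingDl !pairingZl.
have -> : pairing (z s - x (theta s))^T v = \sum_k (z s - x (theta s)) 0 k * v 0 k.
  by rewrite pairingE; apply: eq_bigr => k _; rewrite [_^T _ _]mxE mulrC.
by rewrite addrA; congr (_ + _); rewrite mulrC mulrA [RHS]mulrAC.
Unshelve. all: by end_near. Qed.

Local Notation c := (Num.sqrt (- (2 * h))).

Let c_gt0 : 0 < c. Proof. by rewrite sqrtr_gt0 oppr_gt0 pmulr_rlt0. Qed.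

Let c_sqr : c ^+ 2 = - (2 * h).
Proof. by rewrite sqr_sqrtr// oppr_ge0 pmulr_rle0// ltW. Qed.

(** Sign and scale are such that the derivative dominates the speed of the competitor and the total
    increment is the length of the extremal. *)
Definition normalized_calibration (s : R) : R := - c^-1 * S s.

Local Notation G := normalized_calibration.

Lemma normalized_calibration_ac : absolutely_continuous alpha beta (G : R -> R^o).
Proof. exact: ac_scale (lip_along_ac acz competitor_calibration_lip). Qed.

Lemma normalized_calibration_increment : G beta - G alpha = c * (t2 - t1).
Proof.
rewrite /G /calibrating_function competitor_time_alpha competitor_time_beta zalpha zbeta.
have E u : \sum_k (x u 0 k - x u 0 k) * p u k 0 = 0.
  by apply: big1 => k _; rewrite subrr mul0r.
have E' u : \sum_k (x u 0 k - x u 0 k) * (x u 0 k - x u 0 k) = 0.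
  by apply: big1 => k _; rewrite subrr mul0r.
rewrite !E !E' !mulr0 !addr0.
have -> : - c^-1 * (2 * h * t2) - - c^-1 * (2 * h * t1) = c^-1 * - (2 * h) * (t2 - t1) by ring.
by rewrite -[X in _ * X * _]c_sqr expr2 mulKf// gt_eqF.
Qed.

(** The calibrating covector has [- 2 H >= c^2 + 2 |y|^2]. The factor [k = 1] serves for the bound
    on the length; away from the extremal some [k > 1] is allowed, and this yields strictness. *)
Lemma normalized_calibration_speed s k : alpha < s < beta -> derivable z s 1 ->
  causal_vector (fun i => Y i (z s)) (T (z s)) (derive1 z s) (w s) ->
  0 <= k -> k ^+ 2 * c ^+ 2 <= c ^+ 2 + 2 * `|z s - x (theta s)| ^+ 2 ->
  [/\ derivable G s 1, k * w s <= derive1 G s & 0 < derive1 G s].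
Proof.
move=> sI dz cv k0 hk.
have sJ : alpha <= s <= beta by move: sI => /andP[? ?]; rewrite !ltW.
have [tI _] := Htheta sJ; have [tab te] := calibrated_itv tI.
have [_ _ _ Hcal _] := cal; have [hz pz] := Hcal _ _ tab te (zball sJ).
set zeta := calibrating_covector _ _ _ _ _ _ _ in hz pz.
have q0 : 0 <= `|z s - x (theta s)| ^+ 2 by rewrite exprn_ge0.
have hz0 : ham Y (z s) zeta < 0.
  by apply: le_lt_trans hz _; rewrite subr_lt0; exact: lt_le_trans h0 q0.
have [H1 H2] := causal_vector_pairing cv hz0 pz.
have DS := competitor_calibration_derive sI dz.
have DG : is_derive s 1 G (- c^-1 * pairing zeta (derive1 z s)) by exact: is_derive_scale.
rewrite derive1E (@derive_val _ _ _ _ _ _ _ DG); split.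
- exact: (@ex_derive _ _ _ _ _ _ _ DG).
- have -> : - c^-1 * pairing zeta (derive1 z s) = - pairing zeta (derive1 z s) / c by ring.
  rewrite ler_pdivlMr//; apply: le_trans H2.
  have -> : k * w s * c = k * c * w s by ring.
  apply: ler_wpM2r => //; rewrite -[leLHS]ger0_norm; last by rewrite mulr_ge0// ltW.
  rewrite -sqrtr_sqr ler_wsqrtr// exprMn; apply: le_trans hk _.
  rewrite c_sqr -lerN2 opprK opprD opprK -mulrN -mulrDr.
  by rewrite ler_pM2l.
- by rewrite mulNr -mulrN mulr_gt0 ?invr_gt0// oppr_gt0.
Qed.

Let ae_speed : {ae mu, forall s, s \in `]alpha, beta[ ->
  [/\ derivable G s 1, w s <= derive1 G s & 0 < derive1 G s]}.
Proof.
have FF := ae_filter_ringOfSetsType mu.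
move: aez; apply: filterS => s Hs sI; have [dz cv] := Hs sI.
have sI' : alpha < s < beta by move: sI; rewrite in_itv.
have [|dG G1 G2] := normalized_calibration_speed sI' dz cv ler01.
  by rewrite expr1n mul1r lerDl mulr_ge0// exprn_ge0.
by rewrite mul1r in G1.
Qed.

Lemma competitor_length_le :
  (\int[mu]_(s in [set` `[alpha, beta]]) (w s)%:E <= (c * (t2 - t1))%:E)%E.
Proof.
rewrite -normalized_calibration_increment.
apply: integral_le_ac_increment => //; first exact: ltW.
  exact: normalized_calibration_ac.
have FF := ae_filter_ringOfSetsType mu.
by move: ae_speed; apply: filterS => s Hs /Hs[].
Qed.

(** The distance to the extremal varies by at most [(1 + N)] times the variation of [z], which
    absolute continuity controls when applied to the single interval [[s0, s]]. *)
Let y_near s0 : alpha <= s0 <= beta -> z s0 != x (theta s0) ->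
  exists2 d, 0 < d & forall s, alpha <= s <= beta -> s0 <= s -> s - s0 < d ->
    `|z s0 - x (theta s0)| / 2 <= `|z s - x (theta s)|.
Proof.
move=> s0I zx; have [[_ _ m0] _ _ _ _] := cal.
have y0 : 0 < `|z s0 - x (theta s0)| by rewrite normr_gt0 subr_eq0.
have t11 : t1 <= t1 <= t2 by rewrite lexx ltW.
have B0 : 0 <= B by have [_ _ _ [H _] _] := calibrated_data t11; exact: le_trans H.
pose N := B * (n%:R * `|p0| / m).
have N0 : 0 <= N by rewrite /N !mulr_ge0// invr_ge0 ltW.
have N1 : 0 < 1 + N by rewrite ltr_pwDl.
pose e := `|z s0 - x (theta s0)| / 2 / (1 + N).
have e0 : 0 < e by rewrite /e !divr_gt0.
have [d d0 Hd] := acz e0; exists d => // s sI s0s sd.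
have zs : `|z s - z s0| < e.
  have := Hd 1%N (fun=> s0) (fun=> s); rewrite !big_ord1; apply => //.
  - by have [/andP[? _] /andP[_ ?]] := (s0I, sI).
  - by move=> i j _ _ _; rewrite !ord1.
have xs : `|x (theta s) - x (theta s0)| <= N * `|z s - z s0|.
  apply: mx_norm_le => [|i k]; first by rewrite mulr_ge0.
  rewrite ord1 !mxE.
  have [H _] := calibrated_lipschitz (Htheta s0I).1 (Htheta sI).1.
  apply: le_trans (H k) _; rewrite /N -[leRHS]mulrA; apply: ler_wpM2l => //.
  exact: competitor_time_lipschitz.
have tri : `|z s0 - x (theta s0)| <= `|z s - x (theta s)| + (1 + N) * `|z s - z s0|.
  have -> : z s0 - x (theta s0) = (z s - x (theta s)) + ((x (theta s) - x (theta s0)) - (z s - z s0)).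
    by apply/rowP => i; rewrite !mxE; ring.
  apply: le_trans (ler_normD _ _) _; rewrite lerD2l.
  apply: le_trans (ler_normB _ _) _; rewrite mulrDl mul1r [leRHS]addrC.
  by rewrite lerD2r.
have : (1 + N) * `|z s - z s0| <= `|z s0 - x (theta s0)| / 2.
  by rewrite mulrC -ler_pdivlMr// ltW.
move: tri; set u := `|z s0 - x (theta s0)|; set v := `|z s - x (theta s)|.
set q := (1 + N) * _; lra.
Qed.

Lemma competitor_length_eq :
  (\int[mu]_(s in [set` `[alpha, beta]]) (w s)%:E = (c * (t2 - t1))%:E)%E ->
  forall s, alpha <= s <= beta -> z s = x (theta s).
Proof.
move=> E s sI; apply/eqP; apply: contraT => zx; exfalso.
have [d d0 Hd] := y_near sI zx.
have /andP[as_ sb] := sI.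
(* At [beta] the competitor meets the extremal, so there is room to the right of [s]. *)
have sb' : s < beta.
  rewrite lt_neqAle sb andbT; apply: contra zx => /eqP ->.
  by rewrite competitor_time_beta zbeta.
pose e := Num.min beta (s + d / 2).
have se : s < e by rewrite lt_min sb' ltrDl divr_gt0.
have eb : e <= beta by rewrite ge_min lexx.
have ed : e - s < d.
  rewrite ltrBlDl; apply: (@le_lt_trans _ _ (s + d / 2)).
    by rewrite ge_min lexx orbT.
  by rewrite ltrD2l gtr_pMr// invf_lt1// ltr1n.
pose y := `|z s - x (theta s)|.
have y0 : 0 < y by rewrite normr_gt0 subr_eq0.
(* Chosen so that [k ^+ 2 * c ^+ 2 = c ^+ 2 + 2 * (y / 2) ^+ 2], the competitor being at distance at
   least [y / 2] from the extremal on [[s, e]]. *)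
pose k := Num.sqrt (1 + 2 * (y / 2) ^+ 2 / c ^+ 2).
have kk : 0 < 2 * (y / 2) ^+ 2 / c ^+ 2.
  by rewrite !(divr_gt0, mulr_gt0, exprn_gt0).
have kE : k ^+ 2 = 1 + 2 * (y / 2) ^+ 2 / c ^+ 2.
  by rewrite [LHS]sqr_sqrtr//; apply: addr_ge0 => //; exact: ltW.
have k1 : 1 < k by rewrite -[ltLHS]sqrtr1 ltr_sqrt ?ltrDl// addr_gt0.
have FF := ae_filter_ringOfSetsType mu.
have : (\int[mu]_(s in [set` `[alpha, beta]]) (w s)%:E < (G beta - G alpha)%:E)%E.
  apply: (integral_lt_ac_increment (c := s) (d := e) (k := k)) => //.
  - exact: ltW.
  - exact: normalized_calibration_ac.
  - by move: ae_speed; apply: filterS => u Hu /Hu[].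
  - move: aez; apply: filterS => u Hu uI.
    have /andP[su ue] : s < u < e by move: uI; rewrite in_itv.
    have uab : alpha < u < beta.
      by rewrite (le_lt_trans as_ su) (lt_le_trans ue eb).
    have uI' : u \in `]alpha, beta[ by rewrite in_itv.
    have [dz cv] := Hu uI'.
    have uJ : alpha <= u <= beta by move: uab => /andP[? ?]; rewrite !ltW.
    have usd : u - s < d by apply: lt_trans ed; rewrite ltrD2r.
    have yu := Hd u uJ (ltW su) usd.
    have [|//] := normalized_calibration_speed uab dz cv (ltW (lt_trans ltr01 k1)).
    rewrite kE mulrDl mul1r divfK; last by rewrite expf_neq0// gt_eqF.
    rewrite lerD2l ler_wpM2l// ler_sqr ?nnegrE//.
    by rewrite divr_ge0// ltW.
  - apply: (ac_increasing normalized_calibration_ac) => //.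
    by move: ae_speed; apply: filterS => u Hu /Hu[].
by rewrite E normalized_calibration_increment ltxx.
Qed.

End Competitor.

(** * Charts, smooth fields and orthonormal frames *)

Section Charts.
Variables (R : realType) (n : nat) (M : smoothManifold R n).
Implicit Types (c : chart M) (q : M).

Lemma chart_image_open c (W : set M) : open W -> open (phi M c @` (W `&` dom M c)).
Proof.
move=> oW; rewrite openE => _ [q [Wq dq] <-].
have im : (phi M c @` dom M c) (phi M c q) by exists q.
have n1 : nbhs (phi M c q) (phi M c @` dom M c).
  by apply: open_nbhs_nbhs; split => //; exact: codom_open.
have n2 : nbhs (phi M c q) (psi M c @^-1` W).
  by apply: (psi_continuous im); rewrite phiK//; exact: open_nbhs_nbhs.
rewrite /interior; apply: filterS (filterI n1 n2) => _ [[q' dq' <-]] /=.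
by rewrite phiK// => Wq'; exists q'.
Qed.

Lemma chart_dom_near c q : dom M c q -> nbhs q (dom M c).
Proof. by move=> dq; apply: open_nbhs_nbhs; split => //; exact: dom_open. Qed.

Lemma transition_differentiable c c' q : dom M c q -> dom M c' q ->
  differentiable (phi M c' \o psi M c) (phi M c q).
Proof.
move=> dq dq'; apply: (smooth_differentiable (A := phi M c @` (dom M c `&` dom M c'))).
- by rewrite setIC; apply: chart_image_open; exact: dom_open.
- exact: transition_smooth.
- by exists q.
Qed.

Definition transition c c' q : 'M[R]_n := jacobian (phi M c' \o psi M c) (phi M c q).

Lemma coord_changeE c q : coord_change c q = transition (chart_at M q) c q.
Proof. by []. Qed.

Lemma jacobian_near_id (f : 'rV[R]_n -> 'rV[R]_n) x :
  (\forall y \near x, f y = y) -> jacobian f x = 1%:M.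
Proof.
move=> fx; apply/row_matrixP => i; rewrite !rowE mulmx1.
have df : differentiable f x.
  apply: (@differentiable_of_linear_approx _ _ _ f x (@idfun 'rV[R]_n)).
    by move=> ?; exact: cvg_id.
  move=> e e0; have /nbhs_rVP[d d0 Hd] : nbhs x [set y | f y = y] by exact: fx.
  exists d => // h hd; rewrite (nbhs_singleton fx) Hd ?addrK// [x + _]addrC subrr.
  by rewrite normr0 mulr_ge0// ltW.
rewrite -deriveEjacobian// (near_eq_derive (g := id)) ?derive_id//.
Qed.

Lemma mul_jacobian (f : 'rV[R]_n -> 'rV[R]_n) x v : differentiable f x ->
  v *m jacobian f x = 'd f x v.
Proof. by move=> df; rewrite -deriveEjacobian// deriveE. Qed.

Lemma jacobian_comp (f g : 'rV[R]_n -> 'rV[R]_n) x :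
  differentiable f x -> differentiable g (f x) ->
  jacobian (g \o f) x = jacobian f x *m jacobian g (f x).
Proof.
move=> df dg; have dgf : differentiable (g \o f) x by exact: differentiable_comp.
apply/row_matrixP => i; rewrite !rowE mulmxA.
transitivity ('d (g \o f) x (delta_mx 0 i)); first exact: mul_jacobian.
rewrite (diff_comp df dg) /=.
transitivity ('d f x (delta_mx 0 i) *m jacobian g (f x)).
  exact: (esym (mul_jacobian _ dg)).
by congr (_ *m _); exact: (esym (mul_jacobian _ df)).
Qed.

Lemma transition_comp c c' q : dom M c q -> dom M c' q ->
  transition c c' q *m transition c' c q = 1%:M.
Proof.
move=> dq dq'.
have d1 := transition_differentiable dq dq'.
have d2 := transition_differentiable dq' dq.
have pq : (phi M c' \o psi M c) (phi M c q) = phi M c' q by rewrite /= phiK.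
have d2' : differentiable (phi M c \o psi M c') ((phi M c' \o psi M c) (phi M c q)).
  by rewrite pq.
have E := jacobian_comp d1 d2'.
rewrite pq in E.
transitivity (jacobian ((phi M c \o psi M c') \o (phi M c' \o psi M c)) (phi M c q)).
  exact: (esym E).
apply: jacobian_near_id.
have nW : nbhs (phi M c q) (phi M c @` (dom M c' `&` dom M c)).
  apply: open_nbhs_nbhs; split; last by exists q.
  by apply: chart_image_open; exact: dom_open.
by apply: filterS nW => _ [q' [d' d''] <-]; rewrite /= phiK// phiK.
Qed.

Lemma coord_change_unit c q : dom M c q -> coord_change c q \in unitmx.
Proof.
move=> dq; rewrite coord_changeE.
have E := transition_comp (dom_chart_at q) dq.
by have [u _] := mulmx1_unit E; exact: u.
Qed.

Lemma is_derive_chart c c' (eta : R -> M) (s : R) v :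
  {for s, continuous eta} -> dom M c (eta s) -> dom M c' (eta s) ->
  is_derive s 1 (phi M c \o eta) v ->
  is_derive s 1 (phi M c' \o eta) (v *m transition c c' (eta s)).
Proof.
move=> ce dq dq' D.
have nW : \forall u \near s, dom M c (eta u).
  by apply: ce; exact: chart_dom_near.
have dt := transition_differentiable dq dq'.
have dphi : differentiable (phi M c \o eta) s.
  by apply/derivable1_diffP; exact: (@ex_derive _ _ _ _ _ _ _ D).
apply: (@near_eq_is_derive _ _ _ ((phi M c' \o psi M c) \o (phi M c \o eta))).
  by apply: filterS nW => u du; rewrite /= phiK.
have dcomp : differentiable ((phi M c' \o psi M c) \o (phi M c \o eta)) s.
  exact: differentiable_comp.
apply: DeriveDef; first exact/derivable1_diffP.
rewrite /transition; transitivity ('d (phi M c' \o psi M c) (phi M c (eta s)) v).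
  rewrite (deriveE _ dcomp) (diff_comp dphi dt) /=.
  by rewrite -(deriveE _ dphi) (@derive_val _ _ _ _ _ _ _ D).
by apply/esym; exact: mul_jacobian.
Qed.

(** Where the difference quotient diverges, [derive1] takes the default value 0, so a nonzero
    velocity certifies differentiability. *)
Lemma velocity_derivable (eta : curve R M) s : velocity eta s != 0 ->
  is_derive s 1 (phi M (chart_at M (cmap eta s)) \o cmap eta) (velocity eta s).
Proof.
rewrite /velocity; set f := phi M _ \o cmap eta => v0.
suff df : derivable f s 1.
  by apply: DeriveDef; [exact: df|rewrite derive1E].
apply: contrapT => ncv; move/eqP: v0; apply.
rewrite derive1E /derive dvgP//; by apply/rowP => j; rewrite !mxE.
Qed.

Lemma velocity_chart c (eta : curve R M) s :
  {for s, continuous (cmap eta)} -> dom M c (cmap eta s) -> velocity eta s != 0 ->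
  is_derive s 1 (phi M c \o cmap eta) (velocity eta s *m coord_change c (cmap eta s)).
Proof.
move=> ce dq v0; rewrite coord_changeE.
exact: (is_derive_chart ce (dom_chart_at _) dq (velocity_derivable v0)).
Qed.

Lemma chart_velocity c (eta : curve R M) s v :
  {for s, continuous (cmap eta)} -> dom M c (cmap eta s) ->
  is_derive s 1 (phi M c \o cmap eta) v ->
  velocity eta s *m coord_change c (cmap eta s) = v.
Proof.
move=> ce dq D; have da := dom_chart_at (cmap eta s).
have D' := is_derive_chart ce dq da D.
rewrite /velocity derive1E (@derive_val _ _ _ _ _ _ _ D') coord_changeE.
by rewrite -mulmxA transition_comp// mulmx1.
Qed.

End Charts.

Section SmoothFields.
Variables (R : realType) (n : nat) (M : smoothManifold R n).

Lemma Ck_subset (V : normedModType R) k (A A' : set 'rV[R]_n) (f : 'rV[R]_n -> V) :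
  A' `<=` A -> Ck k A f -> Ck k A' f.
Proof.
move=> sA; elim: k f => [|k IH] f; first by move=> cf y /sA; exact: cf.
by move=> H i; have [df Cf] := H i; split; [move=> y /sA; exact: df|exact: IH].
Qed.

Lemma smooth_field_subset (W W' : set M) X : W' `<=` W -> smooth_field W X -> smooth_field W' X.
Proof.
move=> sW sX c k; apply: Ck_subset (sX c k) => _ [q [Wq dq] <-].
by exists q => //; split => //; exact: sW.
Qed.

Variable W : set M.
Hypothesis oW : open W.

Let oA c : open (phi M c @` (W `&` dom M c)). Proof. exact: chart_image_open. Qed.

Lemma smooth_function_cst k : smooth_function W (cst k : M -> R).
Proof. by move=> c j; exact: Ck_cst. Qed.

Lemma smooth_function_mul f g : smooth_function W f -> smooth_function W g ->
  smooth_function W (fun q => f q * g q).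
Proof. by move=> sf sg c k; exact: (Ck_mul (@oA c) (sf c k) (sg c k)). Qed.

Lemma smooth_function_rsqrt f : smooth_function W f -> (forall q, W q -> 0 < f q) ->
  smooth_function W (fun q => (Num.sqrt (f q))^-1).
Proof.
move=> sf f0 c; apply: (smooth_rsqrt (@oA c) (sf c)) => _ [q [Wq dq] <-].
by rewrite /= phiK//; exact: f0.
Qed.

Lemma smooth_field_scale f X : smooth_function W f -> smooth_field W X ->
  smooth_field W (fun q => f q *: X q).
Proof.
move=> sf sX c; have -> : field_coord c (fun q => f q *: X q) =
    (fun x => (f \o psi M c) x *: field_coord c X x).
  by apply/funext => x; rewrite /field_coord scalemxAl.
exact: (smooth_scale (@oA c) (sf c) (sX c)).
Qed.

Lemma smooth_field_sum (I : Type) (s : seq I) (X : I -> M -> 'rV[R]_n) :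
  (forall i, smooth_field W (X i)) -> smooth_field W (fun q => \sum_(i <- s) X i q).
Proof.
move=> sX c; have -> : field_coord c (fun q => \sum_(i <- s) X i q) =
    (fun x => \sum_(i <- s) field_coord c (X i) x).
  by apply/funext => x; rewrite /field_coord mulmx_suml.
by apply: smooth_sum_mx => // i _; exact: sX.
Qed.

Lemma smooth_field_add X X' : smooth_field W X -> smooth_field W X' ->
  smooth_field W (fun q => X q + X' q).
Proof.
move=> sX sX'.
have sb (b : bool) : smooth_field W (if b then X else X') by case: b.
have -> : (fun q => X q + X' q) = (fun q => \sum_(b <- [:: true; false]) (if b then X else X') q).
  by apply/funext => q; rewrite !big_cons big_nil addr0.
exact: smooth_field_sum.
Qed.

Lemma smooth_function_pos_near f q : W q -> smooth_function W f -> 0 < f q ->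
  exists W', [/\ open W', W' q, W' `<=` W & forall q', W' q' -> 0 < f q'].
Proof.
move=> Wq sf f0; pose c := chart_at M q; have dq := dom_chart_at q.
have xq : (phi M c @` (W `&` dom M c)) (phi M c q) by exists q.
have cf : {for phi M c q, continuous (f \o psi M c)} by exact: (sf c 0%N _ xq).
have fq : 0 < (f \o psi M c) (phi M c q) by rewrite /= phiK.
have n1 : nbhs (phi M c q) [set x | 0 < (f \o psi M c) x].
  move: cf => /cvgrPdist_lt /(_ _ fq) /nbhs_rVP[d d0 Hd].
  apply/nbhs_rVP; exists d => // y /Hd /=.
  by set u := f (psi M c y); set v := f _; rewrite ltr_norml; lra.
have n2 : nbhs q (phi M c @^-1` [set x | 0 < (f \o psi M c) x]).
  exact: phi_continuous dq _ n1.
have n3 := chart_dom_near dq.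
have n4 : nbhs q W by apply: open_nbhs_nbhs.
have : nbhs q [set q' | W q' /\ 0 < f q'].
  apply: filterS (filterI n4 (filterI n2 n3)) => q' [Wq' [fq' d']].
  by split => //; move: fq'; rewrite /= (phiK d').
rewrite nbhsE => -[W' [oW' W'q] sW']; exists W'; split => //.
- by move=> q' /sW'[].
- by move=> q' /sW'[].
Qed.

End SmoothFields.

(** * Local orthonormal frames by the Gram-Schmidt process *)

Section GramSchmidt.
Variables (R : realType) (n : nat) (M : smoothManifold R n) (r : nat).
Variable S : subLorentzian M r.

Lemma dim_distr q : \dim (distr S q) = r.
Proof.
have [W [X [oW Wq _ /(_ _ Wq) bX]]] := distr_smooth S q.
exact: size_basis bX.
Qed.

Section Pointwise.
Variable q : M.
Local Notation g := (metric S q).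
Local Notation D := (distr S q).

Let gsym v w : v \in D -> w \in D -> g v w = g w v.
Proof. exact: (metric_bilinear S q).1. Qed.

Lemma metricDl u v w : u \in D -> v \in D -> w \in D -> g (u + v) w = g u w + g v w.
Proof.
move=> uD vD wD; have := (metric_bilinear S q).2 1 u v w uD vD wD.
by rewrite scale1r mul1r.
Qed.

Lemma metricZl k u w : u \in D -> w \in D -> g (k *: u) w = k * g u w.
Proof.
move=> uD wD; have := (metric_bilinear S q).2 k u 0 w uD (mem0v _) wD.
by rewrite addr0 (bilinear0l (metric_bilinear S q) wD) addr0.
Qed.

Lemma metricDr u v w : u \in D -> v \in D -> w \in D -> g w (u + v) = g w u + g w v.
Proof.
by move=> uD vD wD; rewrite gsym ?rpredD// metricDl// !(gsym wD).
Qed.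

Lemma metricZr k u w : u \in D -> w \in D -> g w (k *: u) = k * g w u.
Proof. by move=> uD wD; rewrite gsym ?memvZ// metricZl// (gsym wD). Qed.

(** Otherwise [e] and [u] would span a negative definite plane, and the index is 1. *)
Lemma timelike_complement_nonneg e u : e \in D -> g e e = -1 -> u \in D -> g u e = 0 ->
  0 <= g u u.
Proof.
move=> eD ee uD ue; rewrite leNgt; apply/negP => uu.
have [_ Hdim] := metric_index S q.
pose V := (<[e]> + <[u]>)%VS.
have VD : (V <= D)%VS by rewrite subv_add -!memvE eD.
have gcomb k l : g (k *: e + l *: u) (k *: e + l *: u) = - k ^+ 2 + l ^+ 2 * g u u.
  rewrite metricDl ?rpredD ?memvZ// !metricDr ?memvZ// !metricZl ?memvZ// !metricZr//.
  by rewrite ee ue (gsym eD uD) ue; ring.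
have Vneg : negative_definite_on g V.
  move=> v /memv_addP[_ /vlineP[k ->] [_ /vlineP[l ->] ->]] v0.
  rewrite gcomb.
  have k2 := sqr_ge0 k; have l2 := sqr_ge0 l.
  have : l ^+ 2 * g u u <= 0 by rewrite mulr_ge0_le0// ltW.
  have [l0|l0] := eqVneq l 0.
    have k0 : k != 0 by apply: contraNneq v0 => ->; rewrite l0 !scale0r addr0.
    have : 0 < k ^+ 2 by rewrite lt_def sqrf_eq0 k0.
    by lra.
  have : 0 < l ^+ 2 by rewrite lt_def sqrf_eq0 l0.
  move=> l2'; have : l ^+ 2 * g u u < 0 by rewrite pmulr_rlt0.
  by lra.
have := Hdim V VD Vneg.
rewrite dimv_disjoint_sum.
  rewrite !dim_vline.
  have -> : e != 0.
    by apply/eqP => e0; move: ee; rewrite e0 (bilinear0l (metric_bilinear S q) (mem0v _)); lra.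
  have -> : u != 0.
    by apply/eqP => u0; move: uu; rewrite u0 (bilinear0l (metric_bilinear S q) (mem0v _)); lra.
  by [].
apply/eqP; rewrite -subv0; apply/subvP => v; rewrite memv_cap.
move=> /andP[/vlineP[k ->] /vlineP[l E]].
have : g (k *: e) e = g (l *: u) e by rewrite E.
rewrite !metricZl// ee ue mulr0 mulrN1 => /eqP; rewrite oppr_eq0 => /eqP ->.
by rewrite scale0r mem0v.
Qed.

(** If [u] were null, nondegeneracy would give a [w] with [g u w != 0], and its projection [w']
    orthogonal to [e] has the same product with [u]. The number [t] is chosen to give [t *: u + w']
    the square [-1], against [timelike_complement_nonneg]. *)
Lemma timelike_complement_pos e u : e \in D -> g e e = -1 -> u \in D -> g u e = 0 ->
  u != 0 -> 0 < g u u.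
Proof.
move=> eD ee uD ue u0; rewrite lt_def (timelike_complement_nonneg eD ee uD ue) andbT.
apply/eqP => uu; move/eqP: u0; apply.
apply: (metric_nondegenerate uD) => w wD; apply: contrapT => /eqP uw.
have [w' [w'D w'e uw']] : exists w', [/\ w' \in D, g w' e = 0 & g u w' = g u w].
  exists (w + g w e *: e); split; first by rewrite rpredD ?memvZ.
    by rewrite metricDl ?memvZ// metricZl// ee; ring.
  by rewrite metricDr ?memvZ// metricZr// ue mulr0 addr0.
pose t := - (g w' w' + 1) / (2 * g u w).
pose y := t *: u + w'.
have yD : y \in D by rewrite rpredD ?memvZ.
have ye : g y e = 0 by rewrite /y metricDl ?memvZ// metricZl// ue w'e mulr0 addr0.
have := timelike_complement_nonneg eD ee yD ye.
have -> : g y y = 2 * t * g u w + g w' w'.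
  rewrite /y metricDl ?memvZ// !metricDr ?memvZ// !metricZl ?memvZ// !metricZr//.
  by rewrite uu (gsym w'D uD) uw'; ring.
have -> : 2 * t * g u w = - (g w' w' + 1) by rewrite /t; field.
by lra.
Qed.

End Pointwise.
End GramSchmidt.

Section FrameExistence.
Variables (R : realType) (n : nat) (M : smoothManifold R n) (r : nat).
Variable S : subLorentzian M r.

Let sgn (i : nat) : R := if i == 0%N then -1 else 1.

Let sgn_sqr i : sgn i * sgn i = 1.
Proof. by rewrite /sgn; case: ifP => _; ring. Qed.

(** Indices are natural numbers so that [k] can grow during the induction; from [k] on the fields
    are arbitrary smooth sections. *)
Definition partial_frame (k : nat) (W : set M) (E : nat -> M -> 'rV[R]_n) : Prop :=
  [/\ open W, forall i, smooth_field W (E i),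
      forall i q, W q -> E i q \in distr S q &
      forall i j q, (i < k)%N -> (j < k)%N -> W q ->
        metric S q (E i q) (E j q) = if i == j then sgn i else 0].

(** The sign condition at [q0] persists nearby, and on that smaller set dividing by the square root
    is smooth. *)
Lemma partial_frame_normalize k W E V q0 : partial_frame k W E -> W q0 ->
  smooth_field W V -> (forall q, W q -> V q \in distr S q) ->
  (forall i q, (i < k)%N -> W q -> metric S q (V q) (E i q) = 0) ->
  0 < sgn k * metric S q0 (V q0) (V q0) ->
  exists W' E', partial_frame k.+1 W' E' /\ W' q0.
Proof.
move=> [oW sE ED Eon] Wq0 sV VD VE V0.
have sf : smooth_function W (fun q => sgn k * metric S q (V q) (V q)).
  apply: smooth_function_mul => //; first exact: smooth_function_cst.
  exact: metric_smooth.
have [W' [oW' W'q0 sW' W'pos]] := smooth_function_pos_near oW Wq0 sf V0.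
pose N q := (Num.sqrt (sgn k * metric S q (V q) (V q)))^-1.
have sN : smooth_function W' N.
  apply: smooth_function_rsqrt => //.
  by move=> c j; apply: Ck_subset (sf c j) => _ [q [W'q dq] <-]; exists q => //; split => //; exact: sW'.
have sNV : smooth_field W' (fun q => N q *: V q).
  by apply: smooth_field_scale => //; exact: smooth_field_subset sV.
exists W', (fun i => if i == k then (fun q => N q *: V q) else E i); split => //; split => //.
- by move=> i; case: eqP => // _; exact: smooth_field_subset (sE i).
- move=> i q /sW' Wq; case: eqP => _; last exact: ED.
  by apply: memvZ; exact: VD.
have NVE i q : (i < k)%N -> W' q -> metric S q (N q *: V q) (E i q) = 0.
  move=> ik W'q; have Wq := sW' q W'q.
  by rewrite (metricZl _ (VD q Wq) (ED i q Wq)) VE// mulr0.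
move=> i j q; rewrite !ltnS => ik jk W'q; have Wq := sW' q W'q.
have [Ei|iNk] := eqVneq i k; have [Ej|jNk] := eqVneq j k.
- rewrite Ei Ej eqxx (metricZl _ (VD q Wq)) ?memvZ ?VD// (metricZr _ (VD q Wq) (VD q Wq)).
  set s := metric S q (V q) (V q).
  have s0 : 0 < sgn k * s by exact: W'pos.
  pose u := Num.sqrt (sgn k * s).
  have u0 : u != 0 by rewrite gt_eqF// sqrtr_gt0.
  have uu : u * u = sgn k * s by rewrite -expr2 sqr_sqrtr// ltW.
  have -> : N q = u^-1 by [].
  have -> : s = sgn k * (u * u) by rewrite uu mulrA sgn_sqr mul1r.
  by field.
- have jk' : (j < k)%N by rewrite ltn_neqAle jNk.
  by rewrite NVE// Ei eq_sym (negPf jNk).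
- have ik' : (i < k)%N by rewrite ltn_neqAle iNk.
  have [gs _] := metric_bilinear S q.
  by rewrite gs ?memvZ ?ED ?VD// NVE// Ej (negPf iNk).
- apply: Eon => //; by rewrite ltn_neqAle ?iNk ?jNk.
Qed.

(** For [k > 0] the dimension provides a basis field [Z i] outside the span of the first [k] vectors
    at [q0]. Its projection [V] is nonzero there and orthogonal to the timelike [E 0], hence
    spacelike. *)
Lemma partial_frame_exists q0 k : (k <= r)%N -> exists W E, partial_frame k W E /\ W q0.
Proof.
have [W0 [Z [oW0 W0q0 sZ bZ]]] := distr_smooth S q0.
have ZD i q : W0 q -> Z i q \in distr S q.
  move=> Wq; apply: (basis_mem (bZ q Wq)).
  by apply/tnthP; exists i; rewrite tnth_mktuple.
elim: k => [_|k IH kr].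
  exists W0, (fun _ _ => 0); split => //; split => //.
  - move=> _; have <- : (fun q => \sum_(i <- [::]) Z i q) = (fun=> 0).
      by apply/funext => q; rewrite big_nil.
    exact: smooth_field_sum.
  - by move=> i q _; exact: mem0v.
have [W [E [[oW sE ED Eon] Wq0]]] := IH (ltnW kr).
pose W1 := W `&` W0.
have oW1 : open W1 by exact: openI.
have W1q0 : W1 q0 by [].
have fr1 : partial_frame k W1 E.
  split => //.
  - by move=> i; apply: smooth_field_subset (sE i) => q [].
  - by move=> i q [Wq _]; exact: ED.
  - by move=> i j q ik jk [Wq _]; exact: Eon.
have [_ sE1 ED1 Eon1] := fr1.
have sZ1 i : smooth_field W1 (Z i) by apply: smooth_field_subset (sZ i) => q [].
have ZD1 i q : W1 q -> Z i q \in distr S q by move=> [_ ?]; exact: ZD.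
(* The first field is timelike: a negative vector at [q0], provided by the index, is extended with
   constant coefficients in the local basis. *)
have [k0|k_gt0] := posnP k.
  have [[V [VD Vneg dimV]] _] := metric_index S q0.
  have v0 : vpick V != 0 by rewrite vpick0 -dimv_eq0 dimV.
  have vV := memv_pick V; have vneg := Vneg _ vV v0.
  have vD : vpick V \in <<[tuple Z i q0 | i < r]>>%VS.
    by rewrite (span_basis (bZ q0 W0q0)); exact: (subvP VD).
  pose v q := \sum_i coord [tuple Z i q0 | i < r] i (vpick V) *: Z i q.
  have vE : v q0 = vpick V.
    rewrite [RHS](coord_span vD); apply: eq_bigr => i _.
    by rewrite nth_mktuple.
  apply: (@partial_frame_normalize k W1 E v q0 fr1 W1q0).
  - apply: smooth_field_sum => // i; apply: smooth_field_scale => //.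
    exact: smooth_function_cst.
  - by move=> q Wq; apply: memv_suml => i _; apply: memvZ; exact: ZD1.
  - by rewrite k0.
  - by rewrite vE k0 /sgn eqxx mulN1r oppr_gt0.
have [i iN] : exists i, Z i q0 \notin <<[seq E j q0 | j <- iota 0 k]>>%VS.
  apply: contrapT => H.
  have sub : (distr S q0 <= <<[seq E j q0 | j <- iota 0 k]>>)%VS.
    rewrite -(span_basis (bZ q0 W0q0)); apply/span_subvP => _ /mapP[i _ ->].
    by apply: contrapT => /negP nin; apply: H; exists i.
  have := dimvS sub; rewrite (dim_distr S q0) => rd.
  have := leq_trans rd (dim_span _); rewrite size_map size_iota.
  by rewrite leqNgt kr.
pose V q := Z i q + \sum_(j < k) (- sgn j * metric S q (Z i q) (E j q)) *: E j q.
have VD q : W1 q -> V q \in distr S q.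
  move=> Wq; apply: rpredD; first exact: ZD1.
  by apply: memv_suml => j _; apply: memvZ; exact: ED1.
have VE j q : (j < k)%N -> W1 q -> metric S q (V q) (E j q) = 0.
  move=> jk Wq; rewrite metricDl ?ZD1 ?ED1//; last first.
    by apply: memv_suml => l _; apply: memvZ; exact: ED1.
  rewrite (bilinear_suml (metric_bilinear S q))//; first last.
  - exact: ED1.
  - by move=> l; exact: ED1.
  rewrite (bigD1 (Ordinal jk))//= big1 ?addr0; last first.
    move=> l lj; rewrite Eon1//; case: eqP => [lj'|_]; last by rewrite mulr0.
    by move/eqP: lj; case; exact/val_inj.
  rewrite Eon1// eqxx /=; set G := metric _ _ _ _.
  transitivity (G * (1 - sgn j * sgn j)); first by ring.
  by rewrite sgn_sqr subrr mulr0.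
apply: (@partial_frame_normalize k W1 E V q0 fr1 W1q0) => //.
- apply: smooth_field_add => //; apply: smooth_field_sum => // j.
  apply: smooth_field_scale => //; apply: smooth_function_mul => //.
    exact: smooth_function_cst.
  exact: (metric_smooth oW1 (sZ1 i) (sE1 j) (ZD1 i) (ED1 j)).
have sk : sgn k = 1 by rewrite /sgn -leqn0 leqNgt k_gt0.
rewrite sk mul1r; apply: (@timelike_complement_pos _ _ _ _ S q0 (E 0%N q0)).
- exact: ED1.
- by rewrite Eon1.
- exact: VD.
- exact: VE.
apply/eqP => V0; move/negP: iN; apply.
have -> : Z i q0 = - \sum_(j < k) (- sgn j * metric S q0 (Z i q0) (E j q0)) *: E j q0.
  by apply/eqP; rewrite -addr_eq0; apply/eqP.
rewrite rpredN; apply: memv_suml => j _; apply: memvZ; apply: memv_span.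
by apply/mapP; exists (j : nat) => //; rewrite mem_iota /= add0n.
Qed.

Lemma orthonormal_frame_exists q0 :
  exists W X, orthonormal_frame S W X /\ W q0.
Proof.
have [W [E [[oW sE ED Eon] Wq0]]] := partial_frame_exists q0 (leqnn r).
exists W, (fun i => E (val i)); split => //; split => //.
  by move=> i q; exact: ED.
by move=> i j q Wq; exact: (Eon _ _ _ (ltn_ord i) (ltn_ord j) Wq).
Qed.

Lemma hamiltonian_frameE W (X : 'I_r -> M -> 'rV[R]_n) q l :
  orthonormal_frame S W X -> W q ->
  hamiltonian S q l = frame_hamiltonian (fun i => X i q) l.
Proof.
move=> fX Wq; rewrite /hamiltonian.
case: xgetP => [y _ [W' [X' [W'q fX' ->]]]|/(_ (frame_hamiltonian (fun i => X i q) l))].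
  rewrite /frame_hamiltonian; congr (_ * _).
  have [_ _ XD Xon] := fX; have [_ _ XD' Xon'] := fX'.
  apply: (hamiltonian_frame_indep l (metric_bilinear S q) (metric_nondegenerate (p := q)) (dim_distr S q)).
  - by move=> i; exact: XD'.
  - by move=> i; exact: XD.
  - by move=> i j; exact: Xon'.
  - by move=> i j; exact: Xon.
by move=> H; exfalso; apply: H; exists W, X; split.
Qed.

End FrameExistence.

(** * Extremals and their competitors in a chart *)

Section HamiltonianDerivative.
Variables (R : realType) (n r : nat) (Y : 'I_r -> 'rV[R]_n -> 'rV[R]_n).
Variables (A : set 'rV[R]_n).
Hypotheses (oA : open A) (SY : forall i, smooth_on A (Y i)).

(** One derivative along a line in phase space serves for both of Hamilton's equations: [y = 0]
    gives the velocity and [d = 0] the force. *)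
Lemma is_derive_ham (x y : 'rV[R]_n) (p d : 'cV[R]_n) : A x ->
  is_derive (0 : R) 1 (fun u : R => ham Y (u *: y + x) (p + u *: d) : R^o)
    (pairing d (ham_velocity Y x p) - pairing (ham_force Y x p) y).
Proof.
move=> Ax; have [rho [C [rho0 C0 _ _ HE]]] := ham_expansion oA Ax SY.
have [K K0 HK] := HE (`|p|) 1 (normr_ge0 _) ler01.
apply: is_derive_eps => e e0.
pose X := `|y| + `|d| + 1.
have yX : `|y| <= X by rewrite /X -addrA lerDl addr_ge0.
have dX : `|d| <= X by rewrite /X addrAC lerDr addr_ge0.
have X0 : 0 < X by rewrite /X ltr_wpDl// addr_ge0.
have KX : 0 <= K * X ^+ 2 by rewrite mulr_ge0// exprn_ge0// ltW.
exists (Num.min (Num.min X^-1 (rho / X)) (e / (K * X ^+ 2 + 1))).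
  by rewrite !lt_min invr_gt0 X0 !divr_gt0// ltr_wpDl.
move=> u; rewrite subr0 !lt_min => /andP[/andP[u1 u2] u3].
have t1 : `|u| * X <= 1 by rewrite -ler_pdivlMr// div1r ltW.
have trho : `|u| * X < rho by rewrite -ltr_pdivlMr.
have zt : `|u *: y + x - x| <= `|u| * X by rewrite addrK normrZ ler_wpM2l.
have dt : `|u *: d| <= 1 * (`|u| * X) by rewrite mul1r normrZ ler_wpM2l.
have := HK x (u *: y + x) p (u *: d) (`|u| * X) _ (le_lt_trans zt trho) zt t1 (lexx _) dt.
rewrite subrr normr0 => /(_ rho0); rewrite addrK scale0r add0r scale0r addr0.
rewrite pairingZl pairingZ -(mulrBr u) => H.
apply: le_trans H _.
have -> : K * (`|u| * X) ^+ 2 = K * X ^+ 2 * `|u| * `|u| by ring.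
rewrite ler_wpM2r//; apply: (@le_trans _ _ ((K * X ^+ 2 + 1) * `|u|)).
  by rewrite ler_wpM2r// lerDl.
by rewrite mulrC -ler_pdivlMr ?ltW// ltr_wpDl.
Qed.

End HamiltonianDerivative.

Section HamiltonEquations.
Variables (R : realType) (n : nat) (M : smoothManifold R n) (r : nat).
Variables (S : subLorentzian M r) (W : set M) (X : 'I_r -> M -> 'rV[R]_n).
Hypothesis frame : orthonormal_frame S W X.
Variable c : chart M.
Let A : set 'rV[R]_n := phi M c @` (W `&` dom M c).
Let Y i := field_coord c (X i).

Let oA : open A.
Proof. by have [oW _ _ _] := frame; exact: chart_image_open. Qed.

Let SY i : smooth_on A (Y i).
Proof. by have [_ sX _ _] := frame; exact: sX. Qed.

Lemma hamiltonian_coordE y xi : A y -> hamiltonian_coord S c y xi = ham Y y xi.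
Proof.
move=> [q [Wq dq] <-]; rewrite /hamiltonian_coord phiK// (hamiltonian_frameE _ frame)//.
rewrite /ham /frame_hamiltonian; congr (_ * _); apply: eq_bigr => i _.
by rewrite /pairing /Y /field_coord phiK// mulmxA.
Qed.

Lemma hamiltonian_velocityE y xi : A y ->
  \row_i 'D_(delta_mx i 0) (hamiltonian_coord S c y : _ -> R^o) xi = ham_velocity Y y xi.
Proof.
move=> Ay; have -> : hamiltonian_coord S c y = ham Y y.
  by apply/funext => l; exact: hamiltonian_coordE.
apply/rowP => i; rewrite mxE -[xi in LHS]add0r -(scale0r (delta_mx i 0)) -derive_line.
have -> : (fun u : R => ham Y y (u *: delta_mx i 0 + xi)) =
    (fun u => ham Y (u *: 0 + y) (xi + u *: delta_mx i 0)).
  by apply/funext => u; rewrite scaler0 add0r addrC.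
rewrite (@derive_val _ _ _ _ _ _ _ (is_derive_ham oA SY 0 xi (delta_mx i 0) Ay)).
rewrite /pairing mul0mx [X in _ - X]mxE subr0 -colE.
by rewrite mxE.
Qed.

Lemma hamiltonian_forceE y xi : A y ->
  - \col_i 'D_(delta_mx 0 i) ((fun z => hamiltonian_coord S c z xi) : _ -> R^o) y =
  ham_force Y y xi.
Proof.
move=> Ay; apply/colP => i; rewrite mxE mxE.
have -> : 'D_(delta_mx 0 i) ((fun z => hamiltonian_coord S c z xi) : _ -> R^o) y =
    'D_(delta_mx 0 i) ((fun z => ham Y z xi) : _ -> R^o) y.
  have nA : nbhs y A by exact: open_nbhs_nbhs.
  apply: near_eq_derive.
  by apply: filterS nA => z Az; exact: hamiltonian_coordE.
rewrite -[y in LHS]add0r -(scale0r (delta_mx 0 i)) -derive_line.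
have -> : (fun u : R => ham Y (u *: delta_mx 0 i + y) xi) =
    (fun u => ham Y (u *: delta_mx 0 i + y) (xi + u *: 0)).
  by apply/funext => u; rewrite scaler0 addr0.
rewrite (@derive_val _ _ _ _ _ _ _ (is_derive_ham oA SY (delta_mx 0 i) xi 0 Ay)).
rewrite /pairing mulmx0 [X in X - _]mxE sub0r opprK.
by rewrite -rowE mxE.
Qed.

End HamiltonEquations.

(** For orthogonal vectors the product of the time components would equal the spatial product, which
    Cauchy-Schwarz makes strictly smaller for timelike vectors. *)
Lemma lorentz_form_neq0 (R : realType) (r : nat) (a b : 'I_r -> R) :
  lorentz_form a a < 0 -> lorentz_form b b < 0 -> lorentz_form a b != 0.
Proof.
case: r a b => [|r] a b; first by rewrite /lorentz_form big_ord0 ltxx.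
rewrite !lorentz_form_recl => aa bb; apply/eqP => /eqP; rewrite subr_eq0 => /eqP ab.
have := cauchy_schwarz_sum (fun i => a (lift ord0 i)) (fun i => b (lift ord0 i)).
rewrite ab exprMn leNgt => /negP; apply.
have ge0 (f : 'I_r -> R) : 0 <= \sum_i f i ^+ 2 by apply: sumr_ge0 => i _; exact: sqr_ge0.
apply: ltr_pM => //; rewrite -subr_lt0.
- by apply: le_lt_trans aa; rewrite expr2 lerD2r; apply: ler_sum => i _; rewrite expr2.
- by apply: le_lt_trans bb; rewrite expr2 lerD2r; apply: ler_sum => i _; rewrite expr2.
Qed.

Section FrameCoordinates.
Variables (R : realType) (n : nat) (M : smoothManifold R n) (r : nat).
Variables (S : subLorentzian M r) (W : set M) (X : 'I_r -> M -> 'rV[R]_n).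
Hypothesis frame : orthonormal_frame S W X.
Variables (c : chart M) (q : M).
Hypotheses (Wq : W q) (dq : dom M c q).
Let Y i := field_coord c (X i).

Let XD i : X i q \in distr S q.
Proof. by have [_ _ XD _] := frame; exact: XD. Qed.

Let Xon i j : metric S q (X i q) (X j q) = if i == j then frame_sign R i else 0.
Proof. by have [_ _ _ Xon] := frame; exact: Xon. Qed.

Let YE i : Y i (phi M c q) = X i q *m coord_change c q.
Proof. by rewrite /Y /field_coord phiK. Qed.

Lemma frame_coord v : v \in distr S q -> exists a : 'I_r -> R,
  [/\ v = \sum_i a i *: X i q & v *m coord_change c q = \sum_i a i *: Y i (phi M c q)].
Proof.
move=> vD; have [a ->] := frame_span (metric_bilinear S q) XD Xon (dim_distr S q) vD.
exists a; split => //; rewrite mulmx_suml; apply: eq_bigr => i _.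
by rewrite YE scalemxAl.
Qed.

Lemma timelike_metric_neq0 v w : timelike S q v -> timelike S q w -> metric S q v w != 0.
Proof.
move=> [vD vv] [wD ww]; have [a [vE _]] := frame_coord vD; have [b [wE _]] := frame_coord wD.
move: vv ww; rewrite vE wE !(metric_frame (metric_bilinear S q) XD Xon).
exact: lorentz_form_neq0.
Qed.

Lemma future_directed_causal_vector T v : timelike S q (T q) -> future_directed S T q v ->
  causal_vector (fun i => Y i (phi M c q)) (field_coord c T (phi M c q))
    (v *m coord_change c q) (Num.sqrt `|metric S q v v|).
Proof.
move=> [TD TT] [[vD vv] vT]; have [a [vE vYE]] := frame_coord vD.
have [b [TE TYE]] := frame_coord TD.
have mf := metric_frame (metric_bilinear S q) XD Xon.
exists a, b; split.
- by split; [exact: vYE|rewrite /field_coord phiK].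
- by rewrite -mf -TE.
- by rewrite -mf -vE.
- by rewrite -mf -vE -TE.
- by rewrite -mf -vE ler0_norm.
Qed.

Lemma ham_velocity_vector xi v : v *m coord_change c q = ham_velocity Y (phi M c q) xi ->
  [/\ v \in distr S q, metric S q v v = 2 * ham Y (phi M c q) xi &
      forall w, w \in distr S q -> metric S q v w = pairing xi (w *m coord_change c q)].
Proof.
move=> vE; pose a i := frame_sign R i * pairing xi (Y i (phi M c q)).
have vX : v = \sum_i a i *: X i q.
  rewrite -[v](mulmxK (coord_change_unit dq)) vE -[RHS](mulmxK (coord_change_unit dq)).
  congr (_ *m _); rewrite mulmx_suml; apply: eq_bigr => i _.
  by rewrite -scalemxAl -YE.
have vw w : w \in distr S q -> metric S q v w = pairing xi (w *m coord_change c q).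
  move=> wD; have [b [wE ->]] := frame_coord wD.
  rewrite vX wE (metric_frame (metric_bilinear S q) XD Xon) pairing_sum.
  apply: eq_bigr => i _; rewrite /a pairingZ mulrA frame_sign_sqr mul1r mulrC.
  by [].
have vD : v \in distr S q by rewrite vX; apply: memv_suml => i _; exact: memvZ.
by split => //; rewrite vw// vE pairing_ham_velocity.
Qed.

End FrameCoordinates.

Lemma within_continuous_near (R : realType) (T : topologicalType) (a b t : R) (f : R -> T)
    (O : set T) :
  {within [set` `[a, b]], continuous f} -> a <= t <= b -> nbhs (f t) O ->
  exists2 d, 0 < d & forall s, a <= s <= b -> `|s - t| < d -> O (f s).
Proof.
move=> /subspace_continuousP cf tab fO.
have : within [set` `[a, b]] (nbhs t) (f @^-1` O).
  by apply: (cf t _ _ fO); rewrite /= in_itv.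
move=> [d /= d0 Hd]; exists d => // s sab st.
by apply: Hd; rewrite /= ?in_itv//= distrC.
Qed.

Lemma within_continuous_interior (R : realType) (T : topologicalType) (a b s : R) (f : R -> T) :
  {within [set` `[a, b]], continuous f} -> a < s < b -> {for s, continuous f}.
Proof.
move=> cf /andP[as_ sb] O fO.
have sab : a <= s <= b by rewrite !ltW.
have [d d0 Hd] := within_continuous_near cf sab fO.
exists (Num.min d (Num.min (s - a) (b - s))) => /=.
  by rewrite !lt_min d0 !subr_gt0 as_.
move=> u /=; rewrite distrC !lt_min => /andP[ud /andP[ua ub]].
by apply: Hd => //; move: ua ub; rewrite !ltr_norml; lra.
Qed.

Lemma pairing_gt0_near (R : realType) (n : nat) (l0 : 'cV[R]_n) (v0 : 'rV[R]_n) :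
  0 < pairing l0 v0 ->
  exists2 e, 0 < e & forall l v, `|l - l0| < e -> `|v - v0| < e -> 0 < pairing l v.
Proof.
set P := pairing l0 v0 => P0; pose C := n%:R * (`|l0| + `|v0| + 1) + 1.
have C0 : 0 < C by rewrite ltr_wpDl// mulr_ge0// !addr_ge0.
exists (Num.min 1 (P / C)); first by rewrite lt_min ltr01 divr_gt0.
move=> l v; rewrite !lt_min => /andP[l1 lP] /andP[v1 vP].
have -> : pairing l v = pairing (l - l0) v + (pairing l0 (v - v0) + P).
  by rewrite /P -pairingDr subrK -pairingDl subrK.
have vB : `|v| <= `|v0| + 1.
  have := ler_normD (v - v0) v0; rewrite subrK => /le_trans; apply.
  by rewrite addrC lerD2l ltW.
have H1 : `|pairing (l - l0) v| <= n%:R * (P / C) * (`|v0| + 1).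
  apply: le_trans (le_pairing _ _) _; apply: ler_pM; rewrite ?mulr_ge0//.
  by rewrite ler_wpM2l// ltW.
have H2 : `|pairing l0 (v - v0)| <= n%:R * `|l0| * (P / C).
  by apply: le_trans (le_pairing _ _) _; rewrite ler_wpM2l ?mulr_ge0// ltW.
have H3 : n%:R * (P / C) * (`|v0| + 1) + n%:R * `|l0| * (P / C) < P.
  have -> : n%:R * (P / C) * (`|v0| + 1) + n%:R * `|l0| * (P / C) = (C - 1) / C * P.
    by rewrite /C; ring.
  by rewrite gtr_pMl// ltr_pdivrMr// mul1r gtrDl oppr_lt0.
move: H1 H2 H3; rewrite !ler_norml.
set u1 := pairing _ _; set u2 := pairing _ _; set k1 := _ * (_ + 1); set k2 := _ * (P / C).
by lra.
Qed.

Section ExtremalInFrame.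
Variables (R : realType) (n : nat) (M : smoothManifold R n) (r : nat).
Variables (S : subLorentzian M r) (W : set M) (X : 'I_r -> M -> 'rV[R]_n).
Hypothesis frame : orthonormal_frame S W X.
Variable c : chart M.
Let Y i := field_coord c (X i).
Local Notation mu := (@lebesgue_measure R).

Lemma competitor_causal (T : M -> 'rV[R]_n) (eta : curve R M) :
  time_orientation S T -> absolutely_continuous_curve eta ->
  tangents_ae (future_directed S T) eta ->
  (forall s, s \in `[cleft eta, cright eta] -> W (cmap eta s) /\ dom M c (cmap eta s)) ->
  {ae mu, forall s, s \in `]cleft eta, cright eta[ ->
    derivable (phi M c \o cmap eta) s 1 /\
    causal_vector (fun i => Y i ((phi M c \o cmap eta) s))
      (field_coord c T ((phi M c \o cmap eta) s)) (derive1 (phi M c \o cmap eta) s)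
      (Num.sqrt `|metric S (cmap eta s) (velocity eta s) (velocity eta s)|)}.
Proof.
move=> [_ TT] [_ ceta _] fd etaW; have FF := ae_filter_ringOfSetsType mu.
move: fd; apply: filterS => s Hs sab.
have scc : s \in `[cleft eta, cright eta] by exact: subset_itv_oo_cc sab.
have fd := Hs scc; have [Ws ds] := etaW s scc.
have cs : {for s, continuous (cmap eta)}.
  by apply: (within_continuous_interior ceta); move: sab; rewrite in_itv.
(* A future directed vector has a nonzero product with the time orientation, and a nonzero velocity
   is a genuine derivative. *)
have v0 : velocity eta s != 0.
  apply/eqP => v0; have [_] := fd; rewrite v0.
  by rewrite (bilinear0l (metric_bilinear S _) (TT _).1) ltxx.
have D := velocity_chart cs ds v0.
split; first exact: (@ex_derive _ _ _ _ _ _ _ D).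
rewrite derive1E (@derive_val _ _ _ _ _ _ _ D).
exact: (future_directed_causal_vector frame Ws ds (TT _) fd).
Qed.

Variables (a b : R) (gamma : R -> M) (l : R -> 'cV[R]_n).
Hypothesis hsol : hamiltonian_solution S a b gamma l.
Let x := phi M c \o gamma.
Let p s := covector_coord c (gamma s) (l s).

Lemma extremal_hamilton_at s : a <= s <= b -> W (gamma s) -> dom M c (gamma s) ->
  hamilton_at Y a b x p s.
Proof.
move=> sab Ws ds; have As : (phi M c @` (W `&` dom M c)) (x s) by exists (gamma s).
have [|Dx Dp] := hsol.2 c s _ ds; first by rewrite in_itv.
split; first by rewrite -(hamiltonian_velocityE frame (p s) As); exact: Dx.
by rewrite -(hamiltonian_forceE frame (p s) As); exact: Dp.
Qed.

Lemma extremal_velocity s : a < s < b -> W (gamma s) -> dom M c (gamma s) ->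
  let v := velocity (Curve a b gamma) s in
  [/\ v \in distr S (gamma s), metric S (gamma s) v v = 2 * ham Y (x s) (p s) &
      forall w, w \in distr S (gamma s) ->
        metric S (gamma s) v w = pairing (p s) (w *m coord_change c (gamma s))].
Proof.
move=> sab Ws ds v; apply: (ham_velocity_vector frame Ws ds).
have cs : {for s, continuous gamma} by exact: within_continuous_interior hsol.1 sab.
have sab' : a <= s <= b by case/andP: sab => ? ?; rewrite !ltW.
have [Dx _] := extremal_hamilton_at sab' Ws ds.
exact: (chart_velocity (eta := Curve a b gamma) cs ds (has_derivative_within_interior sab Dx)).
Qed.

End ExtremalInFrame.

Lemma ae_near_exists (R : realType) (a b t d : R) (P : R -> Prop) :
  a < b -> a <= t <= b -> 0 < d ->
  {ae @lebesgue_measure R, forall s, s \in `[a, b] -> P s} ->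
  exists s, [/\ a < s < b, `|s - t| < d & P s].
Proof.
move=> ab /andP[at_ tb] d0 H.
pose u := Num.max a (t - d); pose v := Num.min b (t + d).
have uv : u < v.
  by rewrite /u /v gt_max !lt_min ab; apply/andP; split; [|apply/andP; split]; lra.
have [|s] := @ae_itv_exists _ u v P uv.
  have FF := ae_filter_ringOfSetsType (@lebesgue_measure R).
  move: H; apply: filterS => s Hs; rewrite in_itv /= gt_max lt_min.
  move=> /andP[/andP[as_ _] /andP[sb _]]; apply: Hs; rewrite in_itv /=.
  by rewrite !ltW.
rewrite in_itv /= gt_max lt_min => /andP[/andP[as_ su] /andP[sb sv]] Ps.
by exists s; split => //; [rewrite as_ | rewrite ltr_norml; lra].
Qed.

(** * Signs of the covector at the given time *)

Section ExtremalInitialCovector.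
Variables (R : realType) (n : nat) (M : smoothManifold R n) (r : nat).
Variables (S : subLorentzian M r) (W : set M) (E : 'I_r -> M -> 'rV[R]_n).
Hypothesis frame : orthonormal_frame S W E.
Variables (c : chart M) (X : M -> 'rV[R]_n) (a b : R) (gamma : R -> M) (l : R -> 'cV[R]_n).
Hypotheses (hX : time_orientation S X) (ab : a < b).
Hypothesis hsol : hamiltonian_solution S a b gamma l.
Hypothesis timelike_gamma : tangents_ae (timelike S) (Curve a b gamma).
Hypothesis future_gamma : tangents_ae (future_directed S X) (Curve a b gamma).
Variables (t : R) (e0 : R).
Hypotheses (tab : a <= t <= b) (e00 : 0 < e0).
Hypothesis near_t : forall s, a <= s <= b -> `|s - t| < e0 -> W (gamma s) /\ dom M c (gamma s).

Let Y i := field_coord c (E i).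
Let x := phi M c \o gamma.
Let p s := covector_coord c (gamma s) (l s).
Let tt : `|t - t| < e0. Proof. by rewrite subrr normr0. Qed.

(** Being timelike is known only almost everywhere, possibly not at [t]; it is used at a nearby
    interior time and carried to [t] by conservation of the Hamiltonian. *)
Lemma extremal_ham_lt0 : ham Y (x t) (p t) < 0.
Proof.
have e20 : 0 < e0 / 2 by rewrite divr_gt0.
have [s [sab st [vD vv]]] := ae_near_exists ab tab e20 timelike_gamma.
have sab' : a <= s <= b by case/andP: sab => ? ?; rewrite !ltW.
have st' : `|s - t| < e0 by apply: lt_trans st _; rewrite ltr_pdivrMr//; lra.
have [Ws ds] := near_t sab' st'.
have [_ vE _] := extremal_velocity frame hsol sab Ws ds.
have oA : open (phi M c @` (W `&` dom M c)).
  by have [oW _ _ _] := frame; exact: chart_image_open.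
have SY i : smooth_on (phi M c @` (W `&` dom M c)) (Y i).
  by have [_ sX _ _] := frame; exact: sX.
have <- : ham Y (x s) (p s) = ham Y (x t) (p t).
  apply: (ham_conserved_near oA SY tab (eps := e0 / 2) _ sab' (ltW st)) => u uab ut.
  have ut' : `|u - t| < e0 by apply: le_lt_trans ut _; rewrite ltr_pdivrMr//; lra.
  have [Wu du] := near_t uab ut'.
  split; first by exists (gamma u).
  exact: (extremal_hamilton_at frame hsol uab Wu du).
by move: vv; rewrite /= vE pmulr_rlt0.
Qed.

(** The pairing is the product of the time orientation with the dual of [p t], two timelike vectors,
    so it is not zero. If it were positive, it would be so at nearby times, almost all of which have
    a future directed velocity. *)
Lemma extremal_pairing_lt0 : pairing (p t) (field_coord c X (x t)) < 0.
Proof.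
have [Wt dt] := near_t tab tt.
have XE s : dom M c (gamma s) -> field_coord c X (x s) = X (gamma s) *m coord_change c (gamma s).
  by move=> ds; rewrite /field_coord /x /= phiK.
rewrite lt_neqAle; apply/andP; split.
  pose v := ham_velocity Y (x t) (p t) *m invmx (coord_change c (gamma t)).
  have [|vD vv vw] := @ham_velocity_vector _ _ _ _ _ _ _ frame c (gamma t) Wt dt (p t) v.
    by rewrite /v mulmxKV// coord_change_unit.
  rewrite XE// -vw; last exact: (hX.2 _).1.
  apply: (timelike_metric_neq0 frame Wt dt (v := v)); last exact: hX.2.
  by split => //; rewrite vv pmulr_rlt0// extremal_ham_lt0.
rewrite leNgt; apply/negP => pX; have [e e_gt0 He] := pairing_gt0_near pX.
have [Dx Dp] := extremal_hamilton_at frame hsol tab Wt dt.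
have [d3 d30 Hd3] : exists2 d, 0 < d & forall y, `|y - x t| < d ->
    `|field_coord c X y - field_coord c X (x t)| < e.
  have xt : (phi M c @` dom M c) (x t) by exists (gamma t).
  have := hX.1 c (x t) xt => /cvgrPdistC_lt /(_ e e_gt0) /nbhs_rVP[d d0 Hd].
  by exists d; [exact: d0|exact: Hd].
have [d1 d10 Hd1] := has_derivative_within_near Dx d30.
have [d2 d20 Hd2] := has_derivative_within_near Dp e_gt0.
have d0 : 0 < Num.min e0 (Num.min d1 d2) by rewrite !lt_min e00 d10.
have [s [sab + [[vD vv] vX]]] := ae_near_exists ab tab d0 future_gamma.
rewrite !lt_min => /andP[st /andP[s1 s2]].
have sab' : a <= s <= b by case/andP: sab => ? ?; rewrite !ltW.
have [Ws ds] := near_t sab' st.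
have [_ _ vw] := extremal_velocity frame hsol sab Ws ds.
have sI : [set` `[a, b]] s by rewrite /= in_itv.
have := He (p s) (field_coord c X (x s)) (Hd2 s sI s2) (Hd3 _ (Hd1 s sI s1)).
rewrite XE// -vw; last exact: (hX.2 _).1.
by move=> /lt_trans /(_ vX); rewrite ltxx.
Qed.

End ExtremalInitialCovector.

Lemma curve_restrict (R : realType) (n : nat) (M : smoothManifold R n) (r : nat)
    (S : subLorentzian M r) (X : M -> 'rV[R]_n) (a b t1 t2 : R) (gamma : R -> M) :
  a <= t1 -> t1 < t2 -> t2 <= b -> future_directed_curve S X (Curve a b gamma) ->
  future_directed_curve S X (Curve t1 t2 gamma).
Proof.
move=> at1 t12 t2b [[[[ab cg acg] hor] nspc] fut].
have sub (P : M -> 'rV[R]_n -> Prop) :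
    tangents_ae P (Curve a b gamma) -> tangents_ae P (Curve t1 t2 gamma).
  have FF := ae_filter_ringOfSetsType (@lebesgue_measure R).
  apply: filterS => s Hs; rewrite in_itv /= => /andP[t1s st2]; apply: Hs.
  by rewrite in_itv /= (le_trans at1)// (le_trans st2).
split; last exact: sub.
split; last exact: sub.
split; last exact: sub.
split => //=.
  by apply: continuous_subspaceW cg => s /=; rewrite !in_itv /= => /andP[t1s st2];
    rewrite (le_trans at1)// (le_trans st2).
move=> c s u t1s su ut2; apply: acg => //; [exact: le_trans t1s|exact: le_trans t2b].
Qed.

(** * Maximality inside a chart ball *)

Section LocalMaximizer.
Variables (R : realType) (n : nat) (M : smoothManifold R n) (r : nat).
Variables (S : subLorentzian M r) (W : set M) (E : 'I_r -> M -> 'rV[R]_n).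
Hypothesis frame : orthonormal_frame S W E.
Variables (c : chart M) (X : M -> 'rV[R]_n) (a b : R) (gamma : R -> M) (l : R -> 'cV[R]_n).
Hypothesis hX : time_orientation S X.
Hypothesis hsol : hamiltonian_solution S a b gamma l.
Hypothesis future_gamma : future_directed_curve S X (Curve a b gamma).
Variable t : R.

Let Y i := field_coord c (E i).
Let T := field_coord c X.
Let x := phi M c \o gamma.
Let p s := covector_coord c (gamma s) (l s).
Let k := Num.sqrt (- (2 * ham Y (x t) (p t))).

Hypothesis h0 : ham Y (x t) (p t) < 0.
Variables rho eps K m B : R.
Hypothesis cal : calibrated Y (phi M c @` (W `&` dom M c)) T a b t x p rho eps K m B.

Definition chart_ball : set M := [set q | dom M c q /\ `|phi M c q - x t| < rho].
Local Notation U := chart_ball.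

Lemma chart_ball_frame q : U q -> W q /\ dom M c q.
Proof.
move=> [dq qrho]; have [_ Hball _ _ _] := cal.
have [[q' [Wq' dq'] qq'] _ _] := Hball _ qrho; split => //.
by rewrite -(phiK dq) -qq' (phiK dq').
Qed.

Variables t1 t2 : R.
Hypotheses (at1 : a <= t1) (t12 : t1 < t2) (t2b : t2 <= b).
Hypotheses (t1e : `|t1 - t| <= eps) (t2e : `|t2 - t| <= eps).
Hypothesis segment : forall s, t1 <= s <= t2 -> U (gamma s).

Lemma extremal_joining : joining S X U (gamma t1) (gamma t2) (Curve t1 t2 gamma).
Proof.
by split => //; exact: curve_restrict future_gamma.
Qed.

Lemma extremal_length_ge : ((k * (t2 - t1))%:E <= curve_length S (Curve t1 t2 gamma))%E.
Proof.
rewrite /curve_length /=; apply: integral_ge_cst; [exact: ltW|exact: sqrtr_ge0| |].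
  by move=> s; exact: sqrtr_ge0.
move=> s; rewrite in_itv /= => /andP[t1s st2].
have sab : a < s < b by rewrite (le_lt_trans at1)// (lt_le_trans st2).
have sab' : a <= s <= b by case/andP: sab => ? ?; rewrite !ltW.
have st : `|s - t| <= eps by move: t1e t2e; rewrite !ler_norml; lra.
have [Ws ds] : W (gamma s) /\ dom M c (gamma s).
  by apply/chart_ball_frame/segment; rewrite !ltW.
have [_ vv _] := extremal_velocity frame hsol sab Ws ds.
have [_ _ /(_ s sab' st)[_ hs _ _ _] _ _] := cal.
have vvE := etrans vv (congr1 (fun h => 2 * h) hs).
have h2 : 2 * ham Y (x t) (p t) < 0 by rewrite pmulr_rlt0.
congr Num.sqrt; rewrite -(ltr0_norm h2).
exact: (congr1 Num.norm vvE).
Qed.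

Lemma competitor_length (eta : curve R M) : joining S X U (gamma t1) (gamma t2) eta ->
  (curve_length S eta <= (k * (t2 - t1))%:E)%E /\
  (curve_length S eta = (k * (t2 - t1))%:E -> reparametrization eta (Curve t1 t2 gamma)).
Proof.
move=> [[[[aceta _] _] fut] etaU eta1 eta2].
have [ab ceta acz] := aceta.
have etaW s : s \in `[cleft eta, cright eta] -> W (cmap eta s) /\ dom M c (cmap eta s).
  by move=> /etaU; exact: chart_ball_frame.
have aez := competitor_causal frame hX aceta fut etaW.
set z := phi M c \o cmap eta in aez.
have ACz : absolutely_continuous (cleft eta) (cright eta) z.
  apply: acz => //; first exact: ltW.
  by move=> u; have := etaW u; rewrite in_itv => H /H[].
have z1 : z (cleft eta) = x t1 by rewrite /z /= eta1.
have z2 : z (cright eta) = x t2 by rewrite /z /= eta2.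
have zball s : cleft eta <= s <= cright eta -> `|z s - x t| < rho.
  by move=> sI; have [] := etaU s; rewrite ?in_itv.
have [theta Htheta] := competitor_time_exists cal at1 t12 t2b t1e t2e ACz z1 z2 zball aez.
have w0 s : 0 <= Num.sqrt `|metric S (cmap eta s) (velocity eta s) (velocity eta s)|.
  exact: sqrtr_ge0.
split.
  exact: (competitor_length_le cal h0 at1 t12 t2b t1e t2e ab ACz z1 z2 zball w0 aez Htheta).
move=> len; exists theta; split.
- apply: (ac_dominated (L := n%:R * `|p t| / m) ACz) => s u as_ su ub.
  apply: (competitor_time_lipschitz cal at1 t2b t1e t2e ACz zball aez Htheta).
    by rewrite as_ (le_trans su).
  by rewrite (le_trans as_).
- move=> s u; rewrite !in_itv /= => /andP[as_ _] /andP[_ ub] su.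
  exact: (competitor_time_increasing cal at1 t2b t1e t2e ACz zball aez Htheta).
- exact: (competitor_time_alpha cal at1 t12 t2b t1e t2e ab z1 Htheta).
- exact: (competitor_time_beta cal at1 t12 t2b t1e t2e ab z2 Htheta).
move=> s sI; have [_ ds] := etaW s sI.
move: sI; rewrite in_itv /= => sI.
have zE := competitor_length_eq cal h0 at1 t12 t2b t1e t2e ab ACz z1 z2 zball w0 aez Htheta len sI.
have [dg _] := segment (Htheta s sI).1.
rewrite -(phiK ds) -(phiK dg); congr (psi M c _).
exact: zE.
Qed.

Lemma extremal_maximizer :
  maximizer S X U (gamma t1) (gamma t2) (Curve t1 t2 gamma) /\
  forall eta, maximizer S X U (gamma t1) (gamma t2) eta ->
    reparametrization eta (Curve t1 t2 gamma).
Proof.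
have dE : distance S X U (gamma t1) (gamma t2) = (k * (t2 - t1))%:E.
  rewrite /distance asboolT; last by exists (Curve t1 t2 gamma); exact: extremal_joining.
  apply/eqP; rewrite eq_le; apply/andP; split.
    by apply: ge_ereal_sup => _ [eta /competitor_length[le _] <-].
  apply: le_ereal_sup_tmp; exists (curve_length S (Curve t1 t2 gamma)).
    by exists (Curve t1 t2 gamma) => //; exact: extremal_joining.
  exact: extremal_length_ge.
split; last by move=> eta [/competitor_length[_ H] eE]; apply: H; rewrite eE.
split; first exact: extremal_joining.
apply/eqP; rewrite dE eq_le extremal_length_ge andbT.
(* The extremal is one of its own competitors, which bounds its length from above. *)
by have [] := competitor_length extremal_joining.
Qed.

End LocalMaximizer.

Lemma chart_ball_open (R : realType) (n : nat) (M : smoothManifold R n) (c : chart M)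
    (gamma : R -> M) (t rho : R) : open (chart_ball c gamma t rho).
Proof.
rewrite openE => q [dq qrho].
have nA : nbhs (phi M c q) [set y | `|y - phi M c (gamma t)| < rho].
  apply/nbhs_rVP; exists (rho - `|phi M c q - phi M c (gamma t)|).
    by rewrite subr_gt0.
  move=> y yq /=; have := ler_distD (phi M c q) y (phi M c (gamma t)).
  by move=> /le_lt_trans; apply; rewrite -ltrBrDr.
exact: filterI (chart_dom_near dq) (phi_continuous dq nA).
Qed.

Theorem theorem2 (R : realType) (n r : nat) (M : smoothManifold R n)
    (S : subLorentzian M r) (X : M -> 'rV[R]_n) (hX : time_orientation S X)
    (a b : R) (gamma : R -> M)
    (hgamma_timelike : timelike_curve S (Curve a b gamma))
    (hgamma_future : future_directed_curve S X (Curve a b gamma))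
    (hgamma_extremal : normal_extremal_trajectory S (Curve a b gamma)) :
  forall t : R, t \in `[a, b] ->
  exists U : set M,
    [/\ open U, U (gamma t) &
        let J := connected_component ([set` `[a, b]] `&` gamma @^-1` U) t in
        forall t1 t2 : R, J t1 -> J t2 -> t1 < t2 ->
          maximizer S X U (gamma t1) (gamma t2) (Curve t1 t2 gamma) /\
          forall eta : curve R M,
            maximizer S X U (gamma t1) (gamma t2) eta ->
            reparametrization eta (Curve t1 t2 gamma)].
Proof.
move=> t; rewrite in_itv /= => tab.
have [[[[/= ab _ _] _] _] fut] := hgamma_future.
have [l hsol] := hgamma_extremal; rewrite /= in hsol.
pose c := chart_at M (gamma t); have dt : dom M c (gamma t) := dom_chart_at (gamma t).
have [W [E [frame Wt]]] := orthonormal_frame_exists S (gamma t).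
have [oW sE _ _] := frame.
have [e0 e00 He0] := within_continuous_near hsol.1 tab
  (filterI (open_nbhs_nbhs (conj oW Wt)) (chart_dom_near dt)).
pose Y i := field_coord c (E i).
pose A := phi M c @` (W `&` dom M c).
pose x := phi M c \o gamma.
pose p s := covector_coord c (gamma s) (l s).
have h0 : ham Y (x t) (p t) < 0.
  exact: (extremal_ham_lt0 frame ab hsol hgamma_timelike.2 tab e00 He0).
have pT : pairing (p t) (field_coord c X (x t)) < 0.
  exact: (extremal_pairing_lt0 frame hX ab hsol hgamma_timelike.2 fut tab e00 He0).
have oA : open A by exact: chart_image_open.
have Axt : A (x t) by exists (gamma t).
have SY i : smooth_on A (Y i) by exact: sE.
have cT : {for x t, continuous (field_coord c X)}.
  by apply: hX.1; exists (gamma t).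
have hamilton s : a <= s <= b -> `|s - t| < e0 -> hamilton_at Y a b x p s.
  move=> sab st; have [Ws ds] := He0 s sab st.
  exact: (extremal_hamilton_at frame hsol sab Ws ds).
have [rho [eps [K [m [B cal]]]]] := calibrated_exists oA Axt SY cT h0 pT tab e00 hamilton.
have [[rho0 eps0 _] _ _ _ exit] := cal.
have Ut : chart_ball c gamma t rho (gamma t) by split => //; rewrite subrr normr0.
exists (chart_ball c gamma t rho); split; [exact: chart_ball_open|exact: Ut|].
set J := connected_component _ _ => /=.
have JA s : J s -> a <= s <= b /\ chart_ball c gamma t rho (gamma s).
  by move=> /connected_component_sub[/=]; rewrite in_itv.
have Jt : J t by apply: connected_component_refl; split => //=; rewrite in_itv.
have Jitv : is_interval J by apply/connected_intervalP; exact: component_connected.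
have Jeps s : J s -> `|s - t| <= eps.
  (* As [J] is an interval containing [t], a point of [J] farther than [eps] from [t] would put
     [t + eps] or [t - eps] into [J], where the extremal is outside the ball. *)
  move=> Js; rewrite leNgt; apply/negP => es.
  have [u [Ju ue]] : exists u, J u /\ `|u - t| = eps.
    have [ts|st] := leP t s.
      exists (t + eps); split; last by rewrite addrC addKr gtr0_norm.
      apply: (Jitv t s) => //; move: es; rewrite ger0_norm ?subr_ge0// ltrBrDl => es.
      by rewrite lerDl (ltW eps0) ltW.
    exists (t - eps); split; last by rewrite addrC addKr normrN gtr0_norm.
    apply: (Jitv s t) => //; move: es; rewrite ltr0_norm ?subr_lt0// opprB ltrBrDr => es.
    by rewrite gerBl (ltW eps0) andbT lerBrDl ltW.
  have [uab [_ urho]] := JA u Ju.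
  by have := exit u uab ue; rewrite leNgt urho.
move=> t1 t2 Jt1 Jt2 t12.
have [/andP[at1 _] _] := JA t1 Jt1; have [/andP[_ t2b] _] := JA t2 Jt2.
apply: (extremal_maximizer frame hX hsol hgamma_future h0 cal at1 t12 t2b) => //.
- exact: Jeps.
- exact: Jeps.
by move=> s sI; apply: (JA s _).2; exact: Jitv sI.
Qed.
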